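(* Let $\epsilon\in(0,\infty)$, $\alpha\in[0,1)$, $\beta\in(\alpha^2,1)$, $p\in[2,\infty)$, and let $(\gamma_n)_{n\in\mathbb N}\subseteq(0,\infty)$ be a non-summable decreasing sequence converging to zero which satisfies $\sup_{\varepsilon\in(0,\infty)}\liminf_{n\to\infty}\bigl((\gamma_n)^{-1}\gamma_{n+\lceil(\gamma_n)^{-1}\varepsilon\rceil}\bigr)>0$ and $\sum_{n=1}^\infty(\gamma_n)^{1+p/3}<\infty$. Let $d\in\mathbb N$, $\vartheta\in\mathbb R^d$, let $(X,U)$ be a locally $p$-regular innovation, let $(\theta_n)_{n\in\mathbb N_0}$ be the Adam algorithm with innovation $(X,U)$, step-sizes $(\gamma_n)_{n\in\mathbb N}$ and damping parameters $(\alpha,\beta,\epsilon)$ started in $\vartheta$, and let $(\Psi_t)_{t\in[0,\infty)}$ be the semiflow of the corresponding Adam vector field $f$. Let $\mathcal D\subset\mathbb R^d$ be compact and let $\theta^*\in\operatorname{int}(\mathcal D)$ satisfy $$\lim_{t\to\infty}\Psi_t(\theta)=\theta^*,\quad\text{uniformly in }\theta\in\mathcal D.$$ Then, almost surely on the event $\{\theta_n\in\mathcal D\text{ for infinitely many }n\in\mathbb N_0\}$, one has $$\lim_{n\to\infty}\theta_n=\theta^* .$$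
   Context: Innovation: a pair $(X,U)$ where $U$ is a random variable on a probability space $(\Omega,\mathcal F,\mathbb P)$ with values in a measurable space $\mathcal U$ and $X:\mathcal U\times\mathbb R^d\to\mathbb R^d$ is product measurable. $X^{(j)}$ is the $j$-th component. For $p\in[2,\infty)$, $(X,U)$ is locally $p$-regular if there is a continuous $c:\mathbb R\to\mathbb R$ such that for all $\theta,\vartheta\in\mathbb R^d$: $\mathbb E[|X(U,\theta)|^p]\le c(0)(1+e^{c(0)|\theta|})$ and $\mathbb E[|X(U,\theta)-X(U,\vartheta)|^p]\le c(|\theta|+|\vartheta|)\,|\theta-\vartheta|^p$. Adam algorithm with innovation $(X,U)$, step-sizes $(\gamma_n)_{n\in\mathbb N}$, damping parameters $(\alpha,\beta,\epsilon)$, started in $\vartheta$: a process $(\theta_n)_{n\in\mathbb N_0}$ in $\mathbb R^d$ for which there are i.i.d. copies $U_1,U_2,\dots$ of $U$ such that $\theta_0=\vartheta$, $m_0=v_0=0\in\mathbb R^d$, and for all $n\in\mathbb N$, $j\in\{1,\dots,d\}$: $$m_n=\alpha m_{n-1}+(1-\alpha)X(U_n,\theta_{n-1}),\quad v_n^{(j)}=\beta v_{n-1}^{(j)}+(1-\beta)(X^{(j)}(U_n,\theta_{n-1}))^2,$$ $$\sigma_n^{(j)}=\bigl(\sqrt{v_n^{(j)}/(1-\beta^n)}+\epsilon\bigr)^{-1},\quad \theta_n^{(j)}=\theta_{n-1}^{(j)}+\gamma_n\sigma_n^{(j)}m_n^{(j)}.$$ Adam vector field $f=(f^{(1)},\dots,f^{(d)}):\mathbb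 R^d\to\mathbb R^d$ of $(X,U)$ with damping parameters $(\alpha,\beta,\epsilon)$: with $(U_k)_{k\in\mathbb Z,k\le0}$ i.i.d. copies of $U$ (and $0^0=1$), $$f^{(j)}(\theta)=(1-\alpha)\,\mathbb E\Bigl[\Bigl(\Bigl[(1-\beta)\sum_{k=-\infty}^0\beta^{-k}|X^{(j)}(U_k,\theta)|^2\Bigr]^{1/2}+\epsilon\Bigr)^{-1}\sum_{k=-\infty}^0\alpha^{-k}X^{(j)}(U_k,\theta)\Bigr].$$ Semiflow: $\Psi_t:\mathbb R^d\to\mathbb R^d$, $t\in[0,\infty)$, solves $\dot\Psi_t(\theta)=f(\Psi_t(\theta))$, $\Psi_0(\theta)=\theta$ (for locally $p$-regular innovations and $\alpha<\sqrt\beta$ the field $f$ is bounded and locally Lipschitz, so the solution exists uniquely for all $t\ge0$). *)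

(* Defs.v *)
From HB Require Import structures.
From mathcomp Require Export all_boot all_order all_algebra.
From mathcomp Require Export all_classical all_reals all_analysis.

Set Implicit Arguments.
Unset Strict Implicit.
Unset Printing Implicit Defensive.

Export numFieldNormedType.Exports.
Import Order.TTheory GRing.Theory Num.Theory.

Local Open Scope classical_set_scope.
Local Open Scope ring_scope.

(* The library norm on row vectors is the maximum norm (it induces the same
   topology); quantitative bounds below use the Euclidean norm. *)
Definition enorm (R : realType) (d : nat) (x : 'rV[R]_d) : R :=
  Num.sqrt (\sum_(j < d) x 0 j ^+ 2).

(* Row vectors carry no sigma-algebra in the library. *)
Notation borelRV R d := (g_sigma_algebraType (@open 'rV[R]_d)).

Definition product_measurable (R : realType) (d : nat) (dU : measure_display)
    (cU : measurableType dU) (X : cU -> 'rV[R]_d -> 'rV[R]_d) : Prop :=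
  measurable_fun [set: cU * borelRV R d]
    (fun z : cU * borelRV R d => (X z.1 z.2 : borelRV R d)).

Section Innovation.
Context (R : realType) (dU : measure_display) (cU : measurableType dU).

Definition independent_family (dO : measure_display) (O : measurableType dO)
    (P : probability O R) (V : nat -> {RV P >-> cU}) : Prop :=
  forall (s : seq nat) (A : nat -> set cU), uniq s ->
    (forall i, measurable (A i)) ->
    P (\bigcap_(i in [set` s]) (V i @^-1` A i)) =
    (\prod_(i <- s) P (V i @^-1` A i))%E.

Definition iid_copies (dO : measure_display) (O : measurableType dO)
    (P : probability O R) (U : {RV P >-> cU})
    (dO' : measure_display) (O' : measurableType dO') (P' : probability O' R)
    (V : nat -> {RV P' >-> cU}) : Prop :=
  independent_family V /\
  forall i (A : set cU), measurable A ->
    distribution P' (V i) A = distribution P U A.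

Context (d : nat) (X : cU -> 'rV[R]_d -> 'rV[R]_d).

Definition locally_regular (p : R) (dO : measure_display)
    (O : measurableType dO) (P : probability O R) (U : {RV P >-> cU}) : Prop :=
  exists c : R -> R, continuous c /\
    forall theta vartheta : 'rV[R]_d,
      ('E_P[fun w => (enorm (X (U w) theta) `^ p)%R] <=
         (c 0 * (1 + expR (c 0 * enorm theta)))%:E)%E /\
      ('E_P[fun w => (enorm (X (U w) theta - X (U w) vartheta) `^ p)%R] <=
         (c (enorm theta + enorm vartheta)
            * enorm (theta - vartheta) `^ p)%:E)%E.

(* [Us n] is the n-th sample for n >= 1; [Us 0] plays no role. *)
Definition adam_algorithm (dO : measure_display) (O : measurableType dO)
    (P : probability O R) (U : {RV P >-> cU}) (gamma : nat -> R)
    (alpha beta epsilon : R) (start : 'rV[R]_d)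
    (dO' : measure_display) (O' : measurableType dO') (P' : probability O' R)
    (theta : nat -> O' -> 'rV[R]_d) : Prop :=
  exists (Us : nat -> {RV P' >-> cU}) (m v : nat -> O' -> 'rV[R]_d),
  [/\ iid_copies U (fun n => Us n.+1),
      forall w, [/\ theta 0%N w = start, m 0%N w = 0 & v 0%N w = 0] &
      forall n w (j : 'I_d),
        let x := X (Us n.+1 w) (theta n w) in
        let sigma :=
          (Num.sqrt (v n.+1 w 0 j / (1 - beta ^+ n.+1)) + epsilon)^-1 in
        [/\ m n.+1 w = alpha *: m n w + (1 - alpha) *: x,
            v n.+1 w 0 j = beta * v n w 0 j + (1 - beta) * x 0 j ^+ 2 &
            theta n.+1 w 0 j =
              theta n w 0 j + gamma n.+1 * sigma * m n.+1 w 0 j]].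

(* The family (U_k)_{k <= 0} is encoded as [V k] = U_{-k}. For a locally
   p-regular innovation with p >= 2 and alpha^2 < beta < 1 both series converge
   almost surely and the integrand is bounded, so the values of [limn] on
   divergent sequences and of [fine] at infinity do not matter. *)
Definition adam_field (alpha beta epsilon : R)
    (dO : measure_display) (O : measurableType dO) (P : probability O R)
    (V : nat -> {RV P >-> cU}) (theta : 'rV[R]_d) : 'rV[R]_d :=
  \row_(j < d)
    ((1 - alpha) * fine 'E_P[fun w =>
      (Num.sqrt ((1 - beta) *
         limn (series (fun k => beta ^+ k * `|X (V k w) theta 0 j| ^+ 2)))
       + epsilon)^-1
      * limn (series (fun k => alpha ^+ k * X (V k w) theta 0 j))]).

End Innovation.

(* Solutions on [0, +oo[: at t = 0 the derivative is the right derivative.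
   Values of [Psi] at negative times play no role. *)
Definition semiflow (R : realType) (d : nat) (f : 'rV[R]_d -> 'rV[R]_d)
    (Psi : R -> 'rV[R]_d -> 'rV[R]_d) : Prop :=
  forall theta : 'rV[R]_d,
  [/\ Psi 0 theta = theta,
      h^-1 *: (Psi h theta - Psi 0 theta) @[h --> 0^'+] --> f (Psi 0 theta) &
      forall t : R, 0 < t ->
        is_derive t 1 (fun s : R => Psi s theta) (f (Psi t theta))].

(* Main.v *)
From HB Require Import structures.
Require Import Defs.
From mathcomp Require Import all_boot all_order all_algebra.
From mathcomp Require Import all_classical all_reals all_analysis.
From mathcomp Require Import measurable_realfun.
From mathcomp Require Import ring lra.
Set Implicit Arguments.
Unset Strict Implicit.
Unset Printing Implicit Defensive.
Import Order.TTheory GRing.Theory Num.Theory.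
Local Open Scope classical_set_scope.
Local Open Scope ring_scope.

(** The idea of the proof: along windows of algorithmic time [h] the algorithm
    makes Euler steps of the ordinary differential equation of the Adam vector
    field, with an error of order [h ^ 2]; a flow that attracts a compact set
    uniformly then also attracts everything that shadows it this well.

    The algorithm has a deterministic speed. By Cauchy-Schwarz the momentum is
    at most a constant times the root of the second moment, because
    [alpha ^ 2 < beta] makes the weights summable ([momentum_step]); hence a step
    of size [gamma] moves the position by at most [adam_speed * gamma], whatever
    the gradients are.

    The vector field is the limit of the means of frozen steps, in which all
    gradients are evaluated at one position. Since the root of the second moment
    is a Euclidean norm, it forgets its past at the geometric rate [sqrt beta];
    so the frozen means converge geometrically ([frozen_mean_cauchy]), and the
    local Lipschitz bound of the innovation passes to the field
    ([adam_field_lip]).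

    A window is cut into blocks of about [gamma ^ (-1/2)] steps, and every block
    is compared with the frozen dynamics at its first position ([block_le]).
    Three random errors arise. The memory of earlier gradients and the motion
    within a block have [p]-th moments of order [gamma ^ (p/2)]; the noise of a
    window is a martingale with bounded increments, so large values have a
    probability that is exponentially small in [gamma ^ (-1/2)]
    ([window_noise_expR]). All three probabilities are [O(gamma ^ (p/3))] at the
    start of the window, and [gamma ^ (p/3)] is summable along the grid of
    windows because [h * gamma ^ (p/3)] is at most the sum of
    [gamma ^ (1 + p/3)] over the preceding window ([grid_summable]). By
    Borel-Cantelli almost surely only finitely many windows are bad. Moments of
    the gradients along the path are available although the path need not stay
    bounded: a weight decreasing exponentially in the position compensates the
    growth of the innovation ([memory_moment]).

    The rest is deterministic. By a discrete Gronwall inequality the grid points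
    shadow the semiflow over bounded times ([shadowing]). A visit to the compact
    set is close to a grid point; from there the grid reaches a small
    neighbourhood of the attractor, inside the compact set, stays in it during a
    further waiting time of the same length, and may be restarted from there
    ([attracted]). *)

(** * Real inequalities *)

Section RealInequalities.
Context {R : realType}.
Implicit Types (p q c x y : R).

Lemma expR_le_quadratic y : y <= 2^-1 -> expR y <= 1 + y + 2 * y ^+ 2.
Proof.
move=> y2; have y1 : 0 < 1 - y by lra.
rewrite -[y in expR y]opprK expRN.
have h : 1 - y <= expR (- y) by exact: expR_ge1Dx.
rewrite (@le_trans _ _ (1 - y)^-1)//.
  by rewrite lef_pV2 ?posrE// (lt_le_trans y1).
rewrite -[_^-1]mul1r ler_pdivrMr//.
have : 0 <= y ^+ 2 * (1 - 2 * y) by rewrite mulr_ge0 ?sqr_ge0//; lra.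
by move=> hh; rewrite -subr_ge0; apply: le_trans hh _; rewrite le_eqVlt; apply/orP; left; apply/eqP; ring.
Qed.

(** Exponential decay beats any power. *)
Lemma expRN_le_powR q c : 0 < q -> 0 < c ->
  exists2 C, 0 < C & forall x, 0 < x -> expR (- (c * x)) <= C * x `^ (- q).
Proof.
move=> q0 c0; exists (expR (q * ln (q / c))); first exact: expR_gt0.
move=> x x0; rewrite /powR (gt_eqF x0) -expRD ler_expR.
have qc : 0 < q / c by rewrite divr_gt0.
have : ln (x / (q / c)) < x / (q / c) by apply: ln_sublinear; rewrite divr_gt0.
rewrite ln_div ?posrE// => h.
have : q * (ln x - ln (q / c)) < q * (x / (q / c)) by rewrite ltr_pM2l.
rewrite (_ : q * (x / (q / c)) = c * x); first by lra.
by field; rewrite !gt_eqF.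
Qed.

Lemma convex_powR2 p (t x y : R) : 1 <= p -> 0 <= t -> t <= 1 -> 0 <= x -> 0 <= y ->
  (t * x + (1 - t) * y) `^ p <= t * x `^ p + (1 - t) * y `^ p.
Proof.
move=> p1 t0 t1 x0 y0.
have t01 : Itv.spec (@Itv.num_sem R) (Itv.Real `[0%Z, 1%Z]) t.
  by rewrite /Itv.spec/= /Itv.num_sem/= in_itv/= t0 t1 ger0_real.
have := @convex_powR R p p1 (Itv.mk t01) x y.
by rewrite !inE /= !in_itv /= !andbT => /(_ x0 y0).
Qed.

(** Convexity with weights [t] and [1 - t]. With [t] the discount rate, the
    [p]-th powers of a discounted sum satisfy a recursion of the same rate. *)
Lemma powRD_le p x y (t : R) : 1 <= p -> 0 < t -> t < 1 -> 0 <= x -> 0 <= y ->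
  (t * x + y) `^ p <= t * x `^ p + (1 - t) `^ (1 - p) * y `^ p.
Proof.
move=> p1 t0 t1 x0 y0; have s0 : 0 < 1 - t by lra.
have := @convex_powR2 p t x (y / (1 - t)) p1 (ltW t0) (ltW t1) x0 (divr_ge0 y0 (ltW s0)).
rewrite mulrCA divff ?gt_eqF// mulr1 => /le_trans; apply; rewrite lerD2l.
rewrite powRM ?invr_ge0 ?(ltW s0)// mulrCA mulrC ler_wpM2r ?powR_ge0//.
by rewrite -powR_inv1 ?(ltW s0)// -powRrM mulN1r powRD ?powRr1 ?(ltW s0)// (gt_eqF s0) implybT.
Qed.

Lemma le_1DpowR p x : 1 <= p -> 0 <= x -> x <= 1 + x `^ p.
Proof.
move=> p1 x0; have [x1|x1] := leP 1 x.
  by rewrite (le_trans (le1r_powR x1 p1))// lerDr.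
by rewrite (le_trans (ltW x1))// lerDl powR_ge0.
Qed.

(** Jensen's inequality, scaled so as to avoid a division by the weight. *)
Lemma powR_sum_le p (I : Type) (s : seq I) (w x : I -> R) : 1 <= p ->
  (forall i, 0 < w i) -> (forall i, 0 <= x i) ->
  (\sum_(i <- s) w i * x i) `^ p <=
  (\sum_(i <- s) w i) `^ (p - 1) * \sum_(i <- s) w i * x i `^ p.
Proof.
move=> p1 w0 x0; have p0 : 0 < p by lra.
have sw0 (r : seq I) : 0 <= \sum_(i <- r) w i.
  by apply: sumr_ge0 => i _; exact: ltW.
have sx0 (r : seq I) : 0 <= \sum_(i <- r) w i * x i.
  by apply: sumr_ge0 => i _; rewrite mulr_ge0 ?(ltW (w0 i)).
have mean : 0 < \sum_(i <- s) w i ->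
    ((\sum_(i <- s) w i * x i) / \sum_(i <- s) w i) `^ p <=
    (\sum_(i <- s) w i * x i `^ p) / \sum_(i <- s) w i.
  elim: s => [|i s IH]; first by rewrite !big_nil ltxx.
  rewrite !big_cons => WW.
  have [s0|s0] := leP (\sum_(j <- s) w j) 0.
    have -> : s = [::].
      case: s s0 {IH WW} => // j s; rewrite big_cons leNgt => /negP[].
      by rewrite ltr_wpDr.
    by rewrite !big_nil !addr0 [w i * x i]mulrC [w i * _ `^ p]mulrC !mulfK ?gt_eqF.
  have := IH s0.
  set W := \sum_(j <- s) w j in WW s0 *.
  set S := \sum_(j <- s) w j * x j.
  set Q := \sum_(j <- s) w j * x j `^ p => IHs.
  pose t := w i / (w i + W).
  have t0 : 0 <= t by rewrite divr_ge0 ?(ltW (w0 i)) ?(ltW WW).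
  have t1 : t <= 1 by rewrite ler_pdivrMr// mul1r lerDl ltW.
  have SW0 : 0 <= S / W by rewrite divr_ge0 ?(ltW s0)// sx0.
  have E : 1 - t = W / (w i + W) by rewrite /t; field; rewrite gt_eqF.
  have -> : (w i * x i + S) / (w i + W) = t * x i + (1 - t) * (S / W).
    by rewrite E /t; field; rewrite !gt_eqF.
  apply: (le_trans (convex_powR2 p1 t0 t1 (x0 i) SW0)).
  have -> : (w i * x i `^ p + Q) / (w i + W) = t * x i `^ p + (1 - t) * (Q / W).
    by rewrite E /t; field; rewrite !gt_eqF.
  by rewrite lerD2l ler_wpM2l// subr_ge0.
have [W0|W0] := leP (\sum_(i <- s) w i) 0.
  case: s W0 {mean} => [_|j s].
    by rewrite !big_nil mulr0 (powR0 (lt0r_neq0 p0)).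
  by rewrite big_cons leNgt => /negP[]; rewrite ltr_wpDr.
have {mean} := mean W0; set W := \sum_(i <- s) w i in W0 *.
set S := \sum_(j <- s) w j * x j; set Q := \sum_(j <- s) w j * x j `^ p => h.
have -> : S = W * (S / W) by field; rewrite gt_eqF.
have -> : W `^ (p - 1) * Q = W `^ p * (Q / W).
  rewrite -(mulr_powRB1 (ltW W0) p0); field; rewrite gt_eqF//.
by rewrite powRM ?divr_ge0 ?(ltW W0) ?sx0// ler_wpM2l ?powR_ge0.
Qed.

End RealInequalities.

(** * The Adam recursion for one coordinate *)

(** Both moments of the algorithm, the memory of its gradients and the errors
    of comparison all obey recursions of this form. *)
Fixpoint dsum {R : realType} (r : R) (x : nat -> R) (e0 : R) (n : nat) : R :=
  if n is k.+1 then r * dsum r x e0 k + x k else e0.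

Section Discounted.
Context {R : realType} (r : R).
Implicit Types x y : nat -> R.

Lemma dsumE x e0 n :
  dsum r x e0 n = r ^+ n * e0 + \sum_(k < n) r ^+ k * x (n - k.+1)%N.
Proof.
elim: n => [|n IH]; first by rewrite big_ord0 addr0 expr0 mul1r.
rewrite /= IH big_ord_recl expr0 mul1r subn1 /= mulrDr mulrA -exprS.
rewrite -addrA; congr (_ + _); rewrite addrC; congr (_ + _).
by rewrite mulr_sumr; apply: eq_bigr => i _; rewrite mulrA -exprS.
Qed.

Hypothesis r0 : 0 <= r.

Lemma ler_dsum x y e0 e1 n : e0 <= e1 -> (forall k, (k < n)%N -> x k <= y k) ->
  dsum r x e0 n <= dsum r y e1 n.
Proof.
move=> e01; elim: n => //= n IH xy; apply: lerD; last exact: xy.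
by rewrite ler_wpM2l// IH// => k kn; apply: xy; rewrite ltnW.
Qed.

Lemma dsum_ge0 x e0 n : 0 <= e0 -> (forall k, 0 <= x k) -> 0 <= dsum r x e0 n.
Proof. by move=> e0_ge0 x0; elim: n => //= n IH; rewrite addr_ge0// mulr_ge0. Qed.

(** An input contributes to all later values at most its multiple by the
    geometric series. *)
Lemma sum_dsum_le x e0 n : r < 1 -> 0 <= e0 -> (forall k, 0 <= x k) ->
  (1 - r) * \sum_(i < n) dsum r x e0 i.+1 <= e0 + \sum_(k < n) x k.
Proof.
move=> r1 e00 x0.
have E : (1 - r) * \sum_(i < n) dsum r x e0 i.+1 + r * dsum r x e0 n =
    r * e0 + \sum_(k < n) x k.
  elim: n => [|n IH]; first by rewrite !big_ord0 mulr0 add0r addr0.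
  rewrite !big_ord_recr /=; set S := \sum_(i < n) _ in IH *.
  rewrite [RHS]addrA -IH; ring.
have : 0 <= r * dsum r x e0 n by rewrite mulr_ge0// dsum_ge0.
have : r * e0 <= e0 by rewrite ler_piMl// ltW.
by move: E; lra.
Qed.

End Discounted.

Section AdamScalar.
Context {R : realType} (alpha beta epsilon : R).
Hypotheses (epsilon_gt0 : 0 < epsilon).
Hypotheses (alpha_ge0 : 0 <= alpha) (alpha_lt1 : alpha < 1).
Hypotheses (alpha2_lt_beta : alpha ^+ 2 < beta) (beta_lt1 : beta < 1).

Definition adam_rate : R := Num.sqrt beta.
(** The Cauchy-Schwarz constant of [momentum_step]: its square is [(1 - alpha)^2]
    times [sum_k (alpha^2 / beta)^k], divided by [1 - beta]. *)
Definition adam_speed : R :=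
  Num.sqrt ((1 - alpha) ^+ 2 * beta / ((1 - beta) * (beta - alpha ^+ 2))).
Definition adam_ratio (m v : R) : R := m / (Num.sqrt v + epsilon).
Definition mom (x : nat -> R) := dsum alpha (fun k => (1 - alpha) * x k).
Definition vel (x : nat -> R) := dsum beta (fun k => (1 - beta) * x k ^+ 2).

Local Notation rho := adam_rate.
Local Notation C0 := adam_speed.

Lemma beta_gt0 : 0 < beta.
Proof. by rewrite (le_lt_trans _ alpha2_lt_beta)// sqr_ge0. Qed.

Lemma adam_rate_gt0 : 0 < rho.
Proof. by rewrite sqrtr_gt0 beta_gt0. Qed.

Lemma adam_rate_lt1 : rho < 1.
Proof. by rewrite -[X in _ < X]sqrtr1 ltr_sqrt. Qed.

Lemma adam_rate2 : rho ^+ 2 = beta.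
Proof. by rewrite sqr_sqrtr// ltW// beta_gt0. Qed.

Lemma alpha_le_rate : alpha <= rho.
Proof.
by rewrite -(ger0_norm alpha_ge0) -sqrtr_sqr ler_wsqrtr// ltW.
Qed.

Lemma adam_speed_ge0 : 0 <= C0. Proof. exact: sqrtr_ge0. Qed.

Lemma adam_speed2 :
  C0 ^+ 2 = (1 - alpha) ^+ 2 * beta / ((1 - beta) * (beta - alpha ^+ 2)).
Proof.
have h1 : 0 <= 1 - beta by rewrite subr_ge0 ltW.
have h2 : 0 <= beta - alpha ^+ 2 by rewrite subr_ge0 ltW.
by rewrite sqr_sqrtr// divr_ge0 ?(mulr_ge0 h1 h2)// mulr_ge0 ?sqr_ge0 ?(ltW beta_gt0).
Qed.

(** Momentum is dominated by the root mean square of the same gradients: a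
    Cauchy-Schwarz estimate, in which [alpha ^+ 2 < beta] makes the weights
    summable. This is what bounds every step of the algorithm. *)
Lemma momentum_step m v x : m ^+ 2 <= C0 ^+ 2 * v ->
  (alpha * m + (1 - alpha) * x) ^+ 2 <=
  C0 ^+ 2 * (beta * v + (1 - beta) * x ^+ 2).
Proof.
move=> mv; have b0 := beta_gt0; have d0 : 0 < beta - alpha ^+ 2 by rewrite subr_gt0.
have e0 : 0 < 1 - beta by rewrite subr_gt0.
set K := C0 ^+ 2 in mv *.
have KE : K * ((1 - beta) * (beta - alpha ^+ 2)) = (1 - alpha) ^+ 2 * beta.
  by rewrite /K adam_speed2 divfK// mulf_neq0// gt_eqF.
set y := (1 - alpha) * x.
have h1 : (beta - alpha ^+ 2) * (alpha * m + y) ^+ 2 <=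
    (beta - alpha ^+ 2) * (beta * m ^+ 2) + beta * y ^+ 2.
  rewrite -subr_ge0 (_ : _ - _ = ((beta - alpha ^+ 2) * m - alpha * y) ^+ 2).
    exact: sqr_ge0.
  ring.
rewrite -(ler_pM2l d0) (le_trans h1)//.
have -> : beta * y ^+ 2 = (beta - alpha ^+ 2) * (K * ((1 - beta) * x ^+ 2)).
  transitivity ((1 - alpha) ^+ 2 * beta * x ^+ 2); first by rewrite /y; ring.
  by rewrite -KE; ring.
have -> : K * (beta * v + (1 - beta) * x ^+ 2) =
  beta * (K * v) + K * ((1 - beta) * x ^+ 2) by ring.
by rewrite [X in _ <= X]mulrDr lerD2r !ler_pM2l.
Qed.

Lemma momentum_le x m v n : m ^+ 2 <= C0 ^+ 2 * v ->
  mom x m n ^+ 2 <= C0 ^+ 2 * vel x v n.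
Proof. by move=> mv; elim: n => //= n; exact: momentum_step. Qed.

Lemma vel_ge0 x v n : 0 <= v -> 0 <= vel x v n.
Proof.
move=> v0; apply: dsum_ge0 => //; first exact/ltW/beta_gt0.
by move=> k; rewrite mulr_ge0 ?sqr_ge0// subr_ge0 ltW.
Qed.

Lemma abs_le_speed m v : 0 <= v -> m ^+ 2 <= C0 ^+ 2 * v -> `|m| <= C0 * Num.sqrt v.
Proof.
move=> v0 mv.
rewrite -sqrtr_sqr -[X in _ <= X * _](ger0_norm adam_speed_ge0) -sqrtr_sqr.
by rewrite -sqrtrM ?sqr_ge0// ler_wsqrtr.
Qed.

Lemma adam_ratio_le m v v' : 0 <= v -> v <= v' -> m ^+ 2 <= C0 ^+ 2 * v ->
  `|adam_ratio m v'| <= C0.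
Proof.
move=> v0 vv' mv; have s0 : 0 <= Num.sqrt v' by exact: sqrtr_ge0.
have e0 := epsilon_gt0.
have p0 : 0 < Num.sqrt v' + epsilon by lra.
rewrite normrM normfV (gtr0_norm p0) ler_pdivrMr//.
apply: (le_trans (abs_le_speed v0 mv)); rewrite ler_wpM2l ?adam_speed_ge0//.
by rewrite (le_trans (ler_wsqrtr vv'))// lerDl ltW.
Qed.

(** The difference is that of the numerators plus the bounded quotient
    [m' / (sqrt v' + epsilon)] times the difference of the denominators, divided
    by a quantity above [epsilon]. Measuring in [sqrt v] and not in [v] makes
    this independent of the size of the gradients. *)
Lemma adam_ratio_lip m v m' v' : 0 <= v' -> m' ^+ 2 <= C0 ^+ 2 * v' ->
  `|adam_ratio m v - adam_ratio m' v'| <=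
  (`|m - m'| + C0 * `|Num.sqrt v - Num.sqrt v'|) / epsilon.
Proof.
move=> v0 mv; have hm := abs_le_speed v0 mv.
have e0 := epsilon_gt0.
have a0 : 0 <= Num.sqrt v by exact: sqrtr_ge0.
have b0 : 0 <= Num.sqrt v' by exact: sqrtr_ge0.
rewrite /adam_ratio; set a := Num.sqrt v in a0 *; set b := Num.sqrt v' in b0 hm *.
have -> : m / (a + epsilon) - m' / (b + epsilon) =
    ((m - m') + m' / (b + epsilon) * (b - a)) / (a + epsilon).
  by field; rewrite !gt_eqF//; lra.
have r1 : `|m' / (b + epsilon)| <= C0.
  rewrite normrM normfV (@gtr0_norm _ (b + epsilon)); last by lra.
  rewrite ler_pdivrMr; last by lra.
  by rewrite (le_trans hm)// ler_wpM2l ?adam_speed_ge0//; lra.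
rewrite normrM normfV (@gtr0_norm _ (a + epsilon)); last by lra.
apply: ler_pM => //.
- by rewrite invr_ge0; lra.
- rewrite (le_trans (ler_normD _ _))// lerD2l normrM distrC.
  by rewrite ler_wpM2r.
- by rewrite lef_pV2 ?posrE//; lra.
Qed.

(** Replacing the corrected second moment [v / (1 - b)] by [v] costs a
    multiple of the correction [b], uniformly in the size of [v]. *)
Lemma adam_ratio_bias m v b : 0 <= v -> m ^+ 2 <= C0 ^+ 2 * v -> 0 <= b -> b < 1 ->
  `|adam_ratio m (v / (1 - b)) - adam_ratio m v| <= C0 * b.
Proof.
move=> v0 mv b0 b1; have hm := abs_le_speed v0 mv.
have e0 := epsilon_gt0.
have d0 : 0 < 1 - b by lra.
have vd : v <= v / (1 - b) by rewrite ler_pdivlMr// ler_piMr//; lra.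
have ab := ler_wsqrtr vd.
have a0 : 0 <= Num.sqrt v by exact: sqrtr_ge0.
have sd : (1 - b) * Num.sqrt (v / (1 - b)) <= Num.sqrt v.
  have -> : Num.sqrt v = Num.sqrt (v / (1 - b)) * Num.sqrt (1 - b).
    by rewrite -sqrtrM ?divfK ?(lt0r_neq0 d0)// divr_ge0// ltW.
  rewrite mulrC ler_wpM2l ?sqrtr_ge0//.
  rewrite -[X in X <= _](ger0_norm (ltW d0)) -sqrtr_sqr ler_wsqrtr//.
  by rewrite expr2 ler_piMl ?(ltW d0)// gerBl.
rewrite /adam_ratio.
set a := Num.sqrt v in a0 hm ab sd *.
set a' := Num.sqrt (v / (1 - b)) in ab sd *.
have -> : m / (a' + epsilon) - m / (a + epsilon) =
    - (m / (a + epsilon) * ((a' - a) / (a' + epsilon))).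
  by field; rewrite !gt_eqF//; lra.
rewrite normrN normrM; apply: ler_pM => //.
  rewrite normrM normfV (@gtr0_norm _ (a + epsilon)); last by lra.
  rewrite ler_pdivrMr; last by lra.
  by rewrite (le_trans hm)// ler_wpM2l ?adam_speed_ge0//; lra.
rewrite ger0_norm; last by rewrite divr_ge0; lra.
rewrite ler_pdivrMr; last by lra.
have : 0 <= b * epsilon by rewrite mulr_ge0// ltW.
by nra.
Qed.

(** The triangle inequality of the Euclidean norm of the plane. *)
Lemma sqrt_sqD_le (p q r s : R) : Num.sqrt (p ^+ 2 + q ^+ 2) <=
  Num.sqrt (r ^+ 2 + s ^+ 2) + (`|p - r| + `|q - s|).
Proof.
have rs0 : 0 <= r ^+ 2 + s ^+ 2 by rewrite addr_ge0 ?sqr_ge0.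
set S := Num.sqrt (r ^+ 2 + s ^+ 2).
have S0 : 0 <= S by exact: sqrtr_ge0.
have S2 : S ^+ 2 = r ^+ 2 + s ^+ 2 by rewrite sqr_sqrtr.
have rS : `|r| <= S by rewrite -sqrtr_sqr ler_wsqrtr// lerDl sqr_ge0.
have sS : `|s| <= S by rewrite -sqrtr_sqr ler_wsqrtr// lerDr sqr_ge0.
set A := `|p - r|; set B := `|q - s|.
have A0 : 0 <= A by exact: normr_ge0.
have B0 : 0 <= B by exact: normr_ge0.
have A2 : (p - r) ^+ 2 = A ^+ 2 by rewrite /A real_normK ?num_real.
have B2 : (q - s) ^+ 2 = B ^+ 2 by rewrite /B real_normK ?num_real.
have rA : r * (p - r) <= S * A.
  by rewrite (le_trans (ler_norm _))// normrM ler_pM.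
have sB : s * (q - s) <= S * B.
  by rewrite (le_trans (ler_norm _))// normrM ler_pM.
rewrite -(@ler_pXn2r _ 2) ?nnegrE ?sqrtr_ge0 ?addr_ge0//.
rewrite sqr_sqrtr ?addr_ge0 ?sqr_ge0//.
have AB : 0 <= A * B by rewrite mulr_ge0.
by nra.
Qed.

Lemma dist_sqrt_sqD_le (p q r s : R) :
  `|Num.sqrt (p ^+ 2 + q ^+ 2) - Num.sqrt (r ^+ 2 + s ^+ 2)| <=
  `|p - r| + `|q - s|.
Proof.
have h1 := sqrt_sqD_le p q r s; have := sqrt_sqD_le r s p q.
rewrite [`|r - p|]distrC [`|s - q|]distrC => h2.
by rewrite ler_norml; apply/andP; split; lra.
Qed.

(** The root of the second moment is the Euclidean norm of the pair of the
    scaled old root and the scaled gradient, so it forgets at rate [rho]. *)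
Lemma sqrt_vel_step v w x y : 0 <= v -> 0 <= w ->
  `|Num.sqrt (beta * v + (1 - beta) * x ^+ 2) -
    Num.sqrt (beta * w + (1 - beta) * y ^+ 2)| <=
  rho * `|Num.sqrt v - Num.sqrt w| + `|x - y|.
Proof.
move=> v0 w0; have b0 := ltW beta_gt0; have e0 : 0 <= 1 - beta by rewrite subr_ge0 ltW.
have E u z : 0 <= u -> beta * u + (1 - beta) * z ^+ 2 =
    (rho * Num.sqrt u) ^+ 2 + (Num.sqrt (1 - beta) * z) ^+ 2.
  by move=> u0; rewrite !exprMn adam_rate2 !sqr_sqrtr.
rewrite !E// (le_trans (dist_sqrt_sqD_le _ _ _ _))//.
rewrite -!mulrBr !normrM (ger0_norm (ltW adam_rate_gt0)) lerD2l.
rewrite ler_piMl// ger0_norm ?sqrtr_ge0// -[X in _ <= X]sqrtr1 ler_wsqrtr//.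
by rewrite gerBl ltW// beta_gt0.
Qed.

(** Two runs of the moment recursions forget their initial states at the
    geometric rate [rho] and are otherwise as close as their inputs. *)
Lemma moments_diff x y m m' v v' n : 0 <= v -> 0 <= v' ->
  `|mom x m n - mom y m' n| +
  `|Num.sqrt (vel x v n) - Num.sqrt (vel y v' n)| <=
  dsum rho (fun k => 2 * `|x k - y k|)
    (`|m - m'| + `|Num.sqrt v - Num.sqrt v'|) n.
Proof.
move=> v0 v0'; elim: n => //= n IH.
have := sqrt_vel_step (x n) (y n) (vel_ge0 x n v0) (vel_ge0 y n v0').
set a := mom x m n in IH *; set b := mom y m' n in IH *.
set c := Num.sqrt _ in IH *; set e := Num.sqrt (vel y v' n) in IH *.
move=> h2.
have h1 : `|(alpha * a + (1 - alpha) * x n) - (alpha * b + (1 - alpha) * y n)| <=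
    rho * `|a - b| + `|x n - y n|.
  rewrite (_ : _ - _ = alpha * (a - b) + (1 - alpha) * (x n - y n)); last by ring.
  rewrite (le_trans (ler_normD _ _))// !normrM (ger0_norm alpha_ge0).
  rewrite (@ger0_norm _ (1 - alpha)); last by rewrite subr_ge0 ltW.
  apply: lerD; first by rewrite ler_wpM2r// alpha_le_rate.
  by rewrite ler_piMl// gerBl.
apply: le_trans (lerD h1 h2) _.
have : rho * (`|a - b| + `|c - e|) <=
    rho * dsum rho (fun k => 2 * `|x k - y k|)
      (`|m - m'| + `|Num.sqrt v - Num.sqrt v'|) n.
  by rewrite ler_wpM2l// ltW// adam_rate_gt0.
by lra.
Qed.

Lemma adam_ratio_diff x y m m' v v' n : 0 <= v -> 0 <= v' ->
  m' ^+ 2 <= C0 ^+ 2 * v' ->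
  `|adam_ratio (mom x m n) (vel x v n) - adam_ratio (mom y m' n) (vel y v' n)|
  <= (1 + C0) / epsilon * dsum rho (fun k => 2 * `|x k - y k|)
    (`|m - m'| + `|Num.sqrt v - Num.sqrt v'|) n.
Proof.
move=> v0 v0' mv'.
have h := adam_ratio_lip (mom x m n) (vel x v n) (vel_ge0 y n v0') (momentum_le y n mv').
apply: (le_trans h); rewrite mulrAC ler_wpM2r ?invr_ge0 ?(ltW epsilon_gt0)//.
have := moments_diff x y m m' n v0 v0'; set D := dsum _ _ _ _.
set A := `|_ - _|; set B := `|_ - _| => hD.
have A0 : 0 <= A by exact: normr_ge0.
have B0 : 0 <= B by exact: normr_ge0.
have K0 := adam_speed_ge0; have : C0 * (A + B) <= C0 * D by rewrite ler_wpM2l.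
have : 0 <= C0 * A by rewrite mulr_ge0.
by rewrite mulrDl mulrDr mul1r; lra.
Qed.

Lemma sqrt_vel_le x v n : 0 <= v ->
  Num.sqrt (vel x v n) <= dsum rho (fun k => `|x k|) (Num.sqrt v) n.
Proof.
move=> v0; elim: n => //= n IH.
have := sqrt_vel_step (x n) 0 (vel_ge0 x n v0) (lexx 0).
rewrite mulr0 expr0n mulr0 addr0 sqrtr0 !subr0 !(ger0_norm (sqrtr_ge0 _)) => h.
by apply: (le_trans h); rewrite lerD2r ler_wpM2l// ltW// adam_rate_gt0.
Qed.

End AdamScalar.

(** * Sequence space and its i.i.d. law *)

Section SequenceSpace.
Context (dU : measure_display) (cU : measurableType dU).

Definition cylinder (A : nat -> set cU) : set (nat -> cU) :=
  [set s | forall i, A i (s i)].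

Definition cylinders : set (set (nat -> cU)) :=
  [set C | exists (n : nat) (A : nat -> set cU),
     [/\ forall i, measurable (A i), forall i, (n <= i)%N -> A i = setT
       & C = cylinder A]].

Definition seqspace : measurableType _ := g_sigma_algebraType cylinders.

Lemma cylindersI : setI_closed cylinders.
Proof.
move=> _ _ [n [A [mA An ->]]] [m [B [mB Bm ->]]].
exists (maxn n m), (fun i => A i `&` B i); split.
- by move=> i; exact: measurableI.
- by move=> i; rewrite geq_max => /andP[/An -> /Bm ->]; rewrite setIT.
- apply/seteqP; split => [s [As Bs] i|s ABs]; first by split.
  by split=> i; have [] := ABs i.
Qed.

Lemma measurable_cylinder n (A : nat -> set cU) :
  (forall i, measurable (A i)) -> (forall i, (n <= i)%N -> A i = setT) ->
  measurable (cylinder A : set seqspace).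
Proof. by move=> mA An; apply: sub_sigma_algebra; exists n, A. Qed.

Lemma measurable_to_seqspace d (T : measurableType d) (f : T -> seqspace) :
  (forall i, measurable_fun setT (fun x => f x i : cU)) ->
  measurable_fun setT f.
Proof.
move=> mf; apply: (@measurability _ _ T seqspace setT f cylinders) => // _ [_ [n [A [mA An ->]]] <-].
rewrite setTI (_ : _ @^-1` _ = \bigcap_i ((fun x => f x i : cU) @^-1` A i)).
  by apply: bigcapT_measurable => i; rewrite -[X in measurable X]setTI; exact: mf.
by apply/seteqP; split => [x Ax i _|x Ax i]; [exact: Ax|exact: (Ax i)].
Qed.

Lemma measurable_coord i : measurable_fun setT (fun s : seqspace => s i : cU).
Proof.
move=> _ B mB; rewrite setTI.
rewrite (_ : _ @^-1` _ = cylinder (fun k => if k == i then B else setT)).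
  apply: (@measurable_cylinder i.+1) => [k|k ik]; first by case: ifP.
  by case: eqP ik => // ->; rewrite ltnn.
apply/seteqP; split => [s Bs k|s /(_ i)]; last by rewrite eqxx.
by case: eqP => [->|].
Qed.

(** Integrating over the second sequence is conditioning on the first [a]
    samples. *)
Definition merge (a : nat) (z : seqspace * seqspace) : seqspace :=
  fun i => if (i < a)%N then z.1 i else z.2 (i - a)%N.

Lemma measurable_merge a : measurable_fun setT (merge a).
Proof.
apply: measurable_to_seqspace => i; rewrite /merge; case: (i < a)%N.
  exact: (measurableT_comp (measurable_coord i) measurable_fst).
exact: (measurableT_comp (measurable_coord _) measurable_snd).
Qed.

Definition shift (a : nat) (s : seqspace) : seqspace := fun i => s (a + i)%N.

Lemma shift_merge a z : shift a (merge a z) = z.2.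
Proof.
by apply/funext => i; rewrite /shift /merge ltnNge leq_addr /= addKn.
Qed.

(** The recursion of the algorithm reads its newest sample last, the series of
    the vector field read it first; reversing an initial segment of i.i.d.
    samples exchanges the two. *)
Definition backwards (a : nat) (s : seqspace) : seqspace :=
  fun i => if (i < a)%N then s (a - i.+1)%N else s i.

Lemma measurable_backwards a : measurable_fun setT (backwards a).
Proof.
apply: measurable_to_seqspace => i; rewrite /backwards; case: (i < a)%N;
exact: measurable_coord.
Qed.

Context (R : realType) (mu : set cU -> \bar R).

(** Stated for set functions, so that it applies to a pushforward. *)
Definition iid_law (nu : set seqspace -> \bar R) :=
  forall n (A : nat -> set cU), (forall i, measurable (A i)) ->
    (forall i, (n <= i)%N -> A i = setT) ->
    nu (cylinder A) = (\prod_(i < n) mu (A i))%E.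

Lemma iid_law_unique (nu nu' : {measure set seqspace -> \bar R}) :
  iid_law nu -> iid_law nu' -> forall A, measurable A -> nu A = nu' A.
Proof.
move=> h h' A mA.
have cT : cylinder (fun=> setT) = setT :> set seqspace by apply/seteqP; split.
apply: (@measure_unique _ R seqspace cylinders (fun=> setT)) => //.
- exact: cylindersI.
- by move=> _; exists 0%N, (fun=> setT); split=> //.
- by rewrite bigcup_const.
- by move=> _ [n [B [mB Bn ->]]]; rewrite (h n) // (h' n).
- by move=> _; rewrite -cT (h 0%N) // big_ord0 ltry.
Qed.

Variable nu : probability seqspace R.
Hypothesis nuP : iid_law nu.
Hypothesis muT : mu setT = 1%E.

Lemma iid_law_merge a : iid_law (pushforward (nu \x nu)%E (merge a)).
Proof.
move=> n A mA An; rewrite /pushforward.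
rewrite (_ : _ @^-1` _ = cylinder (fun i => if (i < a)%N then A i else setT) `*`
    cylinder (fun i => A (a + i)%N)); last first.
  apply/seteqP; split => [[s s'] Az|[s s'] [/= As As'] i]; last first.
    rewrite /merge /=; have := As i; case: ltnP => // ai _.
    by have := As' (i - a)%N; rewrite subnKC.
  split=> i /=; have := Az i; have := Az (a + i)%N; rewrite /merge /=.
    by case: (i < a)%N.
  by rewrite ltnNge leq_addr /= addKn.
have mA1 i : measurable (if (i < a)%N then A i else setT) by case: ifP.
have A1 i : (a <= i)%N -> (if (i < a)%N then A i else setT) = setT.
  by rewrite leqNgt; case: ltnP.
have A2 i : (n <= i)%N -> A (a + i)%N = setT.
  by move=> ni; apply: An; rewrite (leq_trans ni)// leq_addl.
transitivity (nu (cylinder (fun i => if (i < a)%N then A i else setT)) *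
    nu (cylinder (fun i => A (a + i)%N)))%E.
  by apply: product_measure1E; [exact: measurable_cylinder mA1 A1|
    exact: (measurable_cylinder (n := n))].
rewrite (nuP mA1 A1) (nuP (fun i => mA (a + i)%N) A2).
transitivity (\prod_(i < a + n) mu (A i))%E.
  by rewrite big_split_ord /=; congr *%E; apply: eq_bigr => i _; rewrite ltn_ord.
rewrite addnC big_split_ord /= [X in (_ * X)%E]big1 ?mule1// => i _.
by rewrite An ?muT// leq_addr.
Qed.

Lemma ge0_integral_merge a (g : seqspace -> \bar R) :
  measurable_fun setT g -> (forall s, (0 <= g s)%E) ->
  (\int[nu]_s g s = \int[nu]_s \int[nu]_s' g (merge a (s, s')))%E.
Proof.
move=> mg g0.
rewrite -(fubini_tonelli1 (m1 := nu) (m2 := nu) (g \o merge a)); last 2 first.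
- exact: measurableT_comp mg (measurable_merge a).
- by move=> z; exact: g0.
have := ge0_integral_pushforward (measurable_merge a) (nu \x nu)%E measurableT mg.
rewrite preimage_setT => <- //.
apply: eq_measure_integral => [|mm A mA _]; first exact: measurable_merge.
exact: (iid_law_unique nuP (@iid_law_merge a)).
Qed.

Lemma iid_law_backwards a : iid_law (pushforward nu (backwards a)).
Proof.
move=> n A mA An; rewrite /pushforward.
pose B i := if (i < a)%N then A (a - i.+1)%N else A i.
have mB i : measurable (B i) by rewrite /B; case: ifP.
have Bn i : (a + n <= i)%N -> B i = setT.
  move=> ani; rewrite /B ltnNge (leq_trans (leq_addr _ _) ani)/= An//.
  exact: leq_trans (leq_addl _ _) ani.
rewrite (_ : _ @^-1` _ = cylinder B); last first.
  apply/seteqP; split => s; rewrite /B => As i.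
    case: ltnP => ai; last by have := As i; rewrite /backwards ltnNge ai.
    have := As (a - i.+1)%N; rewrite /backwards ltn_subrL /= (leq_ltn_trans _ ai)//.
    by rewrite -subSn// subSS subKn// ltnW.
  rewrite /backwards; case: ltnP => ai; last by have := As i; rewrite ltnNge ai.
  have := As (a - i.+1)%N; rewrite ltn_subrL /= (leq_ltn_trans _ ai)//.
  by rewrite -subSn// subSS subKn// ltnW.
rewrite (nuP mB Bn) big_split_ord /=.
rewrite (reindex_inj rev_ord_inj) /=.
transitivity (\prod_(i < a + n) mu (A i))%E.
  rewrite big_split_ord /=; congr *%E; apply: eq_bigr => i _.
    rewrite /B ltn_subrL /= (leq_ltn_trans _ (ltn_ord i))//.
    by rewrite -subSn// subSS subKn// ltnW.
  by rewrite /B ltnNge leq_addr.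
rewrite addnC big_split_ord /= [X in (_ * X)%E]big1 ?mule1// => i _.
by rewrite An ?muT// leq_addr.
Qed.

Lemma integral_backwards a (g : seqspace -> R) :
  measurable_fun setT g -> nu.-integrable setT (EFin \o (g \o backwards a)) ->
  (\int[nu]_s g s = \int[nu]_s g (backwards a s)).
Proof.
move=> mg ig; rewrite /Rintegral; congr fine.
have mEg : measurable_fun setT (EFin \o g) by exact/measurable_EFinP.
have := integral_pushforward (measurable_backwards a) mEg ig measurableT.
rewrite preimage_setT => <-.
apply: eq_measure_integral => [|mm A mA _]; first exact: measurable_backwards.
exact: (iid_law_unique nuP (@iid_law_backwards a)).
Qed.

End SequenceSpace.

Arguments merge {dU cU}.
Arguments shift {dU cU}.
Arguments backwards {dU cU}.

(** * Row vectors: norms and Borel sets *)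

Section RowVectors.
Context {R : realType} {d : nat}.
Implicit Types x y : 'rV[R]_d.

Lemma rv_coord_le x j : `|x 0 j| <= `|x|.
Proof.
by rewrite [leRHS]/Num.norm /= mx_normrE; apply/bigmax_geP; right; exists (0, j).
Qed.

Lemma rv_norm_le x r : 0 <= r -> (forall j, `|x 0 j| <= r) -> `|x| <= r.
Proof.
move=> r0 xr; rewrite [leLHS]/Num.norm /= mx_normrE; apply/bigmax_leP; split=> //.
by move=> [i j] _ /=; rewrite ord1.
Qed.

Lemma norm_le_enorm x : `|x| <= enorm x.
Proof.
apply: rv_norm_le => [|j]; first exact: sqrtr_ge0.
rewrite -sqrtr_sqr ler_wsqrtr// (bigD1 j)//= lerDl.
by apply: sumr_ge0 => i _; rewrite sqr_ge0.
Qed.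

Lemma enorm_le_norm x : enorm x <= d%:R * `|x|.
Proof.
have d0 : 0 <= d%:R :> R by exact: ler0n.
rewrite -[leRHS]ger0_norm ?mulr_ge0// -sqrtr_sqr ler_wsqrtr//.
apply: (@le_trans _ _ (\sum_(j < d) `|x| ^+ 2)).
  apply: ler_sum => j _; rewrite -real_normK ?num_real//.
  by rewrite lerXn2r ?nnegrE//; exact: rv_coord_le.
rewrite sumr_const card_ord exprMn -[X in X <= _]mulr_natl ler_wpM2r ?sqr_ge0//.
by rewrite -natrX ler_nat; case: (d) => // n; rewrite expnS leq_pmulr ?expn_gt0.
Qed.

Lemma measurable_rv_continuous (g : 'rV[R]_d -> R) : continuous g ->
  measurable_fun setT (g : borelRV R d -> R).
Proof.
move=> cg; apply: (measurability _ (RGenOpens.measurableE R)) => //.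
move=> _ [_ [a [b ->]] <-]; rewrite setTI; apply: sub_sigma_algebra.
by move/continuousP : cg; apply; exact: interval_open.
Qed.

Lemma measurable_rv_coord j : measurable_fun setT (fun x : borelRV R d => x 0 j).
Proof. by apply: (@measurable_rv_continuous (fun x => x 0 j)); exact: coord_continuous. Qed.

(** The Borel sets of row vectors come from the topology, so coordinatewise
    measurability suffices only because every open set is a countable union of
    rational boxes. *)
Lemma measurable_to_rv dT (T : measurableType dT) (f : T -> 'rV[R]_d) :
  (forall j, measurable_fun setT (fun t => f t 0 j)) ->
  measurable_fun setT (f : T -> borelRV R d).
Proof.
move=> mf; apply: (@measurability _ _ T (borelRV R d) setT f open) => //.
move=> _ [W oO <-]; rewrite setTI.
pose c (q : 'rV[rat]_d) : 'rV[R]_d := \row_j ratr (q 0 j).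
pose box (i : 'rV[rat]_d * nat) : set T :=
  \bigcap_(j in [set: 'I_d]) [set t | `|f t 0 j - c i.1 0 j| < i.2.+1%:R^-1].
pose F i := if `[< ball (c i.1) i.2.+1%:R^-1 `<=` W >] then box i else set0.
rewrite (_ : _ @^-1` _ = \bigcup_i F i).
  apply: countable_bigcupT_measurable => // i; rewrite /F; case: ifP => // _.
  apply: fin_bigcap_measurable => // j _.
  rewrite -[X in measurable X]setTI.
  rewrite (_ : [set t | _] = (fun t => `|f t 0 j - c i.1 0 j| < i.2.+1%:R^-1) @^-1` [set true]).
    apply: measurable_fun_ltr => //; apply: measurableT_comp => //.
    by apply: measurable_funB.
  by apply/seteqP; split.
apply/seteqP; split => t.
  move=> Wt; have /nbhs_ballP[e /= e0 eO] : nbhs (f t) W by exact: open_nbhs_nbhs.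
  have [k ke] : exists k : nat, k.+1%:R^-1 < e / 2.
    exists `|Num.ceil (e / 2)^-1|%N.
    rewrite invf_plt ?posrE ?divr_gt0// -natr1.
    rewrite (le_lt_trans (ceil_ge _))// -[X in _ < X]natr1 natr1 natr_absz ltr_pwDr//.
    by rewrite ler_int ler_norm.
  have hq j : exists q : rat, `|f t 0 j - ratr q| < k.+1%:R^-1.
    have : f t 0 j - k.+1%:R^-1 < f t 0 j + k.+1%:R^-1.
      by rewrite ltrD2l gtrN// invr_gt0.
    move=> /rat_in_itvoo[q]; rewrite in_itv /= => /andP[q1 q2]; exists q.
    by move: q1 q2; set r := _^-1 => q1 q2; rewrite ltr_norml; apply/andP; split; lra.
  have {hq} [q hq] := choice hq.
  exists (\row_j q j, k) => //; rewrite /F asboolT/=.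
    by move=> j _; rewrite /= !mxE.
    move=> x [_ xb]; apply: eO; rewrite mx_norm_ball /ball_ /=.
    have k0 : 0 < k.+1%:R^-1 :> R by rewrite invr_gt0.
    set r := k.+1%:R^-1 in ke k0 xb hq.
    apply: (@le_lt_trans _ _ (r + r)); last by lra.
    apply: rv_norm_le => [|j]; first by lra.
    rewrite !mxE; have := xb 0 j; rewrite /ball /= !mxE => h.
    rewrite -(subrKA (ratr (q j))) (le_trans (ler_normD _ _))// ltW// ltrD//.
move=> [[q k] _]; rewrite /F; case: asboolP => //= qO ft; apply: qO.
split; first by rewrite invr_gt0.
by move=> i j; rewrite ord1 /ball /= distrC; exact: (ft j).
Qed.

Lemma measurable_rv_norm dT (T : measurableType dT) (f : T -> 'rV[R]_d) :
  measurable_fun setT (f : T -> borelRV R d) ->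
  measurable_fun setT (fun t => `|f t|).
Proof.
move=> mf.
have mn : measurable_fun setT (fun x : borelRV R d => `|x : 'rV[R]_d|).
  by apply: (@measurable_rv_continuous (fun x => `|x|)); exact: norm_continuous.
exact: (measurableT_comp mn mf).
Qed.

End RowVectors.

(** * The algorithm as a function of the sample sequence *)

Section AdamPath.
Context {R : realType} {dU : measure_display} {cU : measurableType dU} {d : nat}.
Context (X : cU -> 'rV[R]_d -> 'rV[R]_d) (gamma : nat -> R).
Context (alpha beta epsilon : R) (start : 'rV[R]_d).
Implicit Types s : seqspace cU.

Local Notation rho := (adam_rate beta).
Local Notation C0 := (adam_speed alpha beta).

(** Position and the two moments; the samples are numbered from [0], so that
    step [k.+1] reads sample [k] and step size [gamma k.+1]. *)
Fixpoint adam_state s (n : nat) : 'rV[R]_d * 'rV[R]_d * 'rV[R]_d :=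
  if n is k.+1 then
    let: (t, m, v) := adam_state s k in
    let x := X (s k) t in
    let m' := alpha *: m + (1 - alpha) *: x in
    let v' := \row_j (beta * v 0 j + (1 - beta) * x 0 j ^+ 2) in
    (\row_j (t 0 j + gamma k.+1 *
       adam_ratio epsilon (m' 0 j) (v' 0 j / (1 - beta ^+ k.+1))), m', v')
  else (start, 0, 0).

Definition adam_pos s n := (adam_state s n).1.1.
Definition adam_mom1 s n := (adam_state s n).1.2.
Definition adam_mom2 s n := (adam_state s n).2.
Definition adam_grad s n := X (s n) (adam_pos s n).

Lemma mom1S s n j :
  adam_mom1 s n.+1 0 j = alpha * adam_mom1 s n 0 j + (1 - alpha) * adam_grad s n 0 j.
Proof.
by rewrite /adam_mom1 /adam_grad /adam_pos /=; case: (adam_state s n) => [[t m] v] /=; rewrite !mxE.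
Qed.

Lemma mom2S s n j :
  adam_mom2 s n.+1 0 j = beta * adam_mom2 s n 0 j + (1 - beta) * adam_grad s n 0 j ^+ 2.
Proof.
by rewrite /adam_mom2 /adam_grad /adam_pos /=; case: (adam_state s n) => [[t m] v] /=; rewrite !mxE.
Qed.

Lemma posS s n j : adam_pos s n.+1 0 j = adam_pos s n 0 j + gamma n.+1 *
  adam_ratio epsilon (adam_mom1 s n.+1 0 j) (adam_mom2 s n.+1 0 j / (1 - beta ^+ n.+1)).
Proof.
by rewrite /adam_pos /adam_mom1 /adam_mom2 /=; case: (adam_state s n) => [[t m] v] /=; rewrite !mxE.
Qed.

Lemma adam_state_eq s s' n : (forall k, (k < n)%N -> s k = s' k) ->
  adam_state s n = adam_state s' n.
Proof.
elim: n => //= n IH ss'; rewrite IH => [|k kn]; last by apply: ss'; rewrite ltnW.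
by rewrite ss'.
Qed.

Lemma adam_state_merge a s s' n : (n <= a)%N ->
  adam_state (merge a (s, s')) n = adam_state s n.
Proof.
move=> na; apply: adam_state_eq => k kn.
by rewrite /merge (leq_trans kn na).
Qed.

Lemma pos_merge a s s' n : (n <= a)%N -> adam_pos (merge a (s, s')) n = adam_pos s n.
Proof. by move=> na; rewrite /adam_pos adam_state_merge. Qed.

Lemma mom1_mom a s n j :
  adam_mom1 s (a + n) 0 j = mom alpha (fun k => adam_grad s (a + k) 0 j) (adam_mom1 s a 0 j) n.
Proof. by elim: n => [|n IH]; rewrite ?addn0// addnS mom1S IH. Qed.

Lemma mom2_vel a s n j :
  adam_mom2 s (a + n) 0 j = vel beta (fun k => adam_grad s (a + k) 0 j) (adam_mom2 s a 0 j) n.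
Proof. by elim: n => [|n IH]; rewrite ?addn0// addnS mom2S IH. Qed.

Hypotheses (epsilon_gt0 : 0 < epsilon).
Hypotheses (alpha_ge0 : 0 <= alpha) (alpha_lt1 : alpha < 1).
Hypotheses (alpha2_lt_beta : alpha ^+ 2 < beta) (beta_lt1 : beta < 1).
Hypothesis gamma_gt0 : forall n, (1 <= n)%N -> 0 < gamma n.

Lemma mom2_ge0 s n j : 0 <= adam_mom2 s n 0 j.
Proof. by rewrite -[n]add0n mom2_vel (vel_ge0 alpha2_lt_beta)// mxE. Qed.

Lemma mom1_le_mom2 s n j : adam_mom1 s n 0 j ^+ 2 <= C0 ^+ 2 * adam_mom2 s n 0 j.
Proof.
rewrite -[n]add0n mom1_mom mom2_vel; apply: momentum_le => //.
by rewrite !mxE expr0n mulr0.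
Qed.

Lemma expr_beta_lt1 n : 0 <= beta ^+ n.+1 < 1.
Proof.
have b0 := ltW (beta_gt0 alpha2_lt_beta).
by rewrite exprn_ge0//= exprn_ilt1.
Qed.

(** The normalisation cancels the size of the gradients: the bound is
    deterministic. *)
Lemma step_le s n j : `|adam_pos s n.+1 0 j - adam_pos s n 0 j| <= C0 * gamma n.+1.
Proof.
rewrite posS addrC addKr normrM (gtr0_norm (gamma_gt0 _))// mulrC.
rewrite ler_wpM2r ?(ltW (gamma_gt0 _))//.
have /andP[b0 b1] := expr_beta_lt1 n; have v0 := mom2_ge0 s n.+1 j.
apply: (adam_ratio_le epsilon_gt0 v0 _ (mom1_le_mom2 s n.+1 j)).
by rewrite ler_pdivlMr ?subr_gt0// ler_piMr// gerBl.
Qed.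

Lemma pos_dist_le s a n :
  `|adam_pos s (a + n) - adam_pos s a| <= C0 * \sum_(a <= k < a + n) gamma k.+1.
Proof.
have K0 := adam_speed_ge0 alpha beta.
elim: n => [|n IH]; first by rewrite addn0 subrr normr0 big_geq// mulr0.
rewrite addnS big_nat_recr ?leq_addr//= mulrDr.
rewrite -(subrKA (adam_pos s (a + n))) (le_trans (ler_normD _ _))// addrC lerD//.
apply: rv_norm_le => [|j]; first by rewrite mulr_ge0// ltW// gamma_gt0.
by rewrite !mxE; exact: step_le.
Qed.

Hypothesis X_meas : product_measurable X.

Lemma measurable_X_coord dT (T : measurableType dT) (u : T -> cU) (t : T -> 'rV[R]_d) j :
  measurable_fun setT u -> measurable_fun setT (t : T -> borelRV R d) ->
  measurable_fun setT (fun w => X (u w) (t w) 0 j).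
Proof.
move=> mu mt.
have mp : measurable_fun setT (fun w => (u w, t w) : cU * borelRV R d).
  exact: measurable_fun_pair.
exact: (measurableT_comp (measurable_rv_coord j) (measurableT_comp X_meas mp)).
Qed.

Lemma measurable_X dT (T : measurableType dT) (u : T -> cU) (t : T -> 'rV[R]_d) :
  measurable_fun setT u -> measurable_fun setT (t : T -> borelRV R d) ->
  measurable_fun setT ((fun w => X (u w) (t w)) : T -> borelRV R d).
Proof. by move=> mu mt; apply: measurable_to_rv => j; exact: measurable_X_coord. Qed.

Lemma measurable_adam_ratio dT (T : measurableType dT) (m v : T -> R) :
  measurable_fun setT m -> measurable_fun setT v ->
  measurable_fun setT (fun w => adam_ratio epsilon (m w) (v w)).
Proof.
move=> mm mv; apply: measurable_funM => //.
have -> : (fun w => (Num.sqrt (v w) + epsilon)^-1) =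
    (@powR R ^~ (-1)) \o (fun w => Num.sqrt (v w) + epsilon).
  apply/funext => w /=; rewrite powR_inv1//.
  by rewrite addr_ge0 ?sqrtr_ge0// ltW.
apply: measurableT_comp; first exact: measurable_powR.
apply: measurable_funD => //.
apply: (@measurableT_comp _ _ _ _ _ _ (@Num.sqrt R) setT v) => //.
exact: (continuous_measurable_fun (@sqrt_continuous R)).
Qed.

Lemma measurable_state n :
  [/\ measurable_fun setT ((fun s => adam_pos s n) : _ -> borelRV R d),
      (forall j, measurable_fun setT (fun s => adam_mom1 s n 0 j)) &
      (forall j, measurable_fun setT (fun s => adam_mom2 s n 0 j))].
Proof.
elim: n => [|n [mp m1 m2]].
  by split; [exact: measurable_cst|move=> j; exact: measurable_cst..].
have mg j : measurable_fun setT (fun s => adam_grad s n 0 j).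
  by apply: measurable_X_coord => //; exact: measurable_coord.
have m1' j : measurable_fun setT (fun s => adam_mom1 s n.+1 0 j).
  rewrite (funext (fun s => mom1S s n j)).
  by apply: measurable_funD; apply: measurable_funM.
have m2' j : measurable_fun setT (fun s => adam_mom2 s n.+1 0 j).
  rewrite (funext (fun s => mom2S s n j)).
  by apply: measurable_funD; apply: measurable_funM => //; exact: measurable_funX.
split => //; apply: measurable_to_rv => j; rewrite (funext (fun s => posS s n j)).
apply: measurable_funD.
  exact: (measurableT_comp (measurable_rv_coord j) mp).
apply: measurable_funM => //; apply: measurable_adam_ratio => //.
exact: measurable_funM.
Qed.

Lemma measurable_pos n : measurable_fun setT ((fun s => adam_pos s n) : _ -> borelRV R d).
Proof. by case: (measurable_state n). Qed.

End AdamPath.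

(** * Bounds on means of nonnegative functions *)

Section MeasurableReal.
Context {R : realType} {dT : measure_display} {T : measurableType dT}.
Implicit Types f g : T -> R.

Lemma measurable_powR_fun f p : measurable_fun setT f ->
  measurable_fun setT (fun t => f t `^ p).
Proof.
by move=> mf; apply: (@measurableT_comp _ _ _ _ _ _ (@powR R ^~ p) setT f).
Qed.

Lemma measurable_expR_fun f : measurable_fun setT f ->
  measurable_fun setT (fun t => expR (f t)).
Proof. by move=> mf; apply: (@measurableT_comp _ _ _ _ _ _ (@expR R) setT f). Qed.

Lemma measurable_abs_fun f : measurable_fun setT f ->
  measurable_fun setT (fun t => `|f t|).
Proof.
by move=> mf; apply: (@measurableT_comp _ _ _ _ _ _ (@Num.norm R R) setT f).
Qed.

Lemma measurable_set_ler f g : measurable_fun setT f -> measurable_fun setT g ->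
  measurable [set t | f t <= g t].
Proof.
move=> mf mg; rewrite -[X in measurable X]setTI.
rewrite (_ : [set t | _] = (fun t => f t <= g t) @^-1` [set true]).
  exact: measurable_fun_ler.
by apply/seteqP; split.
Qed.

End MeasurableReal.

Section MeanBounds.
Context {R : realType} {dT : measure_display} {T : measurableType dT}.
Context (P : probability T R).
Implicit Types f g : T -> R.

(** Bundling the side conditions of the integral of a nonnegative function
    makes upper bounds on means compose. *)
Definition mean_le f (c : R) := [/\ measurable_fun setT f, forall t, 0 <= f t &
  (\int[P]_t (f t)%:E <= c%:E)%E].

Lemma mean_leW f a b : a <= b -> mean_le f a -> mean_le f b.
Proof. by move=> ab [mf f0 fa]; split=> //; rewrite (le_trans fa)// lee_fin. Qed.

Lemma mean_le_cst c : 0 <= c -> mean_le (fun=> c) c.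
Proof.
move=> c0; split=> //; rewrite (integral_cst _ measurableT c%:E).
by rewrite [leLHS](_ : _ = c%:E)// [X in (_ * X)%E](probability_setT P) mule1.
Qed.

Lemma mean_le_le f g c : measurable_fun setT f -> (forall t, 0 <= f t) ->
  (forall t, f t <= g t) -> mean_le g c -> mean_le f c.
Proof.
move=> mf f0 fg [mg g0 gc]; split=> //; apply: le_trans gc.
apply: ge0_le_integral => //.
- by move=> t _; rewrite lee_fin.
- exact/measurable_EFinP.
- exact/measurable_EFinP.
- by move=> t _; rewrite lee_fin.
Qed.

Lemma mean_leD f g a b : mean_le f a -> mean_le g b ->
  mean_le (fun t => f t + g t) (a + b).
Proof.
move=> [mf f0 fa] [mg g0 gb]; split; first exact: measurable_funD.
  by move=> t; rewrite addr_ge0.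
under eq_integral do rewrite EFinD.
rewrite ge0_integralD//; first by rewrite EFinD leeD.
- by move=> t _; rewrite lee_fin.
- exact/measurable_EFinP.
- by move=> t _; rewrite lee_fin.
- exact/measurable_EFinP.
Qed.

Lemma mean_leZ k f a : 0 <= k -> mean_le f a ->
  mean_le (fun t => k * f t) (k * a).
Proof.
move=> k0 [mf f0 fa]; split; first exact: measurable_funM.
  by move=> t; rewrite mulr_ge0.
under eq_integral do rewrite EFinM.
rewrite ge0_integralZl_EFin//; first by rewrite EFinM lee_wpmul2l ?lee_fin.
- by move=> t _; rewrite lee_fin.
- exact/measurable_EFinP.
Qed.

Lemma mean_le_sum (I : Type) (s : seq I) (f : I -> T -> R) (a : I -> R) :
  (forall i, mean_le (f i) (a i)) ->
  mean_le (fun t => \sum_(i <- s) f i t) (\sum_(i <- s) a i).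
Proof.
move=> fa; elim: s => [|i s IH].
  by under [X in mean_le X]funext do rewrite big_nil; rewrite big_nil; exact: mean_le_cst.
rewrite big_cons.
under [X in mean_le X]funext do rewrite big_cons.
exact: mean_leD.
Qed.

Lemma mean_le_ge0 f a : mean_le f a -> 0 <= a.
Proof.
move=> [mf f0 fa]; rewrite -lee_fin; apply: le_trans fa.
by apply: integral_ge0 => t _; rewrite lee_fin.
Qed.

Lemma mean_le_markov f a c : 0 < c -> mean_le f a ->
  (P [set t | (c <= f t)%R] <= (a / c)%:E)%E.
Proof.
move=> c0 [mf f0 fa].
have mc : measurable [set t | c <= f t].
  exact: measurable_set_ler.
have : mean_le (fun t => c * \1_[set t | c <= f t] t) a.
  apply: (@mean_le_le _ f) => //.
  - by apply: measurable_funM => //; exact: measurable_indic.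
  - by move=> t; rewrite mulr_ge0 ?(ltW c0)// indicE ler0n.
  move=> t; rewrite indicE; have [|] := boolP (t \in _).
    by rewrite inE /= mulr1.
  by rewrite mulr0.
move=> [_ _]; under eq_integral do rewrite EFinM.
rewrite ge0_integralZl_EFin ?(ltW c0)//; last first.
  by apply/measurable_EFinP; exact: measurable_indic.
rewrite integral_indic// setIT => h.
by rewrite EFinM muleC lee_pdivlMl.
Qed.

(** The [L^p] norm of a weighted sum is at most the total weight times the
    largest norm of a summand. *)
Lemma mean_le_powR_sum p (I : Type) (s : seq I) (w : I -> R)
    (x : I -> T -> R) (W A : R) :
  1 <= p -> (forall i, 0 < w i) -> (forall i, measurable_fun setT (x i)) ->
  (forall i t, 0 <= x i t) -> \sum_(i <- s) w i <= W -> 0 <= A ->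
  (forall i, mean_le (fun t => x i t `^ p) A) ->
  mean_le (fun t => (\sum_(i <- s) w i * x i t) `^ p) (W `^ p * A).
Proof.
move=> p1 w0 mx x0 sW A0 xA.
have sw0 : 0 <= \sum_(i <- s) w i by apply: sumr_ge0 => i _; exact: ltW.
have msum : measurable_fun setT (fun t => \sum_(i <- s) w i * x i t).
  by apply: measurable_sum => i; exact: measurable_funM.
apply: (mean_le_le (g := fun t => (\sum_(i <- s) w i) `^ (p - 1) *
    \sum_(i <- s) w i * x i t `^ p)).
- exact: measurable_powR_fun.
- by move=> t; exact: powR_ge0.
- by move=> t; apply: powR_sum_le.
have h : mean_le (fun t => \sum_(i <- s) w i * x i t `^ p) (\sum_(i <- s) w i * A).
  by apply: mean_le_sum => i; apply: mean_leZ; rewrite ?(ltW (w0 i)).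
apply: mean_leW (mean_leZ (powR_ge0 _ _) h).
rewrite -mulr_suml mulrA ler_wpM2r// mulrC mulr_powRB1//; last by lra.
apply: ge0_ler_powR => //; rewrite ?nnegrE//; first by lra.
exact: le_trans sw0 sW.
Qed.

Lemma bounded_integrable f M : measurable_fun setT f -> (forall t, `|f t| <= M) ->
  P.-integrable setT (EFin \o f).
Proof.
move=> mf fM; apply: measurable_bounded_integrable => //.
  by rewrite [X in (X < _)%E](probability_setT P) ltry.
exists M; split; first exact: num_real.
by move=> x Mx t _ /=; rewrite (le_trans (fM t))// ltW.
Qed.

Lemma Rintegral_dist_le f g h M a : measurable_fun setT f -> measurable_fun setT g ->
  (forall t, `|f t| <= M) -> (forall t, `|g t| <= M) -> mean_le h a ->
  (forall t, `|f t - g t| <= h t) ->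
  `|\int[P]_t f t - \int[P]_t g t| <= a.
Proof.
move=> mf mg fM gM ha fgh.
have intf := bounded_integrable mf fM; have intg := bounded_integrable mg gM.
rewrite -RintegralB//.
have mfg : measurable_fun setT (fun t => f t - g t) by exact: measurable_funB.
have fgM t : `|f t - g t| <= M + M by rewrite (le_trans (ler_normB _ _))// lerD.
apply: (le_trans (le_normr_Rintegral measurableT (bounded_integrable mfg fgM))).
have [_ _] : mean_le (fun t => `|f t - g t|) a.
  by apply: (mean_le_le _ _ fgh ha) => //; exact: measurable_abs_fun.
have := integral_ge0 P (D := setT) (f := fun t => `|f t - g t|%:E).
move=> /(_ (fun t _ => normr_ge0 _)).
by rewrite /Rintegral; case: (integral _ _ _) => [r||]//=; rewrite !lee_fin.
Qed.

Lemma Rintegral_abs_le f M : measurable_fun setT f -> (forall t, `|f t| <= M) ->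
  `|\int[P]_t f t| <= M.
Proof.
move=> mf fM; have M0 : 0 <= M by rewrite (le_trans _ (fM point)).
have /= := @Rintegral_dist_le f (fun=> 0) (fun=> M) M M mf _ fM.
rewrite Rintegral_cst// mul0r subr0; apply => //.
- by move=> t; rewrite normr0.
- exact: mean_le_cst.
- by move=> t; rewrite subr0.
Qed.

(** Second-order expansion of the exponential: the linear term has mean zero. *)
Lemma mean_le_expR_centred f M l : measurable_fun setT f -> (forall t, `|f t| <= M) ->
  \int[P]_t f t = 0 -> 0 <= l -> l * M <= 2^-1 ->
  mean_le (fun t => expR (l * f t)) (expR (2 * (l * M) ^+ 2)).
Proof.
move=> mf fM f0 l0 lM.
have M0 : 0 <= M by rewrite (le_trans _ (fM point)).
have mlf : measurable_fun setT (fun t => l * f t) by exact: measurable_funM.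
have me : measurable_fun setT (fun t => expR (l * f t)).
  exact: measurable_expR_fun.
have lfM t : `|l * f t| <= l * M by rewrite normrM ger0_norm// ler_wpM2l.
split=> //.
set c := 2 * (l * M) ^+ 2.
have b t : expR (l * f t) <= l * f t + (1 + c).
  have := lfM t; rewrite ler_norml => /andP[h1 h2].
  have : (l * f t) ^+ 2 <= (l * M) ^+ 2.
    rewrite -real_normK ?num_real// lerXn2r ?nnegrE// mulr_ge0//.
  have := @expR_le_quadratic _ (l * f t); rewrite (le_trans h2)// => /(_ isT).
  by rewrite /c; lra.
have i1 : P.-integrable setT (EFin \o (fun t => l * f t)).
  exact: bounded_integrable lfM.
have i2 : P.-integrable setT (EFin \o (fun t => 1 + c)).
  by apply: (@bounded_integrable _ `|1 + c|).
apply: (@le_trans _ _ (\int[P]_t (l * f t + (1 + c))%:E)%E).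
  apply: ge0_le_integral => //.
  - exact/measurable_EFinP.
  - by apply/measurable_EFinP; exact: measurable_funD.
  - by move=> t _; rewrite lee_fin.
rewrite integralD_EFin//=.
have -> : (\int[P]_t (l * f t)%:E)%E = 0%E.
  have := RintegralZl (D := setT) l measurableT (bounded_integrable mf fM).
  rewrite f0 mulr0 /Rintegral.
  have := integral_fune_fin_num measurableT i1.
  by rewrite /=; case: (integral _ _ _) => //= r _ ->.
rewrite add0e (integral_cst _ measurableT (1 + c)%:E).
rewrite [leLHS](_ : _ = (1 + c)%:E).
  by rewrite lee_fin; exact: expR_ge1Dx.
by rewrite [X in (_ * X)%E](probability_setT P) mule1.
Qed.

End MeanBounds.

Section MeanMerge.
Context {R : realType} {dU : measure_display} {cU : measurableType dU}.
Context (mu : set cU -> \bar R) (nu : probability (seqspace cU) R).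
Hypotheses (nuP : iid_law mu nu) (muT : mu setT = 1%E).

(** Conditioning on the first [a] samples. *)
Lemma mean_le_merge a (f g : seqspace cU -> R) c : measurable_fun setT f ->
  (forall s, mean_le nu (fun s' => f (merge a (s, s'))) (g s)) ->
  measurable_fun setT g -> mean_le nu g c -> mean_le nu f c.
Proof.
move=> mf fg mg [_ g0 gc].
have f0 s : 0 <= f s.
  have [_ + _] := fg s => /(_ (shift a s)).
  rewrite (_ : merge a (s, shift a s) = s)//; apply/funext => i.
  by rewrite /merge /shift /=; case: ltnP => // ai; rewrite subnKC.
split => //; have mef : measurable_fun setT (EFin \o f) by exact/measurable_EFinP.
rewrite (ge0_integral_merge nuP muT a mef); last by move=> s; rewrite lee_fin.
apply: le_trans gc; apply: ge0_le_integral => //.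
- by move=> s _; apply: integral_ge0 => s' _; rewrite lee_fin.
- have mfm : measurable_fun setT ((EFin \o f) \o merge a).
    exact: measurableT_comp mef (measurable_merge a).
  have := @measurable_fun_fubini_tonelli_F _ _ _ _ R nu _ mfm.
  by apply => z; rewrite lee_fin.
- exact/measurable_EFinP.
- by move=> s _; have [] := fg s.
Qed.

End MeanMerge.

(** * Frozen iterates and their means *)

Section Frozen.
Context {R : realType} {dU : measure_display} {cU : measurableType dU} {d : nat}.
Context (X : cU -> 'rV[R]_d -> 'rV[R]_d) (alpha beta epsilon p : R).
Hypotheses (epsilon_gt0 : 0 < epsilon).
Hypotheses (alpha_ge0 : 0 <= alpha) (alpha_lt1 : alpha < 1).
Hypotheses (alpha2_lt_beta : alpha ^+ 2 < beta) (beta_lt1 : beta < 1).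
Hypothesis p_ge1 : 1 <= p.
Hypothesis X_meas : product_measurable X.
Implicit Types (t : 'rV[R]_d) (u : nat -> cU).

Local Notation rho := (adam_rate beta).
Local Notation C0 := (adam_speed alpha beta).

(** The normalised step after [i] steps from zero moments, all gradients being
    evaluated at the same position [t]. *)
Definition frozen t u (j : 'I_d) i : R :=
  adam_ratio epsilon (mom alpha (fun k => X (u k) t 0 j) 0 i)
                     (vel beta (fun k => X (u k) t 0 j) 0 i).

Lemma frozen_le t u j i : `|frozen t u j i| <= C0.
Proof.
have v0 := @vel_ge0 _ _ _ alpha2_lt_beta beta_lt1 (fun k => X (u k) t 0 j) 0 i (lexx 0).
apply: (adam_ratio_le epsilon_gt0 v0 (lexx _)).
by apply: momentum_le => //; rewrite expr0n mulr0.
Qed.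

Lemma frozen_diff t t' u j i : `|frozen t u j i - frozen t' u j i| <=
  (1 + C0) / epsilon * dsum rho (fun k => 2 * `|X (u k) t - X (u k) t'|) 0 i.
Proof.
have c0 : 0 <= (1 + C0) / epsilon.
  by rewrite divr_ge0 ?(ltW epsilon_gt0)// addr_ge0// adam_speed_ge0.
have h0 : (0 : R) ^+ 2 <= C0 ^+ 2 * 0 by rewrite expr0n mulr0.
have := adam_ratio_diff epsilon_gt0 alpha_ge0 alpha_lt1 alpha2_lt_beta beta_lt1
  (fun k => X (u k) t 0 j) (fun k => X (u k) t' 0 j) 0 i (lexx 0) (lexx 0) h0.
move=> /le_trans; apply; rewrite ler_wpM2l// !subrr !normr0 addr0.
apply: ler_dsum => // [|k _]; first exact: sqrtr_ge0.
by rewrite ler_wpM2l//; have := rv_coord_le (X (u k) t - X (u k) t') j; rewrite !mxE.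
Qed.

Lemma measurable_frozen dT (T : measurableType dT) (t : T -> 'rV[R]_d)
    (u : T -> nat -> cU) j i :
  measurable_fun setT (t : T -> borelRV R d) ->
  (forall k, measurable_fun setT (fun w => u w k)) ->
  measurable_fun setT (fun w => frozen (t w) (u w) j i).
Proof.
move=> mt mu; have mx k : measurable_fun setT (fun w => X (u w k) (t w) 0 j).
  exact: measurable_X_coord.
apply: measurable_adam_ratio => //.
  elim: i => [|i IH] /=; first exact: measurable_cst.
  by apply: measurable_funD; apply: measurable_funM => //; exact: measurable_funM.
elim: i => [|i IH] /=; first exact: measurable_cst.
by apply: measurable_funD; apply: measurable_funM => //; exact: measurable_funX.
Qed.

Context (mu : set cU -> \bar R) (nu : probability (seqspace cU) R).
Hypotheses (nuP : iid_law mu nu) (muT : mu setT = 1%E).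
Context (growth kappa : R) (lip : R -> R).
Hypothesis lip_ge0 : forall r, 0 <= lip r.
Hypothesis X_growth : forall k t,
  mean_le nu (fun s => `|X (s k) t| `^ p) (growth * expR (kappa * `|t|)).
Hypothesis X_lip : forall k r t t', `|t| <= r -> `|t'| <= r ->
  mean_le nu (fun s => `|X (s k) t - X (s k) t'| `^ p) (lip r * `|t - t'| `^ p).

Lemma measurable_X_seq k t :
  measurable_fun setT ((fun s : seqspace cU => X (s k) t) : _ -> borelRV R d).
Proof.
apply: (@measurable_X _ _ _ _ _ X_meas _ _ (fun s : seqspace cU => s k) (fun=> t)).
  exact: measurable_coord.
exact: measurable_cst.
Qed.

Lemma measurable_X_seqB k t t' :
  measurable_fun setT (fun s : seqspace cU => `|X (s k) t - X (s k) t'|).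
Proof.
apply: measurable_rv_norm; apply: measurable_to_rv => j.
rewrite (_ : (fun s => _) = (fun s : seqspace cU => X (s k) t 0 j - X (s k) t' 0 j)).
  apply: measurable_funB.
    exact: (measurableT_comp (measurable_rv_coord j) (measurable_X_seq k t)).
  exact: (measurableT_comp (measurable_rv_coord j) (measurable_X_seq k t')).
by apply/funext => s; rewrite !mxE.
Qed.

Lemma mean_X k t :
  mean_le nu (fun s => `|X (s k) t|) (1 + growth * expR (kappa * `|t|)).
Proof.
apply: (@mean_le_le _ _ (seqspace cU) nu _ (fun s => 1 + `|X (s k) t| `^ p)) => //.
- exact: measurable_rv_norm (measurable_X_seq k t).
- by move=> s; apply: le_1DpowR.
- by apply: mean_leD => //; exact: mean_le_cst.
Qed.

(** The first moment is at most [1] plus the [p]-th; rescaling by [|t - t'|]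
    before this step keeps the bound linear in the distance. *)
Lemma mean_X_lip k r t t' : `|t| <= r -> `|t'| <= r ->
  mean_le nu (fun s => `|X (s k) t - X (s k) t'|) ((1 + lip r) * `|t - t'|).
Proof.
move=> tr tr'; have [->|tt'] := eqVneq t t'.
  under [X in mean_le _ X]funext do rewrite subrr normr0.
  by rewrite subrr normr0 mulr0; exact: mean_le_cst.
have e0 : 0 < `|t - t'| by rewrite normr_gt0 subr_eq0.
set e := `|t - t'| in e0 *.
have -> : (1 + lip r) * e = e * (1 + e `^ (- p) * (lip r * e `^ p)).
  rewrite mulrC; congr (_ * (_ + _)); rewrite mulrCA -powRD ?(gt_eqF e0) ?implybT//.
  by rewrite addNr powRr0 mulr1.
apply: (@mean_le_le _ _ (seqspace cU) nu _
  (fun s => e * (1 + e `^ (- p) * `|X (s k) t - X (s k) t'| `^ p))) => //.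
- exact: measurable_X_seqB.
- move=> s; set x := `|_|; rewrite -ler_pdivrMl// mulrC.
  apply: (le_trans (le_1DpowR p_ge1 (divr_ge0 (normr_ge0 _) (ltW e0)))).
  rewrite lerD2l powRM ?invr_ge0 ?(ltW e0)// mulrC ler_wpM2r ?powR_ge0//.
  by rewrite -powR_inv1 ?(ltW e0)// -powRrM mulN1r.
- apply: mean_leZ; first exact: ltW.
  apply: mean_leD; first exact: mean_le_cst.
  by apply: mean_leZ (X_lip _ tr tr'); exact: powR_ge0.
Qed.

Lemma mean_dsum (x : nat -> seqspace cU -> R) A i :
  (forall k, mean_le nu (x k) A) ->
  mean_le nu (fun s => dsum rho (fun k => x k s) 0 i) (A / (1 - rho)).
Proof.
move=> xA; have A0 := mean_le_ge0 (xA 0%N).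
have r1 : 0 < 1 - rho by rewrite subr_gt0 adam_rate_lt1.
elim: i => [|i IH] /=.
  by apply: (mean_leW _ (mean_le_cst _ (lexx 0))); rewrite divr_ge0// ltW.
have -> : A / (1 - rho) = rho * (A / (1 - rho)) + A by field; rewrite gt_eqF.
apply: mean_leD => //; apply: mean_leZ => //; exact: ltW (adam_rate_gt0 alpha2_lt_beta).
Qed.

Definition frozen_mean i t j : R := \int[nu]_s frozen t s j i.

Lemma measurable_frozen_seq t j i :
  measurable_fun setT (fun s : seqspace cU => frozen t s j i).
Proof.
apply: (@measurable_frozen _ (seqspace cU) (fun=> t) (fun s => s)).
  exact: measurable_cst.
by move=> k; exact: measurable_coord.
Qed.

Lemma frozen_mean_le i t j : `|frozen_mean i t j| <= C0.
Proof.
apply: Rintegral_abs_le; first exact: measurable_frozen_seq.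
by move=> s; exact: frozen_le.
Qed.

Definition field_lip r : R := (1 + C0) / epsilon * (2 * (1 + lip r) / (1 - rho)).

Lemma field_lip_ge0 r : 0 <= field_lip r.
Proof.
have r1 : 0 < 1 - rho by rewrite subr_gt0 adam_rate_lt1.
rewrite /field_lip !mulr_ge0 ?invr_ge0 ?(ltW epsilon_gt0) ?(ltW r1)//.
- by rewrite addr_ge0// adam_speed_ge0.
- by rewrite addr_ge0.
Qed.

Lemma frozen_mean_lip r i t t' j : `|t| <= r -> `|t'| <= r ->
  `|frozen_mean i t j - frozen_mean i t' j| <= field_lip r * `|t - t'|.
Proof.
move=> tr tr'.
apply: (@Rintegral_dist_le _ _ (seqspace cU) nu _ _ (fun s => (1 + C0) / epsilon *
    dsum rho (fun k => 2 * `|X (s k) t - X (s k) t'|) 0 i) C0).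
- exact: measurable_frozen_seq.
- exact: measurable_frozen_seq.
- by move=> s; exact: frozen_le.
- by move=> s; exact: frozen_le.
- have -> : field_lip r * `|t - t'| = (1 + C0) / epsilon *
      ((2 * ((1 + lip r) * `|t - t'|)) / (1 - rho)).
    by rewrite /field_lip; ring.
  apply: mean_leZ.
    by rewrite divr_ge0 ?(ltW epsilon_gt0)// addr_ge0// adam_speed_ge0.
  apply: (mean_dsum (x := fun k s => 2 * `|X (s k) t - X (s k) t'|)) => k.
  by apply: mean_leZ => //; exact: mean_X_lip.
- by move=> s; exact: frozen_diff.
Qed.

(** The same step with the samples listed from the most recent one. *)
Definition frozen_ser t u (j : 'I_d) i : R :=
  adam_ratio epsilon ((1 - alpha) * \sum_(k < i) alpha ^+ k * X (u k) t 0 j)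
                     ((1 - beta) * \sum_(k < i) beta ^+ k * X (u k) t 0 j ^+ 2).

Lemma frozen_backwards t (s : seqspace cU) j i :
  frozen t (backwards i s) j i = frozen_ser t s j i.
Proof.
rewrite /frozen /frozen_ser /mom /vel !dsumE !mulr0 !add0r !mulr_sumr.
have E (k : 'I_i) : backwards i s (i - k.+1)%N = s k.
  rewrite /backwards ltn_subrL /= (leq_ltn_trans _ (ltn_ord k))//.
  by rewrite -subSn// subSS subKn// ltnW.
by congr adam_ratio; apply: eq_bigr => k _; rewrite E mulrCA.
Qed.

Lemma measurable_frozen_ser t j i :
  measurable_fun setT (fun s : seqspace cU => frozen_ser t s j i).
Proof.
rewrite (_ : (fun s => _) = (fun s : seqspace cU => frozen t s j i) \o backwards i).
  exact: measurableT_comp (measurable_frozen_seq t j i) (measurable_backwards i).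
by apply/funext => s /=; rewrite frozen_backwards.
Qed.

Lemma frozen_ser_le t (s : seqspace cU) j i : `|frozen_ser t s j i| <= C0.
Proof. by rewrite -frozen_backwards frozen_le. Qed.

Lemma frozen_mean_ser i t j : frozen_mean i t j = \int[nu]_s frozen_ser t s j i.
Proof.
rewrite /frozen_mean (integral_backwards (a := i) nuP muT (measurable_frozen_seq t j i)).
  by apply: eq_Rintegral => s _; rewrite frozen_backwards.
apply: (@bounded_integrable _ _ _ nu _ C0) => /=.
  exact: measurableT_comp (measurable_frozen_seq t j i) (measurable_backwards i).
by move=> s; exact: frozen_le.
Qed.

(** One more sample in the past enters the moments with weights [alpha ^ i] and
    [beta ^ i], hence the numerator and the root of the second moment with
    weight at most [rho ^ i]. *)
Lemma frozen_ser_step t (s : seqspace cU) j i :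
  `|frozen_ser t s j i.+1 - frozen_ser t s j i| <=
  (1 + C0) / epsilon * (rho ^+ i * `|X (s i) t|).
Proof.
have b0 := ltW (beta_gt0 alpha2_lt_beta); have b1 : 0 <= 1 - beta by rewrite subr_ge0 ltW.
have r0 := ltW (adam_rate_gt0 alpha2_lt_beta).
pose A n := (1 - alpha) * \sum_(k < n) alpha ^+ k * X (s k) t 0 j.
pose Q n := (1 - beta) * \sum_(k < n) beta ^+ k * X (s k) t 0 j ^+ 2.
have Q0 n : 0 <= Q n.
  rewrite mulr_ge0//; apply: sumr_ge0 => k _.
  by rewrite mulr_ge0 ?sqr_ge0// exprn_ge0.
have AQ : A i ^+ 2 <= C0 ^+ 2 * Q i.
  have E (k : 'I_i) : backwards i s (i - k.+1)%N = s k.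
    rewrite /backwards ltn_subrL /= (leq_ltn_trans _ (ltn_ord k))//.
    by rewrite -subSn// subSS subKn// ltnW.
  have -> : A i = mom alpha (fun k => X (backwards i s k) t 0 j) 0 i.
    rewrite /mom dsumE mulr0 add0r /A mulr_sumr; apply: eq_bigr => k _.
    by rewrite E mulrCA.
  have -> : Q i = vel beta (fun k => X (backwards i s k) t 0 j) 0 i.
    rewrite /vel dsumE mulr0 add0r /Q mulr_sumr; apply: eq_bigr => k _.
    by rewrite E mulrCA.
  by apply: momentum_le => //; rewrite expr0n mulr0.
have := adam_ratio_lip epsilon_gt0 (A i.+1) (Q i.+1) (Q0 i) AQ.
move=> /le_trans; apply; rewrite mulrAC ler_wpM2r ?invr_ge0 ?(ltW epsilon_gt0)//.
rewrite mulrDl mul1r; set x := X (s i) t 0 j.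
have xn : `|x| <= `|X (s i) t| by exact: rv_coord_le.
have Ed : A i.+1 - A i = (1 - alpha) * alpha ^+ i * x.
  by rewrite /A big_ord_recr /= /x; ring.
have r_i : 0 <= rho ^+ i by rewrite exprn_ge0.
apply: lerD.
  have c0 : 0 <= (1 - alpha) * alpha ^+ i.
    by rewrite mulr_ge0 ?exprn_ge0// subr_ge0 ltW.
  rewrite Ed normrM (ger0_norm c0); apply: ler_pM => //.
  rewrite -[leRHS]mul1r; apply: ler_pM; rewrite ?exprn_ge0 ?subr_ge0 ?(ltW alpha_lt1)//.
    by rewrite gerBl.
  by rewrite lerXn2r// alpha_le_rate.
rewrite ler_wpM2l ?adam_speed_ge0//.
set y := Num.sqrt (1 - beta) * (rho ^+ i * x).
have QS : Q i.+1 = Num.sqrt (Q i) ^+ 2 + y ^+ 2.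
  rewrite sqr_sqrtr ?Q0// exprMn sqr_sqrtr// exprMn exprAC (adam_rate2 alpha2_lt_beta).
  by rewrite /Q big_ord_recr /= mulrDr.
have := dist_sqrt_sqD_le (Num.sqrt (Q i)) y (Num.sqrt (Q i)) 0.
rewrite -QS subrr normr0 add0r subr0 expr0n addr0 (sqr_sqrtr (Q0 i)) => /le_trans.
apply; rewrite /y !normrM (ger0_norm (sqrtr_ge0 _)) (ger0_norm r_i).
rewrite -[leRHS]mul1r; apply: ler_pM; rewrite ?sqrtr_ge0 ?mulr_ge0//.
  by rewrite -[leRHS]sqrtr1 ler_wsqrtr// gerBl.
by rewrite ler_wpM2l.
Qed.

Lemma frozen_mean_step i t j :
  `|frozen_mean i.+1 t j - frozen_mean i t j| <=
  (1 + C0) / epsilon * (1 + growth * expR (kappa * `|t|)) * rho ^+ i.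
Proof.
rewrite !frozen_mean_ser -mulrA [_ * rho ^+ i]mulrC.
apply: (@Rintegral_dist_le _ _ (seqspace cU) nu _ _ (fun s => (1 + C0) / epsilon *
    (rho ^+ i * `|X (s i) t|)) C0).
- exact: measurable_frozen_ser.
- exact: measurable_frozen_ser.
- by move=> s; exact: frozen_ser_le.
- by move=> s; exact: frozen_ser_le.
- apply: mean_leZ.
    by rewrite divr_ge0 ?(ltW epsilon_gt0)// addr_ge0// adam_speed_ge0.
  apply: mean_leZ (mean_X i t).
  by rewrite exprn_ge0// (ltW (adam_rate_gt0 alpha2_lt_beta)).
- by move=> s; exact: frozen_ser_step.
Qed.

Definition field_err r : R :=
  (1 + C0) / epsilon * (1 + growth * expR (kappa * r)) / (1 - rho).

Lemma frozen_mean_cauchy i n t j :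
  `|frozen_mean (i + n) t j - frozen_mean i t j| <= field_err `|t| * rho ^+ i.
Proof.
have r0 := adam_rate_gt0 alpha2_lt_beta; have r1 := adam_rate_lt1 beta_lt1.
set B := (1 + C0) / epsilon * (1 + growth * expR (kappa * `|t|)).
have B0 : 0 <= B.
  rewrite mulr_ge0 ?(mean_le_ge0 (mean_X 0 t))// divr_ge0 ?(ltW epsilon_gt0)//.
  by rewrite addr_ge0// adam_speed_ge0.
suff h : `|frozen_mean (i + n) t j - frozen_mean i t j| <=
    B * (\sum_(k < n) rho ^+ (i + k)).
  apply: (le_trans h); rewrite /field_err -/B -mulrA ler_wpM2l//.
  rewrite (eq_bigr (fun k : 'I_n => rho ^+ i * rho ^+ k)) => [|k _]; last by rewrite exprD.
  rewrite -mulr_sumr mulrC ler_wpM2r ?exprn_ge0 ?(ltW r0)//.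
  have E : (1 - rho) * (\sum_(k < n) rho ^+ k) = 1 - rho ^+ n.
    by rewrite -[RHS]opprB subrX1 -mulNr opprB.
  rewrite -[leRHS]mul1r ler_pdivlMr ?subr_gt0// mulrC E gerBl.
  by rewrite exprn_ge0// ltW.
elim: n => [|n IH]; first by rewrite addn0 subrr normr0 big_ord0 mulr0.
rewrite big_ord_recr /= mulrDr addnS -(subrKA (frozen_mean (i + n) t j)).
rewrite (le_trans (ler_normD _ _))// addrC lerD//.
exact: frozen_mean_step.
Qed.

End Frozen.

(** * The Adam vector field as a limit *)

Section MeasurableLimits.
Context {R : realType} {dT : measure_display} {T : measurableType dT}.

(** The Cauchy criterion, with countable quantifiers. *)
Lemma measurable_cvgn_set (h : nat -> T -> R) :
  (forall n, measurable_fun setT (h n)) -> measurable [set w | cvgn (h ^~ w)].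
Proof.
move=> mh.
rewrite (_ : [set w | _] = \bigcap_(k : nat) \bigcup_(N : nat)
  \bigcap_(n : nat) [set w | `|h N w - h (N + n)%N w| <= k.+1%:R^-1]).
  apply: bigcapT_measurable => k; apply: bigcupT_measurable => N.
  apply: bigcapT_measurable => n; apply: measurable_set_ler => //.
  by apply: measurable_abs_fun; exact: measurable_funB.
apply/seteqP; split => w /=.
  move=> cw k _; have /cvg_ex[l /= hl] := cw.
  have e0 : 0 < k.+1%:R^-1 / 2 :> R by rewrite divr_gt0// invr_gt0.
  have /cvgrPdist_le/(_ _ e0)[N _ hN] := hl.
  exists N => // n _ /=; have h1 := hN N (leqnn N); have h2 := hN (N + n)%N (leq_addr _ _).
  rewrite -(subrKA l) (le_trans (ler_normD _ _))// distrC.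
  by rewrite [X in _ <= X]splitr lerD.
move=> cw; apply/cauchy_cvgP/cauchy_exP => e e0.
have [k ke] : exists k : nat, k.+1%:R^-1 < e.
  exists `|Num.ceil e^-1|%N.
  rewrite invf_plt ?posrE// (le_lt_trans (ceil_ge _))// -natr1 natr_absz ltr_pwDr//.
  by rewrite ler_int ler_norm.
have [N _ hN] := cw k I; exists (h N w); exists N => // n /= Nn.
have := hN (n - N)%N I; rewrite /= subnKC// => hh.
by rewrite /ball/=; exact: le_lt_trans hh ke.
Qed.

Lemma measurable_limn (h : nat -> T -> R) :
  (forall n, measurable_fun setT (h n)) -> measurable_fun setT (fun w => limn (h ^~ w)).
Proof.
move=> mh; have mC := measurable_cvgn_set mh.
rewrite -(setUv [set w | cvgn (h ^~ w)]).
apply/measurable_funU => //; first exact: measurableC.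
split.
  apply: (measurable_fun_cvg (h := h)) => [n|w cw]; first exact: measurable_funTS.
  exact: cw.
apply: (eq_measurable_fun (fun=> point)); last exact: measurable_cst.
by move=> w /[!inE] /= ncw; rewrite dvgP.
Qed.

(** The mean of the sum is bounded by a geometric series. *)
Lemma ae_cvg_series (P : probability T R) (r A : R) (x : nat -> T -> R) :
  0 <= r -> r < 1 -> (forall k, mean_le P (x k) A) ->
  {ae P, forall w, cvgn (series (fun k => r ^+ k * x k w))}.
Proof.
move=> r0 r1 xA; have A0 := mean_le_ge0 (xA 0%N).
have ry k : mean_le P (fun w => r ^+ k * x k w) (r ^+ k * A).
  by apply: mean_leZ; rewrite ?exprn_ge0.
have y0 k w : 0 <= r ^+ k * x k w by have [_ + _] := ry k; apply.
pose G w := (\sum_(k <oo) (r ^+ k * x k w)%:E)%E.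
have G0 w : (0 <= G w)%E by apply: nneseries_ge0 => k _ _; rewrite lee_fin y0.
have mG : measurable_fun setT G.
  apply: ge0_emeasurable_sum => // k; first by move=> w _ _; rewrite lee_fin y0.
  by move=> _; apply/measurable_EFinP; have [] := ry k.
have iG : P.-integrable setT G.
  apply/integrableP; split => //.
  under eq_integral => w _ do rewrite (gee0_abs (G0 w)).
  rewrite integral_nneseries//; last 2 first.
  - by move=> k; apply/measurable_EFinP; have [] := ry k.
  - by move=> k w _; rewrite lee_fin y0.
  apply: (@le_lt_trans _ _ (A / (1 - r))%:E); last exact: ltry.
  apply: lime_le.
    by apply: is_cvg_nneseries => k _ _; apply: integral_ge0 => w _; rewrite lee_fin y0.
  apply: nearW => n; rewrite big_mkord.
  apply: (@le_trans _ _ (\sum_(k < n) (r ^+ k * A)%:E)%E).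
    by apply: lee_sum => k _; have [] := ry k.
  rewrite sumEFin lee_fin -mulr_suml mulrC ler_wpM2l//.
  have E : (1 - r) * (\sum_(k < n) r ^+ k) = 1 - r ^+ n.
    by rewrite -[RHS]opprB subrX1 -mulNr opprB.
  by rewrite -[leRHS]mul1r ler_pdivlMr ?subr_gt0// mulrC E gerBl exprn_ge0.
apply: filterS (integrable_ae measurableT iG) => w /(_ I) Gw.
apply: nondecreasing_is_cvgn; first exact: nondecreasing_series.
exists (fine (G w)) => _ [n _ <-]; rewrite -lee_fin fineK// /series/= -sumEFin.
by apply: nneseries_lim_ge => k _ _; rewrite lee_fin y0.
Qed.

End MeasurableLimits.

Section FieldLimit.
Context {R : realType} {dU : measure_display} {cU : measurableType dU} {d : nat}.
Context (X : cU -> 'rV[R]_d -> 'rV[R]_d) (alpha beta epsilon p : R).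
Hypotheses (epsilon_gt0 : 0 < epsilon).
Hypotheses (alpha_ge0 : 0 <= alpha) (alpha_lt1 : alpha < 1).
Hypotheses (alpha2_lt_beta : alpha ^+ 2 < beta) (beta_lt1 : beta < 1).
Hypothesis X_meas : product_measurable X.
Context {dV : measure_display} {OV : measurableType dV} (PV : probability OV R).
Context (V : nat -> {RV PV >-> cU}).

(** Almost surely both series converge, being dominated by the [rho]-discounted
    sum of the norms of the gradients; the frozen steps are bounded by the
    speed, so their means converge too. *)
Lemma frozen_ser_cvg (t : 'rV[R]_d) A j :
  (forall k, mean_le PV (fun w => `|X (V k w) t|) A) ->
  (\int[PV]_w frozen_ser X alpha beta epsilon t (fun k => V k w) j i) @[i --> \oo]
    --> adam_field X alpha beta epsilon V t 0 j.
Proof.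
move=> XA.
have r0 := adam_rate_gt0 alpha2_lt_beta; have r1 := adam_rate_lt1 beta_lt1.
have b0 := ltW (beta_gt0 alpha2_lt_beta).
have mx k : measurable_fun setT (fun w => X (V k w) t 0 j).
  by apply: measurable_X_coord => //; exact: measurable_cst.
pose fser i w := frozen_ser X alpha beta epsilon t (fun k => V k w) j i.
pose sb w := series (fun k => beta ^+ k * `|X (V k w) t 0 j| ^+ 2).
pose sa w := series (fun k => alpha ^+ k * X (V k w) t 0 j).
pose h w := (Num.sqrt ((1 - beta) * limn (sb w)) + epsilon)^-1 * limn (sa w).
have fserE i w : fser i w =
    adam_ratio epsilon ((1 - alpha) * sa w i) ((1 - beta) * sb w i).
  rewrite /fser /frozen_ser /sa /sb /series /= !big_mkord.
  by congr (adam_ratio _ _ (_ * _)); apply: eq_bigr => k _; rewrite real_normK ?num_real.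
have msa i : measurable_fun setT (fun w => sa w i).
  by apply: measurable_sum => k; exact: measurable_funM.
have msb i : measurable_fun setT (fun w => sb w i).
  apply: measurable_sum => k; apply: measurable_funM => //; apply: measurable_funX.
  exact: measurable_abs_fun.
have mfser i : measurable_fun setT (fser i).
  rewrite (funext (fserE i)).
  by apply: measurable_adam_ratio => //; exact: measurable_funM.
have hE w : (1 - alpha) * h w =
    adam_ratio epsilon ((1 - alpha) * limn (sa w)) ((1 - beta) * limn (sb w)).
  by rewrite /h /adam_ratio; ring.
have mh : measurable_fun setT (fun w => (1 - alpha) * h w).
  rewrite (funext hE); apply: measurable_adam_ratio => //;
  apply: measurable_funM => //.
    exact: (measurable_limn (h := fun i w => sa w i)).
  exact: (measurable_limn (h := fun i w => sb w i)).
have cvg_h : {ae PV, forall w, setT w -> (fser i w)%:E @[i --> \oo] --> ((1 - alpha) * h w)%:E}.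
  apply: filterS (ae_cvg_series (ltW r0) r1 XA) => w cw _.
  have cv (u : nat -> R) : (forall k, `|u k| <= adam_rate beta ^+ k * `|X (V k w) t|) ->
      cvgn (series u).
    move=> hu; apply: normed_cvg; apply: series_le_cvg cw => // k /=.
      by [].
    by rewrite mulr_ge0// exprn_ge0// ltW.
  have csa : cvgn (sa w).
    apply: cv => k; rewrite normrM (ger0_norm (exprn_ge0 _ alpha_ge0)).
    apply: ler_pM; rewrite ?exprn_ge0//; last exact: rv_coord_le.
    by rewrite lerXn2r ?nnegrE ?(ltW r0)// alpha_le_rate.
  have csb : cvgn (sb w).
    have [M [_ hM]] := cvg_series_bounded cw.
    have {hM} hM := hM (`|M| + 1) (ltr_pwDr ltr01 (ler_norm _)).
    have : cvgn (series (fun k => (`|M| + 1) * (adam_rate beta ^+ k * `|X (V k w) t|))).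
      by rewrite seriesZ; exact: is_cvgZr.
    apply: series_le_cvg => k.
    - by rewrite mulr_ge0 ?exprn_ge0.
    - by rewrite !mulr_ge0 ?addr_ge0 ?exprn_ge0 ?(ltW r0).
    - rewrite -[X in X ^+ k * _ ^+ 2](adam_rate2 alpha2_lt_beta) exprAC -exprMn expr2.
      have hk : adam_rate beta ^+ k * `|X (V k w) t 0 j| <=
          adam_rate beta ^+ k * `|X (V k w) t|.
        by rewrite ler_wpM2l ?exprn_ge0 ?(ltW r0)// rv_coord_le.
      apply: ler_pM => //; rewrite ?mulr_ge0 ?exprn_ge0 ?(ltW r0)//.
      by apply: (le_trans hk); apply: (le_trans (ler_norm _)); exact: hM.
  rewrite hE; under eq_fun do rewrite fserE.
  apply: cvg_EFin; first exact: nearW.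
  apply: cvgM; first by apply: cvgMr => //; exact: csa.
  apply: cvgV.
    by rewrite gt_eqF// ltr_wpDl// sqrtr_ge0.
  apply: cvgD; last exact: cvg_cst.
  apply: continuous_cvg; first exact: sqrt_continuous.
  by apply: cvgMr => //; exact: csb.
have iC : PV.-integrable setT (EFin \o (fun=> adam_speed alpha beta)).
  by apply: (@bounded_integrable _ _ _ PV _ `|adam_speed alpha beta|).
have dom : {ae PV, forall w n, setT w -> `|(fser n w)%:E| <= (adam_speed alpha beta)%:E}%E.
  apply: aeW => w n _; rewrite lee_fin.
  exact: (frozen_ser_le X epsilon_gt0 alpha2_lt_beta beta_lt1 t (fun k => V k w)).
have mefser n : measurable_fun setT (fun w => (fser n w)%:E).
  exact/measurable_EFinP.
have meh : measurable_fun setT (fun w => ((1 - alpha) * h w)%:E).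
  exact/measurable_EFinP.
have [ih _ cvgI] := dominated_convergence measurableT mefser meh cvg_h iC dom.
have a1 : 1 - alpha != 0 by rewrite subr_eq0 gt_eqF.
have ih' : PV.-integrable setT (EFin \o h).
  have -> : EFin \o h = (fun w => (1 - alpha)^-1%:E * ((1 - alpha) * h w)%:E)%E.
    by apply/funext => w /=; rewrite -EFinM mulrA mulVf// mul1r.
  exact: integrableZl.
have -> : adam_field X alpha beta epsilon V t 0 j = \int[PV]_w ((1 - alpha) * h w).
  by rewrite mxE (RintegralZl _ measurableT ih') unlock.
apply: fine_cvg; rewrite fineK; first exact: cvgI.
exact: integral_fune_fin_num.
Qed.

End FieldLimit.

(** * Moments along the path and the error of freezing *)

Section Window.
Context {R : realType} {dU : measure_display} {cU : measurableType dU} {d : nat}.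
Context (X : cU -> 'rV[R]_d -> 'rV[R]_d) (gamma : nat -> R).
Context (alpha beta epsilon p : R) (start : 'rV[R]_d).
Hypotheses (epsilon_gt0 : 0 < epsilon).
Hypotheses (alpha_ge0 : 0 <= alpha) (alpha_lt1 : alpha < 1).
Hypotheses (alpha2_lt_beta : alpha ^+ 2 < beta) (beta_lt1 : beta < 1).
Hypothesis p_ge1 : 1 <= p.
Hypothesis X_meas : product_measurable X.
Hypothesis gamma_gt0 : forall n, (1 <= n)%N -> 0 < gamma n.
Hypothesis gamma_decr : forall m n, (1 <= m)%N -> (m <= n)%N -> gamma n <= gamma m.
Hypothesis gamma_cvg0 : gamma n @[n --> \oo] --> 0.
Context (mu : set cU -> \bar R) (nu : probability (seqspace cU) R).
Hypotheses (nuP : iid_law mu nu) (muT : mu setT = 1%E).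
Context (growth kappa : R) (lip : R -> R).
Hypothesis kappa_ge0 : 0 <= kappa.
Hypothesis lip_ge0 : forall r, 0 <= lip r.
Hypothesis X_growth : forall k (t : 'rV[R]_d),
  mean_le nu (fun s => `|X (s k) t| `^ p) (growth * expR (kappa * `|t|)).
Hypothesis X_lip : forall k r (t t' : 'rV[R]_d), `|t| <= r -> `|t'| <= r ->
  mean_le nu (fun s => `|X (s k) t - X (s k) t'| `^ p) (lip r * `|t - t'| `^ p).
Implicit Types s : seqspace cU.

Local Notation rho := (adam_rate beta).
Local Notation C0 := (adam_speed alpha beta).
Local Notation pos := (adam_pos X gamma alpha beta epsilon start).
Local Notation grad := (adam_grad X gamma alpha beta epsilon start).
Local Notation mom1 := (adam_mom1 X gamma alpha beta epsilon start).
Local Notation mom2 := (adam_mom2 X gamma alpha beta epsilon start).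

Let rho0 : 0 < rho := adam_rate_gt0 alpha2_lt_beta.
Let rho1 : rho < 1 := adam_rate_lt1 beta_lt1.
Let C00 : 0 <= C0 := adam_speed_ge0 alpha beta.

Let mpos n : measurable_fun setT ((fun s => pos s n) : _ -> borelRV R d).
Proof. exact: measurable_pos. Qed.

Let mgrad n : measurable_fun setT ((fun s => grad s n) : _ -> borelRV R d).
Proof.
apply: (@measurable_X _ _ _ _ _ X_meas _ _ (fun s : seqspace cU => s n)) => //.
exact: measurable_coord.
Qed.

(** Both moments are bounded in terms of this one quantity, which forgets at
    rate [rho] and does not depend on the coordinate. *)
Definition memory s n : R := dsum rho (fun k => `|grad s k|) 0 n.

Lemma memory_ge0 s n : 0 <= memory s n.
Proof. by apply: dsum_ge0 => //; exact: ltW. Qed.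

Lemma measurable_memory n : measurable_fun setT (fun s => memory s n).
Proof.
rewrite /memory; elim: n => [|n IH] /=; first exact: measurable_cst.
apply: measurable_funD; first exact: measurable_funM.
exact: measurable_rv_norm.
Qed.

Lemma sqrt_mom2_le s n j : Num.sqrt (mom2 s n 0 j) <= memory s n.
Proof.
have E : mom2 s (0 + n) 0 j = vel beta (fun k => grad s (0 + k) 0 j) (mom2 s 0 0 j) n.
  exact: mom2_vel.
rewrite add0n in E; rewrite E.
apply: (le_trans (sqrt_vel_le alpha2_lt_beta beta_lt1 _ _ _)); first by rewrite mxE.
apply: ler_dsum; rewrite ?(ltW rho0)//; first by rewrite mxE sqrtr0.
by move=> k _; exact: rv_coord_le.
Qed.

Lemma moments_le_memory s n j :
  `|mom1 s n 0 j| + Num.sqrt (mom2 s n 0 j) <= (1 + C0) * memory s n.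
Proof.
have v0 : 0 <= mom2 s n 0 j by exact: mom2_ge0.
have mv : mom1 s n 0 j ^+ 2 <= C0 ^+ 2 * mom2 s n 0 j by exact: mom1_le_mom2.
rewrite addrC mulrDl mul1r lerD ?sqrt_mom2_le//.
by rewrite (le_trans (abs_le_speed v0 mv))// ler_wpM2l// sqrt_mom2_le.
Qed.

Lemma pos_step s n : `|pos s n.+1 - pos s n| <= C0 * gamma n.+1.
Proof.
apply: rv_norm_le => [|j]; first by rewrite mulr_ge0// ltW// gamma_gt0.
by rewrite !mxE; exact: step_le.
Qed.

Lemma pos_dist_const s a n : `|pos s (a + n) - pos s a| <= C0 * (n%:R * gamma a.+1).
Proof.
have h : `|pos s (a + n) - pos s a| <= C0 * \sum_(a <= k < a + n) gamma k.+1.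
  exact: pos_dist_le.
apply: (le_trans h); rewrite ler_wpM2l//.
apply: (@le_trans _ _ (\sum_(a <= k < a + n) gamma a.+1)).
  by apply: ler_sum_nat => k /andP[ak _]; exact: gamma_decr.
by rewrite sumr_const_nat addKn mulr_natl.
Qed.

(** Given the first [n] samples the position is fixed and the next sample is
    fresh, so the growth bound of the innovation applies at this position. *)
Lemma mean_grad_weighted n :
  mean_le nu (fun s => `|grad s n| `^ p * expR (- (kappa * `|pos s n|))) growth.
Proof.
have mf : measurable_fun setT
    (fun s => `|grad s n| `^ p * expR (- (kappa * `|pos s n|))).
  apply: measurable_funM.
    by apply: measurable_powR_fun; exact: measurable_rv_norm.
  apply: measurable_expR_fun; apply: measurableT_comp => //.
  by apply: measurable_funM => //; exact: measurable_rv_norm.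
have g0 : 0 <= growth.
  by have := mean_le_ge0 (X_growth 0 0); rewrite pmulr_lge0 ?expR_gt0.
apply: (mean_le_merge nuP muT (a := n) (g := fun=> growth) mf) => [s||];
  [|exact: measurable_cst|exact: (mean_le_cst _ g0)].
have -> : growth = expR (- (kappa * `|pos s n|)) * (growth * expR (kappa * `|pos s n|)).
  by rewrite mulrCA -expRD addNr expR0 mulr1.
rewrite (_ : (fun s' => _) = (fun s' : seqspace cU =>
    expR (- (kappa * `|pos s n|)) * `|X (s' 0%N) (pos s n)| `^ p)).
  by apply: mean_leZ => //; exact: expR_ge0.
apply/funext => s'; rewrite /adam_grad pos_merge// mulrC.
by rewrite /merge ltnn subnn.
Qed.

(** The weight [expR (- kappa * |pos|)] compensates the growth of the gradients
    far from the origin. It changes by at most [expR (kappa * C0 * gamma)] per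
    step, which the contraction [rho] of the memory absorbs once the steps are
    small; hence the bound is uniform in [n] even if the path is unbounded. *)
Lemma memory_moment : exists A, forall n,
  mean_le nu (fun s => memory s n `^ p * expR (- (kappa * `|pos s n|))) A.
Proof.
pose c := (1 - rho) `^ (1 - p) * growth.
have g0 : 0 <= growth by exact: mean_le_ge0 (mean_grad_weighted 0).
have c0 : 0 <= c by rewrite mulr_ge0 ?powR_ge0.
have mf n : measurable_fun setT
    (fun s => memory s n `^ p * expR (- (kappa * `|pos s n|))).
  apply: measurable_funM; first by apply: measurable_powR_fun; exact: measurable_memory.
  apply: measurable_expR_fun; apply: measurableT_comp => //.
  by apply: measurable_funM => //; exact: measurable_rv_norm.
have step n A : mean_le nu (fun s => memory s n `^ p * expR (- (kappa * `|pos s n|))) A ->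
    mean_le nu (fun s => memory s n.+1 `^ p * expR (- (kappa * `|pos s n.+1|)))
      (expR (kappa * (C0 * gamma n.+1)) * (rho * A + c)).
  move=> hA.
  apply: (mean_le_le (g := fun s => expR (kappa * (C0 * gamma n.+1)) *
     (rho * (memory s n `^ p * expR (- (kappa * `|pos s n|))) +
      (1 - rho) `^ (1 - p) * (`|grad s n| `^ p * expR (- (kappa * `|pos s n|)))))) => //.
  - by move=> s; rewrite mulr_ge0 ?powR_ge0 ?expR_ge0.
  - move=> s.
    have -> : forall a b e q : R, q * (rho * (a * e) + (1 - rho) `^ (1 - p) * (b * e)) =
        (rho * a + (1 - rho) `^ (1 - p) * b) * (q * e) by move=> *; ring.
    rewrite ler_pM ?powR_ge0 ?expR_ge0//.
      by apply: powRD_le => //; exact: memory_ge0.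
    rewrite -expRD ler_expR -[leRHS]opprK opprB lerN2 -mulrBr ler_wpM2l//.
    rewrite lerBlDr -lerBlDl; apply: le_trans (pos_step s n).
    by rewrite distrC; exact: lerB_dist.
  - apply: mean_leZ; first exact: expR_ge0.
    apply: mean_leD; apply: mean_leZ; rewrite ?powR_ge0 ?(ltW rho0)//.
    exact: mean_grad_weighted.
pose r2 := (1 + rho) / 2.
have r20 : 0 < 1 - r2 by rewrite /r2; have := rho1; lra.
pose q n := expR (kappa * (C0 * gamma n.+1)).
have [N hN] : exists N, forall n, (N <= n)%N -> q n * rho <= r2 /\ q n <= 2.
  have cl : kappa * (C0 * gamma n.+1) @[n --> \oo] --> kappa * (C0 * 0).
    apply: cvgMr; apply: cvgMr.
    by rewrite (@cvg_shiftS R gamma).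
  have cq : q n @[n --> \oo] --> expR (kappa * (C0 * 0)).
    exact: (cvg_comp _ _ cl (@continuous_expR R _)).
  rewrite !mulr0 expR0 in cq.
  have e0 : 0 < Num.min 1 ((1 - rho) / 2).
    by rewrite lt_min ltr01 divr_gt0// subr_gt0.
  have /cvgrPdist_le/(_ _ e0)[N _ hN] := cq.
  exists N => n Nn; have := hN n Nn; rewrite le_min => /andP[].
  rewrite !ler_norml => /andP[h1 _] /andP[h2 _]; split; last by lra.
  have q1 : q n <= 1 + (1 - rho) / 2 by lra.
  apply: (@le_trans _ _ ((1 + (1 - rho) / 2) * rho)); first by rewrite ler_wpM2r// ltW.
  by rewrite /r2; have := rho1; have := rho0; nra.
have init n : exists A, mean_le nu (fun s => memory s n `^ p * expR (- (kappa * `|pos s n|))) A.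
  elim: n => [|n [A hA]]; last by exists (q n * (rho * A + c)); exact: step.
  exists 0; apply: (mean_le_le (mf 0%N) _ _ (mean_le_cst _ (lexx 0))) => s.
    by rewrite mulr_ge0 ?powR_ge0 ?expR_ge0.
  by rewrite /memory /= powR0 ?mul0r//; have := p_ge1; lra.
have upto m : exists A, forall n, (n <= m)%N ->
    mean_le nu (fun s => memory s n `^ p * expR (- (kappa * `|pos s n|))) A.
  elim: m => [|m [A hA]]; first by have [A hA] := init 0%N; exists A => n; rewrite leqn0 => /eqP ->.
  have [B hB] := init m.+1; exists (Num.max A B) => n; rewrite leq_eqVlt => /orP[/eqP ->|].
    by apply: mean_leW hB; rewrite le_max lexx orbT.
  by rewrite ltnS => /hA; apply: mean_leW; rewrite le_max lexx.
have [A hA] := upto N.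
pose B := Num.max A (2 * c / (1 - r2)).
have B0 : 0 <= B.
  by rewrite le_max divr_ge0 ?(ltW r20) ?orbT// mulr_ge0.
exists B => n; have [nN|/ltnW Nn] := leqP n N.
  by apply: mean_leW (hA n nN); rewrite le_max lexx.
rewrite -(subnKC Nn); elim: (n - N)%N => [|k IH].
  by rewrite addn0; apply: mean_leW (hA N (leqnn N)); rewrite le_max lexx.
rewrite addnS; apply: mean_leW (step _ _ IH).
have [h1 h2] := hN (N + k)%N (leq_addr _ _).
rewrite -/(q (N + k)%N) mulrDr mulrA.
apply: (@le_trans _ _ (r2 * B + 2 * c)).
  by rewrite lerD// ler_wpM2r.
have : 2 * c / (1 - r2) <= B by rewrite le_max lexx orbT.
by rewrite ler_pdivrMr//; lra.
Qed.

(** ** One block: gradients frozen at its first position *)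

Lemma sum_geometric_le (r : R) n : 0 <= r -> r < 1 ->
  \sum_(k < n) r ^+ k.+1 <= (1 - r)^-1.
Proof.
move=> r0 r1; have E : (1 - r) * (\sum_(k < n) r ^+ k) = 1 - r ^+ n.
  by rewrite -[RHS]opprB subrX1 -mulNr opprB.
rewrite -[leRHS]mul1r ler_pdivlMr ?subr_gt0// mulrC.
rewrite (eq_bigr (fun k : 'I_n => r * r ^+ k)) => [|k _]; last by rewrite exprS.
rewrite -mulr_sumr mulrCA E mulr_ile1 ?(ltW r1)// ?gerBl ?exprn_ge0//.
by rewrite subr_ge0 exprn_ile1// ltW.
Qed.

Variables (F : 'rV[R]_d -> 'rV[R]_d) (j : 'I_d).

Local Notation fmean := (frozen_mean X alpha beta epsilon nu).
Local Notation ferr := (field_err alpha beta epsilon growth kappa).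
Local Notation flip := (field_lip alpha beta epsilon lip).

Hypothesis F_err : forall i t, `|fmean i t j - F t 0 j| <= ferr `|t| * rho ^+ i.

Definition step_of s k : R :=
  adam_ratio epsilon (mom1 s k.+1 0 j) (mom2 s k.+1 0 j / (1 - beta ^+ k.+1)).

Definition freeze_err s a q : R := `|grad s (a + q)%N - X (s (a + q)%N) (pos s a)|.

Definition block_noise (a l : nat) t (u : nat -> cU) : R :=
  \sum_(i < l) gamma (a + i).+1 *
    (frozen X alpha beta epsilon t u j i.+1 - fmean i.+1 t j).

(** The frozen step starts from zero moments and omits the bias correction. The
    initial moments are forgotten at rate [rho], as are the errors from the
    motion of the position, and the correction decays like [beta ^ i]. *)
Lemma step_frozen_le s a i : `|step_of s (a + i) -
    frozen X alpha beta epsilon (pos s a) (shift a s) j i.+1| <=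
  (1 + C0) / epsilon * dsum rho (fun q => 2 * freeze_err s a q)
    ((1 + C0) * memory s a) i.+1 + C0 * beta ^+ i.+1.
Proof.
have c0 : 0 <= (1 + C0) / epsilon by rewrite divr_ge0 ?(ltW epsilon_gt0)// addr_ge0.
have b0 := ltW (beta_gt0 alpha2_lt_beta).
have v0 k : 0 <= mom2 s k 0 j by exact: mom2_ge0.
have mv k : mom1 s k 0 j ^+ 2 <= C0 ^+ 2 * mom2 s k 0 j by exact: mom1_le_mom2.
have [bb0 bb1] : 0 <= beta ^+ (a + i).+1 /\ beta ^+ (a + i).+1 < 1.
  by rewrite exprn_ge0// exprn_ilt1.
rewrite -(subrKA (adam_ratio epsilon (mom1 s (a + i).+1 0 j) (mom2 s (a + i).+1 0 j))).
rewrite (le_trans (ler_normD _ _))// addrC lerD//; last first.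
  apply: (le_trans (adam_ratio_bias epsilon_gt0 (v0 _) (mv _) bb0 bb1)).
  by rewrite ler_wpM2l// ler_wiXn2l ?(ltW beta_lt1)// ltnS leq_addl.
have E1 : mom1 s (a + i.+1) 0 j =
    mom alpha (fun k => grad s (a + k) 0 j) (mom1 s a 0 j) i.+1 by exact: mom1_mom.
have E2 : mom2 s (a + i.+1) 0 j =
    vel beta (fun k => grad s (a + k) 0 j) (mom2 s a 0 j) i.+1 by exact: mom2_vel.
rewrite addnS in E1 E2; rewrite E1 E2.
have h0 : (0 : R) ^+ 2 <= C0 ^+ 2 * 0 by rewrite expr0n mulr0.
apply: (le_trans (adam_ratio_diff epsilon_gt0 alpha_ge0 alpha_lt1 alpha2_lt_beta
  beta_lt1 _ (fun k => X (shift a s k) (pos s a) 0 j) _ _ (v0 a) (lexx 0) h0)).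
rewrite ler_wpM2l//; apply: ler_dsum; rewrite ?(ltW rho0)//.
  rewrite subr0 sqrtr0 subr0 (ger0_norm (sqrtr_ge0 _)).
  exact: moments_le_memory.
move=> k _; rewrite ler_wpM2l//.
have := rv_coord_le (grad s (a + k)%N - X (s (a + k)%N) (pos s a)) j.
by rewrite !mxE.
Qed.

Definition block_const r : R := ferr r / (1 - rho) + C0 / (1 - beta).
Definition memory_const : R := (1 + C0) ^+ 2 / (epsilon * (1 - rho)).
Definition freeze_const : R := 2 * (1 + C0) / (epsilon * (1 - rho)).

Lemma pos_telescope s a l : pos s (a + l) 0 j - pos s a 0 j =
  \sum_(i < l) gamma (a + i).+1 * step_of s (a + i).
Proof.
elim: l => [|l IH]; first by rewrite addn0 subrr big_ord0.
have E : pos s (a + l).+1 0 j = pos s (a + l) 0 j + gamma (a + l).+1 * step_of s (a + l).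
  exact: posS.
by rewrite big_ord_recr /= -IH addnS E; ring.
Qed.

Lemma ferr_le r r' : r <= r' -> ferr r <= ferr r'.
Proof.
move=> rr'; have g0 : 0 <= growth by exact: mean_le_ge0 (mean_grad_weighted 0).
rewrite /field_err ler_wpM2r ?invr_ge0 ?subr_ge0 ?(ltW rho1)//.
rewrite ler_wpM2l ?divr_ge0 ?(ltW epsilon_gt0) ?addr_ge0//.
by rewrite lerD2l ler_wpM2l// ler_expR ler_wpM2l.
Qed.

Lemma ferr_ge0 r : 0 <= ferr r.
Proof.
have g0 : 0 <= growth by exact: mean_le_ge0 (mean_grad_weighted 0).
rewrite /field_err divr_ge0 ?subr_ge0 ?(ltW rho1)// mulr_ge0//.
  by rewrite divr_ge0 ?(ltW epsilon_gt0) ?addr_ge0.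
by rewrite addr_ge0// mulr_ge0// expR_ge0.
Qed.

(** Every geometric error sums to a constant, so the past of the block costs a
    bounded number of steps and not a multiple of its length. *)
Lemma block_le s a l r : `|pos s a| <= r ->
  `|pos s (a + l) 0 j - pos s a 0 j
    - block_noise a l (pos s a) (shift a s)
    - (\sum_(i < l) gamma (a + i).+1) * F (pos s a) 0 j| <=
  gamma a.+1 * (memory_const * memory s a +
     freeze_const * (\sum_(q < l) freeze_err s a q) + block_const r).
Proof.
move=> sr; have b0 := ltW (beta_gt0 alpha2_lt_beta).
have c0 : 0 <= (1 + C0) / epsilon by rewrite divr_ge0 ?(ltW epsilon_gt0)// addr_ge0.
rewrite pos_telescope /block_noise mulr_suml -!sumrB.
apply: (@le_trans _ _ (\sum_(i < l) gamma a.+1 * ((1 + C0) / epsilon *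
    dsum rho (fun q => 2 * freeze_err s a q) ((1 + C0) * memory s a) i.+1 +
    C0 * beta ^+ i.+1 + ferr r * rho ^+ i.+1))).
  apply: (le_trans (ler_norm_sum _ _ _)); apply: ler_sum => i _.
  rewrite -mulrBr -mulrBr normrM (gtr0_norm (gamma_gt0 _))//.
  apply: ler_pM => //; first by rewrite ltW// gamma_gt0.
    by apply: gamma_decr => //; rewrite ltnS leq_addr.
  rewrite opprB addrA addrAC -(addrA (_ - _)) (le_trans (ler_normD _ _))//.
  apply: lerD; first exact: step_frozen_le.
  apply: (le_trans (F_err _ _)); rewrite ler_wpM2r ?exprn_ge0 ?(ltW rho0)//.
  exact: ferr_le.
rewrite -mulr_sumr ler_wpM2l ?(ltW (gamma_gt0 _))//.
rewrite !big_split/= -!mulr_sumr -addrA lerD//; last first.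
  rewrite /block_const addrC lerD// ler_wpM2l ?ferr_ge0// ?sum_geometric_le//.
  exact: ltW.
have h := @sum_dsum_le _ rho (ltW rho0) (fun q => 2 * freeze_err s a q)
   ((1 + C0) * memory s a) l rho1 (mulr_ge0 (addr_ge0 ler01 C00) (memory_ge0 s a))
   (fun q => mulr_ge0 (ler0n R 2) (normr_ge0 _)).
have r1 : 0 < 1 - rho by rewrite subr_gt0.
rewrite -ler_pdivlMl// in h.
apply: (le_trans (ler_wpM2l c0 h)).
rewrite -mulr_sumr /memory_const /freeze_const.
rewrite le_eqVlt; apply/orP; left; apply/eqP.
by field; rewrite !gt_eqF.
Qed.

(** ** The noise of a window of blocks *)

Lemma frozen_eq t (u u' : nat -> cU) i : (forall k, (k < i)%N -> u k = u' k) ->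
  frozen X alpha beta epsilon t u j i = frozen X alpha beta epsilon t u' j i.
Proof.
move=> uu'; rewrite /frozen /mom /vel.
congr adam_ratio; elim: i uu' => //= i IH uu'; rewrite IH ?uu'// => k ki;
by apply: uu'; rewrite ltnW.
Qed.

Lemma block_noise_eq a l t (u u' : nat -> cU) : (forall k, (k < l)%N -> u k = u' k) ->
  block_noise a l t u = block_noise a l t u'.
Proof.
move=> uu'; apply: eq_bigr => i _; rewrite (@frozen_eq t u u')// => k ki.
by apply: uu'; rewrite (leq_trans ki).
Qed.

Let Mfrozen t u i : `|frozen X alpha beta epsilon t u j i| <= C0.
Proof. exact: frozen_le. Qed.

Let Mfmean i t : `|fmean i t j| <= C0.
Proof. exact: (frozen_mean_le epsilon_gt0 alpha2_lt_beta beta_lt1 X_meas). Qed.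

Lemma block_noise_le a l t u : `|block_noise a l t u| <= 2 * C0 * (l%:R * gamma a.+1).
Proof.
apply: (le_trans (ler_norm_sum _ _ _)).
apply: (@le_trans _ _ (\sum_(i < l) 2 * C0 * gamma a.+1)); last first.
  by rewrite sumr_const card_ord -[leLHS]mulr_natl mulrCA.
apply: ler_sum => i _; rewrite normrM (gtr0_norm (gamma_gt0 _))// mulrC.
apply: ler_pM => //; first by rewrite ltW// gamma_gt0.
  by rewrite (le_trans (ler_normB _ _))// mulr_natl mulr2n lerD.
by apply: gamma_decr => //; rewrite ltnS leq_addr.
Qed.

(** The mean is locally Lipschitz in the position, hence continuous. *)
Lemma measurable_fmean dT (T : measurableType dT) (t : T -> 'rV[R]_d) i :
  measurable_fun setT (t : T -> borelRV R d) ->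
  measurable_fun setT (fun w => fmean i (t w) j).
Proof.
move=> mt.
have cf : continuous (fun x : 'rV[R]_d => fmean i x j).
  move=> x; apply/(cvgrPdist_le (FF := nbhs_filter x)) => e e0.
  pose L := flip (`|x| + 1).
  have L0 : 0 <= L by apply: field_lip_ge0.
  have L1 : 0 < L + 1 by rewrite ltr_wpDl.
  have r0 : 0 < Num.min 1 (e / (L + 1)) by rewrite lt_min ltr01 divr_gt0.
  apply: (@filterS _ _ (nbhs_filter x) _ _ _ (nbhsx_ballx x _ r0)) => y.
  rewrite mx_norm_ball /ball_ /= lt_min => /andP[/ltW yx1 /ltW yx].
  have ny : `|y| <= `|x| + 1.
    by rewrite -lerBlDl; apply: le_trans yx1; rewrite distrC; exact: lerB_dist.
  apply: (@le_trans _ _ (L * `|x - y|)).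
    have nx : `|x| <= `|x| + 1 by rewrite lerDl.
    exact: (frozen_mean_lip epsilon_gt0 alpha_ge0 alpha_lt1 alpha2_lt_beta beta_lt1
      p_ge1 X_meas X_lip i j nx ny).
  rewrite (le_trans (ler_wpM2l L0 yx))// mulrCA ler_piMr ?(ltW e0)//.
  by rewrite ler_pdivrMr ?mul1r ?lerDl.
exact: (measurableT_comp (measurable_rv_continuous cf) mt).
Qed.

Lemma measurable_block_noise dT (T : measurableType dT) a l (t : T -> 'rV[R]_d)
    (u : T -> nat -> cU) :
  measurable_fun setT (t : T -> borelRV R d) ->
  (forall k, measurable_fun setT (fun w => u w k)) ->
  measurable_fun setT (fun w => block_noise a l (t w) (u w)).
Proof.
move=> mt mu'; apply: measurable_sum => i; apply: measurable_funM => //.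
apply: measurable_funB; last exact: measurable_fmean.
exact: (@measurable_frozen _ _ _ _ X alpha beta epsilon epsilon_gt0 X_meas _ _ t u j _ mt mu').
Qed.

Let msamp k : measurable_fun setT (fun s : seqspace cU => s k : cU).
Proof. exact: measurable_coord. Qed.

Lemma block_noise_centred a l t : \int[nu]_s block_noise a l t s = 0.
Proof.
have mf i : measurable_fun setT (fun s : seqspace cU => frozen X alpha beta epsilon t s j i).
  exact: measurable_frozen_seq.
have if_ i := bounded_integrable nu (mf i) (fun s => Mfrozen t s i).
have ic (c : R) : nu.-integrable setT (EFin \o (fun=> c)).
  by apply: (@bounded_integrable _ _ _ nu _ `|c|).
rewrite /block_noise; elim: l => [|l IH].
  under eq_Rintegral do rewrite big_ord0.
  by rewrite Rintegral_cst// mul0r.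
under eq_Rintegral do rewrite big_ord_recr /=.
have mB : measurable_fun setT (fun s : seqspace cU => block_noise a l t s).
  by apply: (@measurable_block_noise _ (seqspace cU) a l (fun=> t) (fun s => s)).
have iB := bounded_integrable nu mB (block_noise_le a l t).
have mD : measurable_fun setT (fun s : seqspace cU =>
    gamma (a + l).+1 * (frozen X alpha beta epsilon t s j l.+1 - fmean l.+1 t j)).
  by apply: measurable_funM => //; exact: measurable_funB.
have iD : nu.-integrable setT (EFin \o (fun s : seqspace cU =>
    gamma (a + l).+1 * (frozen X alpha beta epsilon t s j l.+1 - fmean l.+1 t j))).
  apply: (bounded_integrable nu mD (M := gamma (a + l).+1 * (C0 + C0))) => s.
  rewrite normrM (gtr0_norm (gamma_gt0 _))// ler_wpM2l ?(ltW (gamma_gt0 _))//.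
  by rewrite (le_trans (ler_normB _ _))// lerD.
rewrite (RintegralD measurableT iB iD) IH add0r.
have iE : nu.-integrable setT (EFin \o (fun s : seqspace cU =>
    frozen X alpha beta epsilon t s j l.+1 - fmean l.+1 t j)).
  apply: (bounded_integrable nu _ (M := C0 + C0)); first exact: measurable_funB.
  by move=> s; rewrite (le_trans (ler_normB _ _))// lerD.
rewrite (RintegralZl _ measurableT iE) (RintegralB measurableT (if_ _) (ic _)).
rewrite Rintegral_cst// [X in fine X](probability_setT nu) mulr1.
by rewrite /frozen_mean subrr mulr0.
Qed.

Variables (n l : nat).
Local Notation blk b := (n + b * l)%N.

Definition window_noise M s : R :=
  \sum_(b < M) block_noise (blk b) l (pos s (blk b)) (shift (blk b) s).

Lemma measurable_window_noise M : measurable_fun setT (window_noise M).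
Proof.
apply: measurable_sum => b; apply: measurable_block_noise => // k.
exact: measurable_coord.
Qed.

(** The noise of the first [M] blocks depends only on the samples before block
    [M]: the noise is adapted. *)
Lemma window_noise_merge M s s' :
  window_noise M (merge (blk M) (s, s')) = window_noise M s.
Proof.
apply: eq_bigr => b _.
have bM : (blk b + l <= blk M)%N.
  by rewrite -addnA leq_add2l addnC -mulSn leq_mul2r ltn_ord orbT.
rewrite pos_merge; last by rewrite (leq_trans _ bM)// leq_addr.
apply: block_noise_eq => k kl; rewrite /shift /merge /=.
by rewrite (leq_trans _ bM)// ltn_add2l.
Qed.

(** The window noise is a martingale with bounded increments, so its
    exponential moments are Gaussian. *)
Lemma window_noise_expR M (sg lam : R) : `|sg| <= 1 -> 0 <= lam ->
  lam * (2 * C0 * (l%:R * gamma n.+1)) <= 2^-1 ->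
  mean_le nu (fun s => expR (lam * (sg * window_noise M s)))
    (expR (\sum_(b < M) 2 * (lam * (2 * C0 * (l%:R * gamma (blk b).+1))) ^+ 2)).
Proof.
move=> sg1 lam0 hlam.
have c2 : 0 <= 2 * C0 by rewrite mulr_ge0.
have mexp N : measurable_fun setT (fun s => expR (lam * (sg * window_noise N s))).
  apply: measurable_expR_fun; apply: measurable_funM => //; apply: measurable_funM => //.
  exact: measurable_window_noise.
elim: M => [|M IH].
  rewrite big_ord0 expR0.
  rewrite (_ : (fun s => _) = fun=> 1); first exact: mean_le_cst.
  by apply/funext => s; rewrite /window_noise big_ord0 !mulr0 expR0.
rewrite big_ord_recr /= expRD mulrC.
set v := expR (2 * (lam * _) ^+ 2).
apply: (mean_le_merge nuP muT (a := blk M) (mexp M.+1)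
  (g := fun s => v * expR (lam * (sg * window_noise M s)))); last 2 first.
- by apply: measurable_funM => //; exact: mexp.
- by apply: mean_leZ => //; exact: expR_ge0.
move=> s; rewrite (_ : (fun s' => _) = (fun s' : seqspace cU =>
    expR (lam * (sg * window_noise M s)) *
    expR (lam * (sg * block_noise (blk M) l (pos s (blk M)) s')))); last first.
  apply/funext => s'; rewrite -expRD -!mulrDr; congr (expR (_ * (_ * _))).
  rewrite {1}/window_noise big_ord_recr /= -/(window_noise M _) window_noise_merge.
  by rewrite shift_merge pos_merge.
rewrite [v * _]mulrC; apply: mean_leZ; first exact: expR_ge0.
apply: mean_le_expR_centred => //.
- apply: measurable_funM => //.
  by apply: (@measurable_block_noise _ (seqspace cU) (blk M) l (fun=> pos s (blk M)) (fun s => s)).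
- move=> s'; rewrite normrM -[leRHS]mul1r ler_pM//.
  exact: block_noise_le.
- have mB : measurable_fun setT (fun s' : seqspace cU =>
      block_noise (blk M) l (pos s (blk M)) s').
    by apply: (@measurable_block_noise _ (seqspace cU) (blk M) l (fun=> pos s (blk M)) (fun s => s)).
  rewrite (RintegralZl _ measurableT (bounded_integrable nu mB (block_noise_le _ _ _))).
  by rewrite block_noise_centred mulr0.
- apply: le_trans hlam; rewrite ler_wpM2l// ler_wpM2l// ler_wpM2l//.
  by apply: gamma_decr => //; rewrite ltnS leq_addr.
Qed.

(** ** The drift of a window of blocks *)

Lemma sum_blocks (f : nat -> R) M :
  \sum_(n <= k < n + M * l) f k = \sum_(b < M) \sum_(i < l) f (blk b + i)%N.
Proof.
elim: M => [|M IH]; first by rewrite mul0n addn0 big_geq// big_ord0.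
rewrite big_ord_recr /= -IH mulSn addnCA [(l + _)%N]addnC.
rewrite (big_cat_nat (n := blk M)) ?leq_addr//=; congr (_ + _).
by rewrite -{1}[blk M]add0n big_addn addKn big_mkord; apply: eq_bigr => i _; rewrite addnC.
Qed.

Definition window_time M : R := \sum_(n <= k < n + M * l) gamma k.+1.
Definition block_starts M : R := \sum_(b < M) gamma (blk b).+1.

Lemma window_timeS M :
  window_time M.+1 = window_time M + \sum_(i < l) gamma (blk M + i).+1.
Proof. by rewrite /window_time !sum_blocks big_ord_recr. Qed.

Lemma window_time_ge0 M : 0 <= window_time M.
Proof. by apply: sumr_ge0 => k _; exact/ltW/gamma_gt0. Qed.

Lemma block_starts_ge0 M : 0 <= block_starts M.
Proof. by apply: sumr_ge0 => k _; exact/ltW/gamma_gt0. Qed.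

(** The steps decrease: each block start is at most every step of the preceding
    block, and the first one is counted separately. *)
Lemma block_starts_le M : l%:R * block_starts M <= l%:R * gamma n.+1 + window_time M.
Proof.
case: M => [|M].
  rewrite /block_starts big_ord0 mulr0 addr_ge0 ?window_time_ge0// mulr_ge0//.
  exact/ltW/gamma_gt0.
have -> : window_time M.+1 = window_time M + \sum_(i < l) gamma (blk M + i).+1.
  exact: window_timeS.
suff h : l%:R * block_starts M.+1 <= l%:R * gamma n.+1 + window_time M.
  rewrite (le_trans h)// addrA lerDl; apply: sumr_ge0 => i _; exact/ltW/gamma_gt0.
rewrite /block_starts; elim: M => [|M IH].
  by rewrite big_ord_recr big_ord0 /= add0r mul0n addn0 lerDl window_time_ge0.
rewrite big_ord_recr /= mulrDr window_timeS addrA lerD//.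
rewrite -[l in l%:R]card_ord mulr_natl -sumr_const; apply: ler_sum => i _.
apply: gamma_decr => //; rewrite ltnS mulSn addnCA [(l + _)%N]addnC leq_add2l.
exact: ltnW.
Qed.

Lemma pos_window_le s M r k : `|pos s n| <= r -> (k <= M * l)%N -> window_time M <= 2 ->
  `|pos s (n + k)| <= r + 2 * C0.
Proof.
move=> sr kM t2.
have h : `|pos s (n + k) - pos s n| <= C0 * \sum_(n <= i < n + k) gamma i.+1.
  exact: pos_dist_le.
have h2 : \sum_(n <= i < n + k) gamma i.+1 <= window_time M.
  rewrite /window_time [leRHS](big_cat_nat (n := (n + k)%N)) ?leq_addr ?leq_add2l//= lerDl.
  by apply: sumr_ge0 => i _; exact/ltW/gamma_gt0.
rewrite -(subrK (pos s n) (pos s (n + k))) (le_trans (ler_normD _ _))// addrC lerD//.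
by rewrite (le_trans h)// mulrC ler_wpM2r// (le_trans h2).
Qed.

(** Errors are counted only for windows that start in the ball of radius [r]:
    there the exponential weight of [memory_moment] is bounded below and the
    Lipschitz constants are uniform. *)
Definition memory_in r b s : R := if `|pos s n| <= r then memory s (blk b) else 0.
Definition freeze_in r b q s : R := if `|pos s n| <= r then freeze_err s (blk b) q else 0.

Lemma measurable_in r (f : seqspace cU -> R) : measurable_fun setT f ->
  measurable_fun setT (fun s => if `|pos s n| <= r then f s else 0).
Proof.
move=> mf; apply: measurable_fun_ifT => //; apply: measurable_fun_ler => //.
exact: measurable_rv_norm.
Qed.

Lemma measurable_freeze_err a q : measurable_fun setT (fun s => freeze_err s a q).
Proof.
apply: measurable_rv_norm; apply: measurable_to_rv => i.
rewrite (_ : (fun s => _) = (fun s : seqspace cU =>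
    grad s (a + q) 0 i - X (s (a + q)%N) (pos s a) 0 i)); last first.
  by apply/funext => s; rewrite !mxE.
apply: measurable_funB.
  exact: (measurableT_comp (measurable_rv_coord i) (mgrad (a + q))).
exact: measurable_X_coord.
Qed.

Lemma memory_in_ge0 r b s : 0 <= memory_in r b s.
Proof. by rewrite /memory_in; case: ifP => // _; exact: memory_ge0. Qed.

Lemma freeze_in_ge0 r b q s : 0 <= freeze_in r b q s.
Proof. by rewrite /freeze_in; case: ifP => // _; exact: normr_ge0. Qed.

Variable A : R.
Hypothesis memory_le : forall k,
  mean_le nu (fun s => memory s k `^ p * expR (- (kappa * `|pos s k|))) A.

Lemma mean_memory_in r M b : window_time M <= 2 -> (b <= M)%N ->
  mean_le nu (fun s => memory_in r b s `^ p) (expR (kappa * (r + 2 * C0)) * A).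
Proof.
move=> t2 bM.
apply: (mean_le_le (g := fun s => expR (kappa * (r + 2 * C0)) *
    (memory s (blk b) `^ p * expR (- (kappa * `|pos s (blk b)|))))).
- by apply: measurable_powR_fun; apply: measurable_in; exact: measurable_memory.
- by move=> s; exact: powR_ge0.
- move=> s; rewrite /memory_in; case: ifP => [sr|_]; last first.
    by rewrite powR0 ?mulr_ge0 ?expR_ge0 ?powR_ge0// gt_eqF// (lt_le_trans _ p_ge1).
  rewrite mulrCA -expRD ler_peMr ?powR_ge0// -{1}expR0 ler_expR -mulrBr mulr_ge0//.
  rewrite subr_ge0; apply: (pos_window_le sr _ t2); by rewrite leq_mul2r bM orbT.
- by apply: mean_leZ => //; exact: expR_ge0.
Qed.

Lemma mean_freeze_in r M b q : window_time M <= 2 -> (b < M)%N -> (q < l)%N ->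
  mean_le nu (fun s => freeze_in r b q s `^ p)
    (lip (r + 2 * C0) * (C0 * (l%:R * gamma n.+1)) `^ p).
Proof.
move=> t2 bM ql; set r1 := r + 2 * C0; set B := lip r1 * _.
have p0 : 0 <= p by rewrite (le_trans ler01).
have B0 : 0 <= B by rewrite mulr_ge0 ?powR_ge0.
have mfi : measurable_fun setT (fun s => freeze_in r b q s `^ p).
  by apply: measurable_powR_fun; apply: measurable_in; exact: measurable_freeze_err.
apply: (mean_le_merge nuP muT (a := (blk b + q)%N) (g := fun=> B) mfi) => [s||];
  [|exact: measurable_cst|exact: mean_le_cst].
have bqM : (b * l + q <= M * l)%N.
  rewrite (@leq_trans (b.+1 * l))//; first by rewrite mulSn addnC leq_add2r ltnW.
  by rewrite leq_mul2r bM orbT.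
have bM' : (b * l <= M * l)%N by rewrite (leq_trans _ bqM)// leq_addr.
rewrite (_ : (fun s' => _) = (fun s' : seqspace cU =>
    if `|pos s n| <= r then
      `|X (s' 0%N) (pos s (blk b + q)) - X (s' 0%N) (pos s (blk b))| `^ p else 0)).
  have [sr|_] := boolP (`|pos s n| <= r); last first.
    by apply: (mean_leW B0); exact: (mean_le_cst nu (lexx 0)).
  have h1 : `|pos s (blk b + q)| <= r1 by rewrite -addnA; exact: pos_window_le sr _ t2.
  have h2 : `|pos s (blk b)| <= r1 by exact: pos_window_le sr _ t2.
  apply: mean_leW (X_lip 0 h1 h2); rewrite ler_wpM2l//.
  apply: ge0_ler_powR => //; rewrite ?nnegrE//.
    by rewrite !mulr_ge0// ltW// gamma_gt0.
  apply: (le_trans (pos_dist_const s (blk b) q)); rewrite ler_wpM2l//.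
  apply: ler_pM => //; first exact/ltW/gamma_gt0.
    by rewrite ler_nat ltnW.
  by apply: gamma_decr => //; rewrite ltnS leq_addr.
apply/funext => s'; rewrite /freeze_in pos_merge; last first.
  by rewrite -addnA leq_addr.
case: ifP => _; last by rewrite powR0// gt_eqF// (lt_le_trans _ p_ge1).
have e1 : pos (merge (blk b + q) (s, s')) (blk b + q) = pos s (blk b + q).
  exact: pos_merge.
have e2 : pos (merge (blk b + q) (s, s')) (blk b) = pos s (blk b).
  by apply: pos_merge; exact: leq_addr.
by rewrite /freeze_err /adam_grad e1 e2 /merge ltnn subnn.
Qed.

Definition memory_sum r M s : R := \sum_(b < M) gamma (blk b).+1 * memory_in r b s.
Definition freeze_sum r M s : R :=
  \sum_(z : 'I_M * 'I_l) gamma (blk z.1).+1 * freeze_in r z.1 z.2 s.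

Let tail (f : seqspace cU -> R) B eta : (forall s, 0 <= f s) -> 0 < eta ->
  mean_le nu (fun s => f s `^ p) B ->
  (nu [set s | (eta <= f s)%R] <= (B / eta `^ p)%:E)%E.
Proof.
move=> f0 e0 fB; have p0 : 0 < p by rewrite (lt_le_trans ltr01).
apply: le_trans (mean_le_markov (powR_gt0 _ e0) fB).
rewrite (_ : [set s | _] = [set s | eta `^ p <= f s `^ p])//.
apply/seteqP; split => s /= h.
  by apply: ge0_ler_powR; rewrite ?nnegrE ?(ltW p0) ?(ltW e0).
rewrite leNgt; apply/negP => fe; move: h; rewrite leNgt => /negP; apply.
by apply: gt0_ltr_powR; rewrite ?nnegrE ?(ltW e0).
Qed.

Lemma memory_sum_tail r M eta : window_time M <= 2 -> 0 < eta ->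
  (nu [set s | (eta <= memory_sum r M s)%R] <=
    (block_starts M `^ p * (expR (kappa * (r + 2 * C0)) * A) / eta `^ p)%:E)%E.
Proof.
move=> t2 e0; apply: tail => // [s|].
  by apply: sumr_ge0 => b _; rewrite mulr_ge0 ?memory_in_ge0// ltW// gamma_gt0.
apply: mean_le_powR_sum => //.
- by move=> b; exact: gamma_gt0.
- by move=> b; apply: measurable_in; exact: measurable_memory.
- by move=> b s; exact: memory_in_ge0.
- by rewrite mulr_ge0 ?expR_ge0// (mean_le_ge0 (memory_le 0%N)).
- by move=> b; apply: mean_memory_in t2 _; exact: ltnW.
Qed.

Lemma freeze_sum_tail r M eta : window_time M <= 2 -> 0 < eta ->
  (nu [set s | (eta <= freeze_sum r M s)%R] <=
    ((l%:R * block_starts M) `^ p * (lip (r + 2 * C0) * (C0 * (l%:R * gamma n.+1)) `^ p)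
      / eta `^ p)%:E)%E.
Proof.
move=> t2 e0; apply: tail => // [s|].
  by apply: sumr_ge0 => b _; rewrite mulr_ge0 ?freeze_in_ge0// ltW// gamma_gt0.
apply: mean_le_powR_sum => //.
- by move=> b; exact: gamma_gt0.
- by move=> b; apply: measurable_in; exact: measurable_freeze_err.
- by move=> b s; exact: freeze_in_ge0.
- rewrite -(pair_bigA _ (fun (b : 'I_M) (_ : 'I_l) => gamma (blk b).+1)) /=.
  rewrite /block_starts mulr_sumr; apply: ler_sum => b _.
  by rewrite sumr_const card_ord mulr_natl.
- by rewrite mulr_ge0 ?powR_ge0.
- by move=> z; apply: mean_freeze_in t2 _ _.
Qed.

Hypothesis F_lip : forall r t t', `|t| <= r -> `|t'| <= r ->
  `|F t 0 j - F t' 0 j| <= flip r * `|t - t'|.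

(** The blocks are summed, and the field is moved from the block positions to
    the first position of the window; by the speed bound this costs the square
    of the duration. *)
Lemma window_le r M s : `|pos s n| <= r -> window_time M <= 2 ->
  `|pos s (n + M * l) 0 j - pos s n 0 j - window_time M * F (pos s n) 0 j| <=
  `|window_noise M s| +
  (memory_const * memory_sum r M s + freeze_const * freeze_sum r M s +
   block_const (r + 2 * C0) * block_starts M) +
  flip (r + 2 * C0) * C0 * window_time M ^+ 2.
Proof.
move=> sr t2; set r1 := r + 2 * C0.
have flip0 : 0 <= flip r1 by exact: field_lip_ge0.
have blkM (b : 'I_M) : (b * l <= M * l)%N by rewrite leq_mul2r ltnW ?orbT.
have bpos (b : 'I_M) : `|pos s (blk b)| <= r1 by exact: pos_window_le sr (blkM b) t2.
pose tau b : R := \sum_(i < l) gamma (blk b + i).+1.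
have tau0 b : 0 <= tau b by apply: sumr_ge0 => i _; exact/ltW/gamma_gt0.
have timeE : window_time M = \sum_(b < M) tau b by exact: sum_blocks.
have posE : pos s (n + M * l) 0 j - pos s n 0 j =
    \sum_(b < M) (pos s (blk b + l) 0 j - pos s (blk b) 0 j).
  have E N : \sum_(b < N) (pos s (blk b + l) 0 j - pos s (blk b) 0 j) =
      pos s (n + N * l) 0 j - pos s n 0 j.
    elim: N => [|N IH]; first by rewrite big_ord0 mul0n addn0 subrr.
    rewrite big_ord_recr /= IH mulSn addnCA [(l + _)%N]addnC.
    by rewrite addrC subrKA.
  by rewrite E.
have -> : pos s (n + M * l) 0 j - pos s n 0 j - window_time M * F (pos s n) 0 j =
    window_noise M s +
    (\sum_(b < M) (pos s (blk b + l) 0 j - pos s (blk b) 0 j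
       - block_noise (blk b) l (pos s (blk b)) (shift (blk b) s)
       - tau b * F (pos s (blk b)) 0 j) +
     \sum_(b < M) tau b * (F (pos s (blk b)) 0 j - F (pos s n) 0 j)).
  rewrite posE timeE mulr_suml /window_noise -!sumrB -!big_split /=.
  by apply: eq_bigr => b _; ring.
rewrite (le_trans (ler_normD _ _))// -addrA lerD// (le_trans (ler_normD _ _))// lerD//.
  apply: (le_trans (ler_norm_sum _ _ _)).
  apply: (@le_trans _ _ (\sum_(b < M) gamma (blk b).+1 *
    (memory_const * memory_in r b s +
     freeze_const * (\sum_(q < l) freeze_in r b q s) + block_const r1))).
    apply: ler_sum => b _; rewrite /memory_in /freeze_in sr.
    exact: block_le.
  rewrite le_eqVlt; apply/orP; left; apply/eqP.
  rewrite /memory_sum /freeze_sum /block_starts !mulr_sumr.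
  rewrite -(pair_bigA _ (fun (b : 'I_M) (q : 'I_l) =>
     freeze_const * (gamma (blk b).+1 * freeze_in r b q s))) /= -!big_split /=.
  apply: eq_bigr => b _; rewrite -!mulr_sumr; ring.
apply: (le_trans (ler_norm_sum _ _ _)).
apply: (@le_trans _ _ (\sum_(b < M) tau b * (flip r1 * (C0 * window_time M)))).
  apply: ler_sum => b _; rewrite normrM (ger0_norm (tau0 b)) ler_wpM2l//.
  have nr1 : `|pos s n| <= r1 by rewrite (le_trans sr)// lerDl mulr_ge0.
  apply: (le_trans (F_lip (bpos b) nr1)); rewrite ler_wpM2l//.
  have h : `|pos s (n + b * l) - pos s n| <= C0 * \sum_(n <= i < n + b * l) gamma i.+1.
    exact: pos_dist_le.
  apply: (le_trans h); rewrite ler_wpM2l//.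
  rewrite /window_time [leRHS](big_cat_nat (n := blk b)) ?leq_addr ?leq_add2l//= lerDl.
  by apply: sumr_ge0 => i _; exact/ltW/gamma_gt0.
rewrite -mulr_suml -timeE le_eqVlt; apply/orP; left; apply/eqP; ring.
Qed.

End Window.

(** * The grid of windows and the Borel-Cantelli argument *)

(** The interface between the random and the deterministic part. The Euler
    estimate is demanded only in a ball of radius [r], since the constant [C]
    depends on local Lipschitz bounds; the windows start at [0] and cover all
    times, so that every index lies in one of them. *)
Definition euler_windows (R : realType) (d : nat) (F : 'rV[R]_d -> 'rV[R]_d)
    (v r C h : R) (y : nat -> 'rV[R]_d) : Prop :=
  exists (G : nat -> nat) (tau : nat -> R) (K : nat),
    [/\ G 0%N = 0%N, forall k, (G k < G k.+1)%N &
      forall k, (K <= k)%N ->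
      [/\ h <= tau k <= 2 * h,
          forall n, (G k <= n <= G k.+1)%N -> `|y n - y (G k)| <= v * (2 * h) &
          `|y (G k)| <= r ->
          `|y (G k.+1) - y (G k) - tau k *: F (y (G k))| <= C * h ^+ 2]].

Section Grid.
Context {R : realType} {dU : measure_display} {cU : measurableType dU} {d : nat}.
Context (X : cU -> 'rV[R]_d -> 'rV[R]_d) (gamma : nat -> R).
Context (alpha beta epsilon p : R) (start : 'rV[R]_d).
Hypotheses (epsilon_gt0 : 0 < epsilon).
Hypotheses (alpha_ge0 : 0 <= alpha) (alpha_lt1 : alpha < 1).
Hypotheses (alpha2_lt_beta : alpha ^+ 2 < beta) (beta_lt1 : beta < 1).
Hypothesis p_ge1 : 1 <= p.
Hypothesis X_meas : product_measurable X.
Hypothesis gamma_gt0 : forall n, (1 <= n)%N -> 0 < gamma n.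
Hypothesis gamma_decr : forall m n, (1 <= m)%N -> (m <= n)%N -> gamma n <= gamma m.
Hypothesis gamma_cvg0 : gamma n @[n --> \oo] --> 0.
Hypothesis gamma_unbounded : forall B, exists m, B <= \sum_(0 <= k < m) gamma k.+1.
Hypothesis gamma_summable : exists B, forall m,
  \sum_(0 <= k < m) gamma k.+1 `^ (1 + p / 3) <= B.
Context (mu : set cU -> \bar R) (nu : probability (seqspace cU) R).
Hypotheses (nuP : iid_law mu nu) (muT : mu setT = 1%E).
Context (growth kappa : R) (lip : R -> R).
Hypothesis kappa_ge0 : 0 <= kappa.
Hypothesis lip_ge0 : forall r, 0 <= lip r.
Hypothesis X_growth : forall k (t : 'rV[R]_d),
  mean_le nu (fun s => `|X (s k) t| `^ p) (growth * expR (kappa * `|t|)).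
Hypothesis X_lip : forall k r (t t' : 'rV[R]_d), `|t| <= r -> `|t'| <= r ->
  mean_le nu (fun s => `|X (s k) t - X (s k) t'| `^ p) (lip r * `|t - t'| `^ p).
Variable F : 'rV[R]_d -> 'rV[R]_d.
Implicit Types s : seqspace cU.

Local Notation rho := (adam_rate beta).
Local Notation C0 := (adam_speed alpha beta).
Local Notation pos := (adam_pos X gamma alpha beta epsilon start).
Local Notation fmean := (frozen_mean X alpha beta epsilon nu).
Local Notation ferr := (field_err alpha beta epsilon growth kappa).
Local Notation flip := (field_lip alpha beta epsilon lip).

Hypothesis F_err : forall i t j, `|fmean i t j - F t 0 j| <= ferr `|t| * rho ^+ i.
Hypothesis F_lip : forall r t t' j, `|t| <= r -> `|t'| <= r ->
  `|F t 0 j - F t' 0 j| <= flip r * `|t - t'|.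

Let C00 : 0 <= C0 := adam_speed_ge0 alpha beta.
Local Notation g n := (gamma n.+1).
Let g0 n : 0 < g n. Proof. exact: gamma_gt0. Qed.

(** ** Choice of the windows *)

(** Blocks of about [gamma ^ (-1/2)] steps balance the three errors: the memory
    of the past is forgotten on a fraction [gamma ^ (1/2)] of the block, the
    path moves by [gamma ^ (1/2)] during the block, and the noise of a window
    has variance of order [gamma ^ (1/2)]. *)
Definition blen n : nat := `|Num.ceil (Num.sqrt (g n))^-1|%N.

Lemma sqrtg_gt0 n : 0 < Num.sqrt (g n).
Proof. by rewrite sqrtr_gt0. Qed.

Lemma sqrtg2 n : Num.sqrt (g n) ^+ 2 = g n.
Proof. by rewrite sqr_sqrtr// ltW. Qed.

Lemma blen_ge n : (Num.sqrt (g n))^-1 <= (blen n)%:R.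
Proof.
rewrite (le_trans (ceil_ge _))// /blen natr_absz ler_int ler_norm//.
Qed.

Lemma blen_gt0 n : (0 < blen n)%N.
Proof.
rewrite -(ltr_nat R) (lt_le_trans _ (blen_ge n))// invr_gt0.
exact: sqrtg_gt0.
Qed.

Lemma blen_le n : g n <= 1 -> (blen n)%:R * g n <= 2 * Num.sqrt (g n).
Proof.
move=> g1; have s0 := sqrtg_gt0 n.
have s1 : Num.sqrt (g n) <= 1 by rewrite -[leRHS]sqrtr1 ler_wsqrtr.
have h : (blen n)%:R <= (Num.sqrt (g n))^-1 + 1.
  rewrite /blen natr_absz ger0_norm ?ceil_ge0.
    by rewrite -lerBlDr ltW//; have := ceilB1_lt (Num.sqrt (g n))^-1; rewrite intrB.
  by rewrite (@lt_trans _ _ 0)// ?ltrN10// invr_gt0.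
rewrite (le_trans (ler_wpM2r (ltW (g0 n)) h))// -[in X in _ * X <= _](sqrtg2 n).
rewrite mulrDl mul1r expr2 mulrA mulVf ?gt_eqF// mul1r.
have : Num.sqrt (g n) * Num.sqrt (g n) <= Num.sqrt (g n) by rewrite ler_piMl// ltW.
by lra.
Qed.

Lemma gamma_unbounded_from n B : exists m, B <= \sum_(n <= k < n + m) g k.
Proof.
have [m hm] := gamma_unbounded (B + \sum_(0 <= k < n) g k).
exists m; have h : \sum_(0 <= k < m) g k <= \sum_(0 <= k < n + m) g k.
  rewrite [leRHS](big_cat_nat (n := m)) ?leq_addl//= lerDl.
  by apply: sumr_ge0 => i _; exact: ltW.
have := le_trans hm h; rewrite [X in _ <= X](big_cat_nat (n := n)) ?leq_addr//=.
by move=> h1; rewrite -(lerD2l (\sum_(0 <= k < n) g k)) [leLHS]addrC.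
Qed.

Variable h : R.
Hypotheses (h_gt0 : 0 < h) (h_le1 : h <= 1).

Lemma window_exists n : exists M, h <= window_time gamma n (blen n) M.
Proof.
have [m hm] := gamma_unbounded_from n h; exists m.
apply: (le_trans hm); rewrite /window_time.
rewrite [leRHS](big_cat_nat (n := (n + m)%N)) ?leq_addr//=.
  by rewrite lerDl; apply: sumr_ge0 => i _; exact: ltW.
by rewrite leq_add2l leq_pmulr// blen_gt0.
Qed.

Definition nblk n : nat := ex_minn (window_exists n).
Definition wtime n : R := window_time gamma n (blen n) (nblk n).
Definition wend n : nat := (n + nblk n * blen n)%N.

Lemma wtime_ge n : h <= wtime n.
Proof. by rewrite /wtime /nblk; case: ex_minnP. Qed.

Lemma nblk_gt0 n : (0 < nblk n)%N.
Proof.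
rewrite lt0n; apply/eqP => E; have := wtime_ge n.
by rewrite /wtime /window_time E mul0n addn0 big_geq// leNgt h_gt0.
Qed.

Lemma wtime_le n : wtime n <= h + (blen n)%:R * g n.
Proof.
rewrite /wtime /nblk; case: ex_minnP => -[|M] hM minM.
  rewrite /window_time mul0n addn0 big_geq// addr_ge0 ?(ltW h_gt0)// mulr_ge0//.
  exact: ltW.
have hM' : window_time gamma n (blen n) M < h.
  by rewrite ltNge; apply/negP => /minM; rewrite ltnn.
rewrite window_timeS lerD ?(ltW hM')//.
rewrite -[X in X%:R]card_ord mulr_natl -sumr_const; apply: ler_sum => i _.
by apply: gamma_decr => //; rewrite ltnS -addnA leq_addr.
Qed.

Lemma wend_gt n : (n < wend n)%N.
Proof. by rewrite -[X in (X < _)%N]addn0 ltn_add2l muln_gt0 nblk_gt0 blen_gt0. Qed.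

Fixpoint grid k : nat := if k is k'.+1 then wend (grid k') else 0%N.

Lemma grid_ge k : (k <= grid k)%N.
Proof. by elim: k => // k IH; rewrite (leq_ltn_trans IH)// wend_gt. Qed.

(** The steps decrease along the grid, so each grid term is dominated by the
    average over the preceding window. *)
Lemma grid_summable : exists B, forall m,
  \sum_(0 <= k < m) g (grid k) `^ (p / 3) <= B.
Proof.
have p3 : 0 <= p / 3 by rewrite divr_ge0// (le_trans ler01).
have [B hB] := gamma_summable.
exists (g 0%N `^ (p / 3) + B / h) => m.
case: m => [|m].
  rewrite big_geq// addr_ge0 ?powR_ge0// divr_ge0 ?(ltW h_gt0)//.
  by apply: le_trans (hB 0%N); rewrite big_geq.
rewrite big_nat_recl//= lerD2l ler_pdivlMr//.
apply: (@le_trans _ _ (\sum_(0 <= i < grid m) g i `^ (1 + p / 3))); last exact: hB.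
elim: m => [|m IH]; first by rewrite !big_geq// mul0r.
rewrite big_nat_recr//= mulrDl.
rewrite [leRHS](big_cat_nat (n := grid m))//=; last exact/ltnW/wend_gt.
rewrite lerD// (le_trans (ler_wpM2l _ (wtime_ge (grid m))))// ?powR_ge0//.
rewrite /wtime /window_time mulr_sumr ler_sum_nat// => i /andP[gi iw].
rewrite powRD; last by rewrite (gt_eqF (g0 i)) implybT.
rewrite powRr1 ?(ltW (g0 i))// mulrC ler_wpM2l ?(ltW (g0 i))//.
apply: ge0_ler_powR; rewrite ?nnegrE ?(ltW (g0 _))//.
by apply: gamma_decr => //; rewrite ltnS ltnW.
Qed.

(** Bad events whose probability at step [n] is [O(gamma ^ (p/3))] have finite
    total probability along the grid, so almost surely only finitely many of
    them occur there. *)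
Lemma grid_eventually (E : nat -> set (seqspace cU)) (C : R) N :
  (forall n, measurable (E n)) -> 0 <= C ->
  (forall n, (N <= n)%N -> (nu (E n) <= (C * g n `^ (p / 3))%:E)%E) ->
  {ae nu, forall s, exists K, forall k, (K <= k)%N -> ~ E (grid k) s}.
Proof.
move=> mE C0' hE.
have [B hB] := grid_summable.
have mG k : measurable (E (grid (N + k))) by [].
have sumE : (\sum_(k <oo) nu (E (grid (N + k))) < +oo)%E.
  apply: (@le_lt_trans _ _ (C * B)%:E); last exact: ltry.
  apply: lime_le; first by apply: is_cvg_nneseries => k _ _; exact: measure_ge0.
  apply: nearW => m.
  apply: (@le_trans _ _ (\sum_(0 <= k < m) (C * g (grid (N + k)) `^ (p / 3))%:E)%E).
    apply: lee_sum => k _; apply: hE.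
    by rewrite (leq_trans _ (grid_ge _))// leq_addr.
  rewrite sumEFin lee_fin -mulr_sumr ler_wpM2l//.
  apply: le_trans (hB (N + m)%N).
  rewrite [leRHS](big_cat_nat (n := N)) ?leq_addr//=.
  have -> : \sum_(N <= k < N + m) g (grid k) `^ (p / 3) =
      \sum_(0 <= k < m) g (grid (N + k)) `^ (p / 3).
    by rewrite -{1}[N]add0n big_addn addKn; apply: eq_bigr => k _; rewrite addnC.
  by rewrite lerDr; apply: sumr_ge0 => k _; exact: powR_ge0.
have := lim_sup_set_cvg0 mG sumE => h0.
exists (lim_sup_set (fun k => E (grid (N + k)))); split => //.
  apply: bigcapT_measurable => k; apply: bigcup_measurable => i _; exact: mG.
move=> s /= nE; rewrite /lim_sup_set => K _ /=.
apply: contrapT => H; apply: nE; exists (N + K)%N => k Kk Ek; apply: H.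
exists (k - N)%N => /=; first by rewrite leq_subRL// (leq_trans _ Kk)// leq_addr.
by rewrite subnKC// (leq_trans _ Kk)// leq_addr.
Qed.

(** ** Probability of a bad window *)

Lemma gamma_small e : 0 < e -> exists N, forall n, (N <= n)%N -> g n <= e.
Proof.
move=> e0; have /cvgrPdist_le/(_ _ e0)[N _ hN] := gamma_cvg0.
exists N => n Nn; have := hN n.+1 (leq_trans Nn (leqnSn n)).
by rewrite sub0r normrN gtr0_norm.
Qed.

Let good n := [/\ g n <= 1, Num.sqrt (g n) <= h / 2 & Num.sqrt (g n) <= 1].

Let good_eventually : exists N, forall n, (N <= n)%N -> good n.
Proof.
have e0 : 0 < Num.min 1 ((h / 2) ^+ 2) by rewrite lt_min ltr01 exprn_gt0// divr_gt0.
have [N hN] := gamma_small e0; exists N => n /hN; rewrite le_min => /andP[h1 h2].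
split => //; last by rewrite -[leRHS]sqrtr1 ler_wsqrtr.
have h0 : 0 <= h / 2 by rewrite divr_ge0// ltW.
by rewrite -(ger0_norm h0) -sqrtr_sqr ler_wsqrtr.
Qed.

Let lg_le n : good n -> (blen n)%:R * g n <= h.
Proof. by move=> [g1 gh _]; apply: (le_trans (blen_le g1)); lra. Qed.

Let wtime_le2h n : good n -> wtime n <= 2 * h.
Proof. by move=> gn; apply: (le_trans (wtime_le n)); have := lg_le gn; lra. Qed.

Let wtime_le2 n : good n -> wtime n <= 2.
Proof. by move=> /wtime_le2h; have := h_le1; lra. Qed.

Local Notation starts n := (block_starts gamma n (blen n) (nblk n)).

Let lstarts_le n : good n -> (blen n)%:R * starts n <= 3.
Proof.
move=> gn; apply: (le_trans (block_starts_le gamma_gt0 gamma_decr _ _ _)).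
by have := lg_le gn; have := wtime_le2h gn; have := h_le1; rewrite /wtime; lra.
Qed.

Let starts_ge0 n : 0 <= starts n. Proof. exact: block_starts_ge0. Qed.

Let starts_le n : good n -> starts n <= 3 * Num.sqrt (g n).
Proof.
move=> gn; have s0 := sqrtg_gt0 n.
have : (Num.sqrt (g n))^-1 * starts n <= 3.
  apply: le_trans (lstarts_le gn); rewrite ler_wpM2r//; exact: blen_ge.
by rewrite ler_pdivrMl// mulrC.
Qed.

Let sqrt_powR n : good n -> Num.sqrt (g n) `^ p <= g n `^ (p / 3).
Proof.
move=> [g1 _ _]; have gg : 0 < g n <= 1 by rewrite g0 g1.
rewrite -powR12_sqrt ?(ltW (g0 n))// -powRrM ger_powR//.
by have := p_ge1; lra.
Qed.

Local Notation msum r n := (memory_sum X gamma alpha beta epsilon start n (blen n) r (nblk n)).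
Local Notation fsum r n := (freeze_sum X gamma alpha beta epsilon start n (blen n) r (nblk n)).
Local Notation wnoise j n :=
  (window_noise X gamma alpha beta epsilon start nu j n (blen n) (nblk n)).

Let h2_gt0 : 0 < h ^+ 2. Proof. by rewrite exprn_gt0. Qed.

(** Markov's inequality for the [p]-th moment: the sum of the steps at the block
    starts is of order [gamma ^ (1/2)]. *)
Lemma memory_eventually r : {ae nu, forall s, exists K, forall k, (K <= k)%N ->
  msum r (grid k) s < h ^+ 2}.
Proof.
have [A hA] : exists A, forall n, mean_le nu (fun s =>
    memory X gamma alpha beta epsilon start s n `^ p * expR (- (kappa * `|pos s n|))) A.
  exact: (memory_moment start epsilon_gt0 alpha2_lt_beta beta_lt1 p_ge1 X_meas gamma_gt0
    gamma_cvg0 nuP muT kappa_ge0 X_growth).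
have [N hN] := good_eventually.
have A0 : 0 <= A := mean_le_ge0 (hA 0%N).
pose C := 3 `^ p * (expR (kappa * (r + 2 * C0)) * A) / (h ^+ 2) `^ p.
pose E n := [set s | h ^+ 2 <= msum r n s].
have : {ae nu, forall s, exists K, forall k, (K <= k)%N -> ~ E (grid k) s}.
  apply: (@grid_eventually E C N) => [n||n Nn].
  - apply: measurable_set_ler => //; apply: measurable_sum => b.
    apply: measurable_funM => //; apply: measurable_in => //.
    exact: measurable_memory.
  - by rewrite !mulr_ge0 ?invr_ge0 ?powR_ge0 ?expR_ge0.
  have gn := hN n Nn.
  apply: (le_trans (memory_sum_tail epsilon_gt0 alpha2_lt_beta beta_lt1 p_ge1 X_meas
    gamma_gt0 kappa_ge0 hA r (wtime_le2 gn) h2_gt0)).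
  have key : starts n `^ p <= 3 `^ p * g n `^ (p / 3).
    apply: (@le_trans _ _ ((3 * Num.sqrt (g n)) `^ p)).
      apply: ge0_ler_powR; rewrite ?nnegrE ?mulr_ge0 ?sqrtr_ge0 ?starts_le//.
      by rewrite (le_trans ler01).
    by rewrite powRM ?sqrtr_ge0// ler_wpM2l ?powR_ge0// sqrt_powR.
  rewrite lee_fin /C; set v := expR _ * A; set y := _ `^ (p / 3) in key *.
  have -> : 3 `^ p * v / (h ^+ 2) `^ p * y = 3 `^ p * y * v / (h ^+ 2) `^ p by ring.
  by rewrite ler_wpM2r ?invr_ge0 ?powR_ge0// ler_wpM2r// mulr_ge0 ?expR_ge0.
by apply: filterS => s [K hK]; exists K => k /hK /negP; rewrite -ltNge.
Qed.

(** Markov's inequality again: within a block the position moves by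
    [O(gamma ^ (1/2))]. *)
Lemma freeze_eventually r : {ae nu, forall s, exists K, forall k, (K <= k)%N ->
  fsum r (grid k) s < h ^+ 2}.
Proof.
have [N hN] := good_eventually; have p0 : 0 <= p by rewrite (le_trans ler01).
pose C := 3 `^ p * (lip (r + 2 * C0) * (C0 * 2) `^ p) / (h ^+ 2) `^ p.
pose E n := [set s | h ^+ 2 <= fsum r n s].
have : {ae nu, forall s, exists K, forall k, (K <= k)%N -> ~ E (grid k) s}.
  apply: (@grid_eventually E C N) => [n||n Nn].
  - apply: measurable_set_ler => //; apply: measurable_sum => z.
    apply: measurable_funM => //; apply: measurable_in => //.
    exact: measurable_freeze_err.
  - by rewrite !mulr_ge0 ?invr_ge0 ?powR_ge0.
  have gn := hN n Nn; have [gn1 _ _] := gn.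
  apply: (le_trans (freeze_sum_tail start epsilon_gt0 alpha2_lt_beta beta_lt1 p_ge1 X_meas
    gamma_gt0 gamma_decr nuP muT lip_ge0 X_lip r (wtime_le2 gn) h2_gt0)).
  have l0 : 0 <= (blen n)%:R * g n by rewrite mulr_ge0// ltW.
  have key1 : ((blen n)%:R * starts n) `^ p <= 3 `^ p.
    by apply: ge0_ler_powR; rewrite ?nnegrE ?mulr_ge0 ?lstarts_le.
  have key2 : (C0 * ((blen n)%:R * g n)) `^ p <= (C0 * 2) `^ p * g n `^ (p / 3).
    apply: (@le_trans _ _ ((C0 * 2 * Num.sqrt (g n)) `^ p)).
      apply: ge0_ler_powR; rewrite ?nnegrE ?mulr_ge0 ?sqrtr_ge0 ?(ltW (g0 n))//.
      by rewrite -mulrA ler_wpM2l// blen_le.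
    by rewrite powRM ?mulr_ge0 ?sqrtr_ge0// ler_wpM2l ?powR_ge0// sqrt_powR.
  rewrite lee_fin /C; set y := _ `^ (p / 3) in key2 *; set L := lip _; set w := (C0 * 2) `^ p in key2 *.
  have -> : 3 `^ p * (L * w) / (h ^+ 2) `^ p * y = 3 `^ p * (L * (w * y)) / (h ^+ 2) `^ p.
    by ring.
  rewrite ler_wpM2r ?invr_ge0 ?powR_ge0//; apply: ler_pM; rewrite ?powR_ge0//.
    by apply: mulr_ge0; [exact: lip_ge0|exact: powR_ge0].
  exact: ler_wpM2l (lip_ge0 _) _ _ key2.
by apply: filterS => s [K hK]; exists K => k /hK /negP; rewrite -ltNge.
Qed.

(** Chernoff's bound with parameter [lam] of order [gamma ^ (-1/2)], up to a
    constant the largest that [window_noise_expR] admits: the probability is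
    exponentially small in [gamma ^ (-1/2)]. *)
Lemma noise_eventually j (sg : R) : `|sg| <= 1 ->
  {ae nu, forall s, exists K, forall k, (K <= k)%N ->
    sg * wnoise j (grid k) s < h ^+ 2}.
Proof.
move=> sg1; have [N hN] := good_eventually.
have C1 : 0 < C0 + 1 by rewrite ltr_wpDl.
pose eta := h ^+ 2.
have eta1 : eta <= 1 by rewrite /eta exprn_ile1// ltW.
pose c := eta / (128 * (C0 + 1) ^+ 2).
have c0 : 0 < c by rewrite divr_gt0// mulr_gt0// exprn_gt0.
have cE : c * (128 * (C0 + 1) ^+ 2) = eta.
  by rewrite divfK// gt_eqF// mulr_gt0// exprn_gt0.
have q0 : 0 < 2 * p / 3 by have := p_ge1; lra.
have e0 : 0 < c * eta / 2 by rewrite divr_gt0// mulr_gt0.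
have [C C_gt0 hC] := expRN_le_powR q0 e0.
pose E n := [set s | eta <= sg * wnoise j n s].
have mw n : measurable_fun setT (fun s => sg * wnoise j n s).
  apply: measurable_funM => //.
  exact: (measurable_window_noise gamma start epsilon_gt0 alpha_ge0 alpha_lt1
    alpha2_lt_beta beta_lt1 p_ge1 X_meas lip_ge0 X_lip).
have : {ae nu, forall s, exists K, forall k, (K <= k)%N -> ~ E (grid k) s}.
  apply: (@grid_eventually E C N) => [n||n Nn]; [exact: measurable_set_ler|exact: ltW|].
  have gn := hN n Nn; have [gn1 _ gs1] := gn; have s0 := sqrtg_gt0 n.
  set sq := Num.sqrt (g n) in s0 gs1 *.
  pose lam := c / sq.
  have lam0 : 0 < lam by rewrite divr_gt0.
  have lg0 m : 0 <= (blen n)%:R * g m by rewrite mulr_ge0// ltW.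
  have C2 : 0 <= 2 * C0 by rewrite mulr_ge0.
  have lsq : (blen n)%:R * g n <= 2 * sq by exact: blen_le.
  have hlam : lam * (2 * C0 * ((blen n)%:R * g n)) <= 2^-1.
    apply: (@le_trans _ _ (lam * (2 * C0 * (2 * sq)))).
      by rewrite ler_wpM2l ?(ltW lam0)// ler_wpM2l.
    have -> : lam * (2 * C0 * (2 * sq)) = 4 * (c * C0).
      by rewrite /lam; field; rewrite gt_eqF.
    have : c * (C0 + 1) ^+ 2 <= 128^-1 by rewrite -[leRHS]mul1r ler_pdivlMr// -mulrA [_ * 128]mulrC cE.
    have : c * C0 <= c * (C0 + 1) ^+ 2.
      by rewrite ler_wpM2l ?(ltW c0)//; have := C00; nra.
    by lra.
  have noise := window_noise_expR start epsilon_gt0 alpha_ge0 alpha_lt1 alpha2_lt_beta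
    beta_lt1 p_ge1 X_meas gamma_gt0 gamma_decr nuP muT lip_ge0 X_lip j (nblk n)
    sg1 (ltW lam0) hlam.
  have -> : E n = [set s | expR (lam * eta) <= expR (lam * (sg * wnoise j n s))].
    by apply/seteqP; split => s /=; rewrite ler_expR ler_pM2l.
  apply: (le_trans (mean_le_markov (expR_gt0 _) noise)).
  rewrite lee_fin -expRN -expRD.
  have -> : g n `^ (p / 3) = sq^-1 `^ (- (2 * p / 3)).
    rewrite /sq -powR12_sqrt ?(ltW (g0 n))// -powRN -powRrM; congr (_ `^ _).
    by field.
  have sV0 : 0 < sq^-1 by rewrite invr_gt0.
  apply: (le_trans _ (hC _ sV0)).
  rewrite ler_expR.
  pose S2 := \sum_(b < nblk n) 2 * (lam * (2 * C0 * ((blen n)%:R * g (n + b * blen n)))) ^+ 2.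
  rewrite -/S2.
  suff hS : S2 <= c * eta / 2 * sq^-1.
    have E2 : lam * eta = 2 * (c * eta / 2 * sq^-1) by rewrite /lam; field; rewrite gt_eqF.
    by move: hS; rewrite E2; set Y := c * eta / 2 * sq^-1; lra.
  have K0 : 0 <= 2 * lam ^+ 2 * (2 * C0) ^+ 2.
    by apply: mulr_ge0; [apply: mulr_ge0 => //; exact: sqr_ge0|exact: sqr_ge0].
  apply: (@le_trans _ _ (\sum_(b < nblk n) (2 * lam ^+ 2 * (2 * C0) ^+ 2 * (2 * sq) *
      ((blen n)%:R * g (n + b * blen n))))).
    apply: ler_sum => b _; set z := (blen n)%:R * _.
    have z0 : 0 <= z by exact: lg0.
    have zs : z <= 2 * sq.
      apply: le_trans lsq; rewrite ler_wpM2l//.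
      by apply: gamma_decr => //; rewrite ltnS leq_addr.
    have -> : 2 * (lam * (2 * C0 * z)) ^+ 2 = 2 * lam ^+ 2 * (2 * C0) ^+ 2 * z * z by ring.
    by rewrite ler_wpM2r// ler_wpM2l.
  rewrite -mulr_sumr -mulr_sumr.
  apply: (@le_trans _ _ (2 * lam ^+ 2 * (2 * C0) ^+ 2 * (2 * sq) * 3)).
    apply: ler_wpM2l; last exact: lstarts_le.
    by apply: mulr_ge0 => //; apply: mulr_ge0 => //; exact: ltW.
  have -> : 2 * lam ^+ 2 * (2 * C0) ^+ 2 * (2 * sq) * 3 = 48 * c ^+ 2 * C0 ^+ 2 * sq^-1.
    by rewrite /lam; field; rewrite gt_eqF.
  rewrite ler_wpM2r ?invr_ge0 ?(ltW s0)// -cE.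
  have h1 : c ^+ 2 * C0 ^+ 2 <= c ^+ 2 * (C0 + 1) ^+ 2.
    by rewrite ler_wpM2l ?sqr_ge0// lerXn2r ?nnegrE ?(ltW C1)// lerDl.
  by move: h1; rewrite !expr2; nra.
by apply: filterS => s [K hK]; exists K => k /hK /negP; rewrite -ltNge.
Qed.

Definition window_const r : R := 2 + memory_const alpha beta epsilon +
  freeze_const alpha beta epsilon + 4 * (flip (r + 2 * C0) * C0).

(** Over one window the algorithm follows one Euler step of the vector field,
    up to an error that is quadratic in the window length. *)
Lemma euler_eventually r : {ae nu, forall s, exists K, forall k, (K <= k)%N ->
  `|pos s (grid k)| <= r ->
  `|pos s (grid k.+1) - pos s (grid k) - wtime (grid k) *: F (pos s (grid k))| <=
  window_const r * h ^+ 2}.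
Proof.
have nz j : {ae nu, forall s, exists K, forall k, (K <= k)%N ->
    `|wnoise j (grid k) s| < h ^+ 2}.
  have h1 : `|1 : R| <= 1 by rewrite normr1.
  have h2 : `|-1 : R| <= 1 by rewrite normrN1.
  apply: filterS2 (noise_eventually j h1) (noise_eventually j h2) => s [K1 k1] [K2 k2].
  exists (maxn K1 K2) => k; rewrite geq_max => /andP[/k1 e1 /k2 e2].
  by rewrite ltr_norml; apply/andP; split; lra.
have {}nz : {ae nu, forall s, forall j, exists K, forall k, (K <= k)%N ->
    `|wnoise j (grid k) s| < h ^+ 2} by exact: filter_forall.
pose r1 := r + 2 * C0.
pose B := Num.max 0 (block_const alpha beta epsilon growth kappa r1).
have B0 : 0 <= B by rewrite le_max lexx.
have [N hN] := good_eventually.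
have [N' hN'] : exists N', forall n, (N' <= n)%N -> Num.sqrt (g n) <= h ^+ 2 / (3 * (B + 1)).
  have e0 : 0 < h ^+ 2 / (3 * (B + 1)) by rewrite divr_gt0// mulr_gt0// ltr_wpDl.
  have [N' hN'] := gamma_small (exprn_gt0 2 e0); exists N' => n /hN' hg.
  by rewrite -(ger0_norm (ltW e0)) -sqrtr_sqr ler_wsqrtr.
apply: filterS3 (memory_eventually r) (freeze_eventually r) nz.
move=> s [K1 k1] [K2 k2] /choice[Kj kj].
exists (maxn (maxn K1 K2) (maxn (maxn N N') (\max_j Kj j))) => k.
rewrite !geq_max => /andP[/andP[kK1 kK2] /andP[/andP[kN kN'] kJ]] sr.
have gn : good (grid k) by apply: hN; exact: leq_trans kN (grid_ge k).
have c0 : 0 <= h ^+ 2 by rewrite ltW.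
have mc0 : 0 <= memory_const alpha beta epsilon.
  apply: divr_ge0; first exact: sqr_ge0.
  by apply: mulr_ge0; [exact: ltW|rewrite subr_ge0 ltW// adam_rate_lt1].
have fc0 : 0 <= freeze_const alpha beta epsilon.
  apply: divr_ge0; first by apply: mulr_ge0 => //; exact: addr_ge0.
  by apply: mulr_ge0; [exact: ltW|rewrite subr_ge0 ltW// adam_rate_lt1].
have fl0 : 0 <= flip r1 by exact: field_lip_ge0.
have wc0 : 0 <= window_const r.
  have flC : 0 <= 4 * (flip r1 * C0) by apply: mulr_ge0 => //; exact: mulr_ge0.
  by apply: addr_ge0 => //; apply: addr_ge0 => //; exact: addr_ge0.
apply: rv_norm_le => [|j]; first exact: mulr_ge0.
rewrite !mxE.
have := window_le epsilon_gt0 alpha_ge0 alpha_lt1 alpha2_lt_beta beta_lt1 X_meas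
  gamma_gt0 gamma_decr nuP muT kappa_ge0 lip_ge0 X_growth
  (fun i t => F_err i t j) (fun r t t' => F_lip j) sr (wtime_le2 gn).
move=> /le_trans; apply.
have nk : (Kj j <= k)%N by rewrite (leq_trans _ kJ)// leq_bigmax.
have e1 : `|wnoise j (grid k) s| <= h ^+ 2 by rewrite ltW// kj.
have e2 : memory_const alpha beta epsilon * msum r (grid k) s <=
    memory_const alpha beta epsilon * h ^+ 2 by rewrite ler_wpM2l// ltW// k1.
have e3 : freeze_const alpha beta epsilon * fsum r (grid k) s <=
    freeze_const alpha beta epsilon * h ^+ 2 by rewrite ler_wpM2l// ltW// k2.
have e4 : block_const alpha beta epsilon growth kappa r1 * starts (grid k) <= h ^+ 2.
  apply: (@le_trans _ _ (B * starts (grid k))).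
    by rewrite ler_wpM2r// le_max lexx orbT.
  apply: (@le_trans _ _ (B * (3 * Num.sqrt (g (grid k))))).
    by rewrite ler_wpM2l// starts_le.
  have hg := hN' (grid k) (leq_trans kN' (grid_ge k)).
  rewrite ler_pdivlMr in hg; last by rewrite mulr_gt0// ltr_wpDl.
  apply: le_trans hg; have := ltW (sqrtg_gt0 (grid k)).
  by set x := Num.sqrt _; lra.
have e5 : flip r1 * C0 * wtime (grid k) ^+ 2 <= 4 * (flip r1 * C0) * h ^+ 2.
  have -> : 4 * (flip r1 * C0) * h ^+ 2 = flip r1 * C0 * (4 * h ^+ 2) by ring.
  apply: ler_wpM2l; first exact: mulr_ge0.
  have := wtime_le2h gn; have := wtime_ge (grid k); have := h_gt0.
  by rewrite !expr2; nra.
have -> : window_const r * h ^+ 2 =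
    h ^+ 2 + (memory_const alpha beta epsilon * h ^+ 2 +
      freeze_const alpha beta epsilon * h ^+ 2 + h ^+ 2) +
    4 * (flip r1 * C0) * h ^+ 2 by rewrite /window_const -/r1; ring.
apply: lerD; last exact: e5.
by apply: lerD; [exact: e1|apply: lerD; [exact: lerD|exact: e4]].
Qed.

Lemma euler_windows_ae r :
  {ae nu, forall s, euler_windows F C0 r (window_const r) h (pos s)}.
Proof.
have [N hN] := good_eventually.
apply: filterS (euler_eventually r) => s [K hK].
exists grid, (wtime \o grid), (maxn N K); split => [//|k|k].
  exact: wend_gt.
rewrite geq_max => /andP[Nk Kk].
have gn : good (grid k) by apply: hN; exact: leq_trans Nk (grid_ge k).
split; [by rewrite wtime_ge wtime_le2h| |exact: hK].
move=> n /andP[n1 n2]; rewrite -(subnKC n1).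
apply: (le_trans (pos_dist_le X start epsilon_gt0 alpha2_lt_beta beta_lt1 gamma_gt0 _ _ _)).
rewrite ler_wpM2l//; apply: le_trans (wtime_le2h gn).
rewrite /wtime /window_time subnKC// [leRHS](big_cat_nat (n := n))//=.
by rewrite lerDl; apply: sumr_ge0 => i _; exact: ltW.
Qed.

End Grid.

(** * Laws of i.i.d. samples *)

Section IidPaths.
Context {R : realType} {dU : measure_display} {cU : measurableType dU}.
Context {dO : measure_display} {O : measurableType dO} (P : probability O R).
Context (U : {RV P >-> cU}).
Context {dV : measure_display} {OV : measurableType dV} (Q : probability OV R).
Context (V : nat -> {RV Q >-> cU}).

Definition sample_path (w : OV) : seqspace cU := fun k => V k w.

Lemma measurable_sample_path : measurable_fun setT sample_path.
Proof. by apply: measurable_to_seqspace => i; exact: measurable_funPT. Qed.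

HB.instance Definition _ :=
  isMeasurableFun.Build _ _ _ _ sample_path measurable_sample_path.

Definition path_law : probability (seqspace cU) R := distribution Q sample_path.

Hypothesis V_iid : iid_copies U V.

Lemma iid_path_law : iid_law (distribution P U) path_law.
Proof.
move=> n A mA An; have [ind same] := V_iid.
transitivity (Q (\bigcap_(i in [set` iota 0 n]) (V i @^-1` A i))).
  rewrite /path_law /distribution /pushforward; congr (Q _).
  apply/seteqP; split => w Aw i; first by move=> _; exact: Aw.
  case: (ltnP i n) => [ni|/An ->//].
  by apply: Aw; rewrite /= mem_iota add0n leq0n.
rewrite ind ?iota_uniq// -{1}[n]subn0 -/(index_iota 0 n) big_mkord.
by apply: eq_bigr => i _; exact: same.
Qed.

Lemma mean_le_copy (g : cU -> R) c k : measurable_fun setT g -> (forall u, 0 <= g u) ->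
  (\int[P]_w (g (U w))%:E <= c%:E)%E -> mean_le Q (fun w => g (V k w)) c.
Proof.
move=> mg g0 gc; split => //; first exact: measurableT_comp.
have mEg : measurable_fun setT (EFin \o g) by exact/measurable_EFinP.
have Eg0 u : (0 <= (EFin \o g) u)%E by rewrite lee_fin.
apply: le_trans gc.
have <- := ge0_integral_distribution (V k) mEg Eg0.
have <- := ge0_integral_distribution U mEg Eg0.
rewrite le_eqVlt; apply/orP; left; apply/eqP.
by apply: eq_measure_integral => A mA _; exact: V_iid.2.
Qed.

Lemma mean_le_coord (g : cU -> R) c k : measurable_fun setT g -> (forall u, 0 <= g u) ->
  (\int[P]_w (g (U w))%:E <= c%:E)%E -> mean_le path_law (fun s => g (s k)) c.
Proof.
move=> mg g0 gc; have [_ _ h] := mean_le_copy k mg g0 gc.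
have mgk : measurable_fun setT (fun s : seqspace cU => g (s k)).
  exact: (measurableT_comp mg (measurable_coord k)).
split => //; rewrite /path_law ge0_integral_distribution//.
- exact/measurable_EFinP.
- by move=> s; rewrite lee_fin.
Qed.

Lemma Rintegral_path_law (g : seqspace cU -> R) (b : R) :
  measurable_fun setT g -> (forall s, `|g s| <= b) ->
  \int[path_law]_s g s = \int[Q]_w g (sample_path w).
Proof.
move=> mg gb; rewrite /Rintegral; congr fine.
have mEg : measurable_fun setT (EFin \o g) by exact/measurable_EFinP.
apply: (integral_distribution (X := sample_path) mEg).
apply: (@bounded_integrable _ _ _ Q (g \o sample_path) b) => [|w]; last exact: gb.
exact: measurableT_comp mg measurable_sample_path.
Qed.

(** All i.i.d. sequences with the same marginals have the same law, so an almost
    sure property of one sample path holds for all others. *)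
Lemma ae_sample_path (nu : probability (seqspace cU) R) (A : seqspace cU -> Prop) :
  iid_law (distribution P U) nu ->
  {ae nu, forall s, A s} -> {ae Q, forall w, A (sample_path w)}.
Proof.
move=> nuP [N [mN N0 AN]]; exists (sample_path @^-1` N); split.
- by rewrite -[X in measurable X]setTI; exact: measurable_sample_path.
- rewrite -[LHS]/(path_law N) -N0; exact: (iid_law_unique iid_path_law nuP).
- by move=> w /= nA; exact: AN.
Qed.

End IidPaths.

(** * Moment bounds of a locally regular innovation *)

Section Regularity.
Context {R : realType} {dU : measure_display} {cU : measurableType dU} {d : nat}.
Context (X : cU -> 'rV[R]_d -> 'rV[R]_d) (p : R).
Context {dO : measure_display} {O : measurableType dO} (P : probability O R).
Context (U : {RV P >-> cU}).
Hypothesis p_ge0 : 0 <= p.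
Hypothesis X_meas : product_measurable X.
Hypothesis X_reg : locally_regular X p U.

Lemma measurable_innovation (t : 'rV[R]_d) :
  measurable_fun setT ((fun u => X u t) : cU -> borelRV R d).
Proof.
apply: (@measurable_X _ _ _ _ _ X_meas _ _ (fun u : cU => u) (fun=> t)) => //.
Qed.

Lemma measurable_innovationB (t t' : 'rV[R]_d) :
  measurable_fun setT ((fun u => X u t - X u t') : cU -> borelRV R d).
Proof.
apply: measurable_to_rv => j.
rewrite (_ : (fun u => _) = (fun u => X u t 0 j - X u t' 0 j)).
  apply: measurable_funB.
    exact: (measurableT_comp (measurable_rv_coord j) (measurable_innovation t)).
  exact: (measurableT_comp (measurable_rv_coord j) (measurable_innovation t')).
by apply/funext => u; rewrite !mxE.
Qed.

Lemma integral_norm_le_enorm (f : cU -> 'rV[R]_d) :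
  measurable_fun setT (f : cU -> borelRV R d) ->
  (\int[P]_w (`|f (U w)| `^ p)%:E <= 'E_P[fun w => (enorm (f (U w)) `^ p)%R])%E.
Proof.
move=> mf; rewrite unlock.
have mU : measurable_fun setT U by exact: measurable_funPT.
have mfU : measurable_fun setT (fun w => f (U w) : borelRV R d).
  exact: measurableT_comp mf mU.
apply: ge0_le_integral => //.
- apply/measurable_EFinP; apply: measurable_powR_fun; exact: measurable_rv_norm.
- apply/measurable_EFinP; apply: measurable_powR_fun.
  apply: (measurableT_comp (continuous_measurable_fun (@sqrt_continuous R))).
  apply: measurable_sum => j; apply: measurable_funX.
  exact: (measurableT_comp (measurable_rv_coord j) mfU).
- move=> w _; rewrite lee_fin ge0_ler_powR ?nnegrE ?sqrtr_ge0//.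
  exact: norm_le_enorm.
Qed.

Lemma continuous_bound (c : R -> R) : continuous c ->
  exists L : R -> R, forall r, 0 <= L r /\ forall x, 0 <= x -> x <= r -> c x <= L r.
Proof.
move=> cc; suff /choice[L hL] : forall r, exists l, 0 <= l /\
    forall x, 0 <= x -> x <= r -> c x <= l by exists L.
move=> r; have [r0|r0] := leP 0 r; last first.
  exists 0; split => // x x0 /(le_trans x0); by rewrite leNgt r0.
have [m _ hm] := EVT_max r0 (continuous_subspaceT cc).
exists (Num.max 0 (c m)); split; first by rewrite le_max lexx.
move=> x x0 xr; rewrite le_max hm ?orbT//.
by rewrite in_itv /= x0 xr.
Qed.

(** Between the maximum and the Euclidean norm there is a factor [d], which is
    absorbed by the constants; the local Lipschitz constant is a maximum of the
    continuous function [c] over an interval. *)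
Lemma regular_bounds : exists growth kappa (lip : R -> R),
  [/\ 0 <= kappa, forall r, 0 <= lip r,
    forall t, (\int[P]_w (`|X (U w) t| `^ p)%:E <= (growth * expR (kappa * `|t|))%:E)%E &
    forall r t t', `|t| <= r -> `|t'| <= r ->
      (\int[P]_w (`|X (U w) t - X (U w) t'| `^ p)%:E <= (lip r * `|t - t'| `^ p)%:E)%E].
Proof.
have [c [cc hc]] := X_reg; have [L hL] := continuous_bound cc.
pose c0 := Num.max 0 (c 0); have c00 : 0 <= c0 by rewrite le_max lexx.
have cc0 : c 0 <= c0 by rewrite le_max lexx orbT.
have d0 : 0 <= d%:R :> R by exact: ler0n.
have en0 (x : 'rV[R]_d) : 0 <= enorm x by exact: sqrtr_ge0.
exists (2 * c0), (c0 * d%:R), (fun r => L (2 * (d%:R * r)) * d%:R `^ p); split.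
- exact: mulr_ge0.
- by move=> r; rewrite mulr_ge0 ?powR_ge0//; have [] := hL (2 * (d%:R * r)).
- move=> t; apply: (le_trans (integral_norm_le_enorm (measurable_innovation t))).
  have [+ _] := hc t t => /le_trans; apply; rewrite lee_fin.
  have e1 : 1 <= expR (c0 * d%:R * `|t|) by rewrite -expR0 ler_expR !mulr_ge0.
  have e2 : expR (c 0 * enorm t) <= expR (c0 * d%:R * `|t|).
    rewrite ler_expR -mulrA (le_trans (ler_wpM2r (en0 t) cc0))// ler_wpM2l//.
    exact: enorm_le_norm.
  have e3 : 0 <= 1 + expR (c 0 * enorm t) by rewrite addr_ge0// expR_ge0.
  apply: (le_trans (ler_wpM2r e3 cc0)).
  by rewrite mulrAC [leRHS]mulrC ler_wpM2l//; lra.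
- move=> r t t' tr tr'.
  apply: (le_trans (integral_norm_le_enorm (measurable_innovationB t t'))).
  have [_] := hc t t' => /le_trans; apply; rewrite lee_fin.
  have [L0 hL'] := hL (2 * (d%:R * r)).
  have en (x : 'rV[R]_d) : `|x| <= r -> enorm x <= d%:R * r.
    by move=> xr; apply: (le_trans (enorm_le_norm x)); rewrite ler_wpM2l.
  have cL : c (enorm t + enorm t') <= L (2 * (d%:R * r)).
    by apply: hL'; [exact: addr_ge0|have := en t tr; have := en t' tr'; lra].
  apply: (le_trans (ler_wpM2r (powR_ge0 _ _) cL)); rewrite -mulrA ler_wpM2l//.
  rewrite -powRM// ge0_ler_powR ?nnegrE ?mulr_ge0//.
  exact: enorm_le_norm.
Qed.

End Regularity.

(** * The Adam vector field *)

Section AdamField.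
Context {R : realType} {dU : measure_display} {cU : measurableType dU} {d : nat}.
Context (X : cU -> 'rV[R]_d -> 'rV[R]_d) (alpha beta epsilon p : R).
Hypotheses (epsilon_gt0 : 0 < epsilon).
Hypotheses (alpha_ge0 : 0 <= alpha) (alpha_lt1 : alpha < 1).
Hypotheses (alpha2_lt_beta : alpha ^+ 2 < beta) (beta_lt1 : beta < 1).
Hypothesis p_ge1 : 1 <= p.
Hypothesis X_meas : product_measurable X.
Context {dO : measure_display} {O : measurableType dO} (P : probability O R).
Context (U : {RV P >-> cU}).
Context {dV : measure_display} {OV : measurableType dV} (PV : probability OV R).
Context (V : nat -> {RV PV >-> cU}).
Hypothesis V_iid : iid_copies U V.

Local Notation rho := (adam_rate beta).
Local Notation C0 := (adam_speed alpha beta).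
Local Notation F := (adam_field X alpha beta epsilon V).
Local Notation nu := (path_law V).
Local Notation fmean := (frozen_mean X alpha beta epsilon nu).

Context (growth kappa : R) (lip : R -> R).
Hypothesis lip_ge0 : forall r, 0 <= lip r.
Hypothesis growthP : forall t,
  (\int[P]_w (`|X (U w) t| `^ p)%:E <= (growth * expR (kappa * `|t|))%:E)%E.
Hypothesis lipP : forall r t t', `|t| <= r -> `|t'| <= r ->
  (\int[P]_w (`|X (U w) t - X (U w) t'| `^ p)%:E <= (lip r * `|t - t'| `^ p)%:E)%E.

Lemma distribution_setT : distribution P U setT = 1%E.
Proof. exact: probability_setT. Qed.

Lemma measurable_norm_innovation t : measurable_fun setT (fun u => `|X u t| `^ p).
Proof.
apply: measurable_powR_fun; apply: measurable_rv_norm; exact: measurable_innovation.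
Qed.

Lemma path_growth k t :
  mean_le nu (fun s => `|X (s k) t| `^ p) (growth * expR (kappa * `|t|)).
Proof.
apply: (mean_le_coord V_iid k (measurable_norm_innovation t)) => [u|]; last exact: growthP.
exact: powR_ge0.
Qed.

Lemma path_lip k r t t' : `|t| <= r -> `|t'| <= r ->
  mean_le nu (fun s => `|X (s k) t - X (s k) t'| `^ p) (lip r * `|t - t'| `^ p).
Proof.
move=> tr tr'; apply: (mean_le_coord V_iid k (g := fun u => `|X u t - X u t'| `^ p)).
- apply: measurable_powR_fun; apply: measurable_rv_norm; exact: measurable_innovationB.
- by move=> u; exact: powR_ge0.
- exact: lipP.
Qed.

Lemma frozen_mean_cvg t j : fmean i t j @[i --> \oo] --> F t 0 j.
Proof.
have h k : mean_le PV (fun w => `|X (V k w) t|) (1 + growth * expR (kappa * `|t|)).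
  apply: (@mean_le_le _ _ _ PV _ (fun w => 1 + `|X (V k w) t| `^ p)).
  - apply: measurable_rv_norm.
    exact: measurableT_comp (measurable_innovation X_meas t) _.
  - by [].
  - by move=> w; exact: le_1DpowR.
  - apply: mean_leD; first exact: mean_le_cst.
    apply: (mean_le_copy V_iid k (measurable_norm_innovation t)) => [u|]; last exact: growthP.
    exact: powR_ge0.
have := frozen_ser_cvg epsilon_gt0 alpha_ge0 alpha_lt1 alpha2_lt_beta beta_lt1 X_meas
  (j := j) h.
apply: cvg_trans; apply: near_eq_cvg; apply: nearW => i /=.
rewrite (frozen_mean_ser epsilon_gt0 alpha2_lt_beta beta_lt1 X_meas
  (iid_path_law V_iid) distribution_setT).
apply/esym; apply: (@Rintegral_path_law _ _ _ _ _ PV V _ C0).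
- exact: measurable_frozen_ser.
- by move=> s; exact: frozen_ser_le.
Qed.

(** The Cauchy estimate of the frozen means in the limit. *)
Lemma adam_field_err i t j :
  `|fmean i t j - F t 0 j| <= field_err alpha beta epsilon growth kappa `|t| * rho ^+ i.
Proof.
have h : `|fmean i t j - fmean (n + i)%N t j| @[n --> \oo] --> `|fmean i t j - F t 0 j|.
  apply: cvg_norm; apply: cvgB; first exact: cvg_cst.
  by have := @frozen_mean_cvg t j; rewrite -(cvg_shiftn i).
apply: (cvgr_to_le h); apply: nearW => n; rewrite distrC addnC.
exact: (frozen_mean_cauchy epsilon_gt0 alpha_ge0 alpha_lt1 alpha2_lt_beta beta_lt1 p_ge1
  X_meas (iid_path_law V_iid) distribution_setT path_growth).
Qed.

Lemma adam_field_lip r t t' j : `|t| <= r -> `|t'| <= r ->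
  `|F t 0 j - F t' 0 j| <= field_lip alpha beta epsilon lip r * `|t - t'|.
Proof.
move=> tr tr'.
have h : `|fmean n t j - fmean n t' j| @[n --> \oo] --> `|F t 0 j - F t' 0 j|.
  by apply: cvg_norm; apply: cvgB; exact: frozen_mean_cvg.
apply: (cvgr_to_le h); apply: nearW => n.
exact: (frozen_mean_lip epsilon_gt0 alpha_ge0 alpha_lt1 alpha2_lt_beta beta_lt1 p_ge1
  X_meas path_lip).
Qed.

Lemma adam_field_le t : `|F t| <= C0.
Proof.
apply: rv_norm_le => [|j]; first exact: adam_speed_ge0.
have h : `|fmean n t j| @[n --> \oo] --> `|F t 0 j|.
  by apply: cvg_norm; exact: frozen_mean_cvg.
apply: (cvgr_to_le h); apply: nearW => n.
exact: frozen_mean_le.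
Qed.

End AdamField.

(** * The algorithm follows the vector field *)

Section AdamFollowsField.
Context {R : realType} {dU : measure_display} {cU : measurableType dU} {d : nat}.
Context (X : cU -> 'rV[R]_d -> 'rV[R]_d) (gamma : nat -> R).
Context (alpha beta epsilon p : R) (start : 'rV[R]_d).
Context {dO : measure_display} {O : measurableType dO} (P : probability O R).
Context (U : {RV P >-> cU}).

Lemma adam_algorithm_path {dA : measure_display} {OA : measurableType dA}
    (PT : probability OA R) (theta : nat -> OA -> 'rV[R]_d) :
  adam_algorithm X U gamma alpha beta epsilon start PT theta ->
  exists2 Us : nat -> {RV PT >-> cU}, iid_copies U Us &
    forall n w, theta n w =
      adam_pos X gamma alpha beta epsilon start (sample_path Us w) n.
Proof.
move=> [Us [m [v [Us_iid init step]]]]; exists (fun n => Us n.+1) => // n w.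
suff E : adam_state X gamma alpha beta epsilon start
    (sample_path (fun n => Us n.+1) w) n = (theta n w, m n w, v n w) by rewrite /adam_pos E.
elim: n => [|n IH] /=; first by have [-> -> ->] := init w.
rewrite IH; congr (_, _, _).
- apply/rowP => j; rewrite !mxE.
  have [hm hv ->] := step n w j; rewrite hm hv !mxE /adam_ratio.
  by congr (_ + _); rewrite -!mulrA; congr (_ * _); rewrite mulrC.
(* Without coordinates all vectors are equal. *)
- have [j|no] := pickP 'I_d; first by have [-> _ _] := step n w j.
  by apply/rowP => j; have := no j.
- by apply/rowP => j; rewrite !mxE; have [_ -> _] := step n w j.
Qed.

Hypotheses (epsilon_gt0 : 0 < epsilon).
Hypotheses (alpha_ge0 : 0 <= alpha) (alpha_lt1 : alpha < 1).
Hypotheses (alpha2_lt_beta : alpha ^+ 2 < beta) (beta_lt1 : beta < 1).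
Hypothesis p_ge1 : 1 <= p.
Hypothesis X_meas : product_measurable X.
Hypothesis X_reg : locally_regular X p U.
Hypothesis gamma_gt0 : forall n, (1 <= n)%N -> 0 < gamma n.
Hypothesis gamma_decr : forall m n, (1 <= m)%N -> (m <= n)%N -> gamma n <= gamma m.
Hypothesis gamma_cvg0 : gamma n @[n --> \oo] --> 0.
Hypothesis gamma_unbounded : forall B, exists m, B <= \sum_(0 <= k < m) gamma k.+1.
Hypothesis gamma_summable : exists B, forall m,
  \sum_(0 <= k < m) gamma k.+1 `^ (1 + p / 3) <= B.
Context {dV : measure_display} {OV : measurableType dV} (PV : probability OV R).
Context (V : nat -> {RV PV >-> cU}).
Hypothesis V_iid : iid_copies U V.
Context {dA : measure_display} {OA : measurableType dA} (PT : probability OA R).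
Context (theta : nat -> OA -> 'rV[R]_d).
Hypothesis theta_adam : adam_algorithm X U gamma alpha beta epsilon start PT theta.

Local Notation C0 := (adam_speed alpha beta).
Local Notation F := (adam_field X alpha beta epsilon V).

(** The field is defined by one i.i.d. sequence and the algorithm is driven by
    another; they have the same law on sequences, which is all that matters. *)
Theorem adam_follows_field : exists L C : R -> R,
  [/\ forall t, `|F t| <= C0,
      forall r, 0 <= L r,
      forall r t t', `|t| <= r -> `|t'| <= r -> `|F t - F t'| <= L r * `|t - t'| &
      forall r h, 0 < h -> h <= 1 ->
        {ae PT, forall w, euler_windows F C0 r (C r) h (theta ^~ w)}].
Proof.
have p0 : 0 <= p by rewrite (le_trans ler01).
have [growth [kappa [lip [kappa0 lip0 growthP lipP]]]] := regular_bounds p0 X_meas X_reg.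
pose L := field_lip alpha beta epsilon lip.
have L0 r : 0 <= L r by exact: field_lip_ge0.
have F_lip := adam_field_lip epsilon_gt0 alpha_ge0 alpha_lt1 alpha2_lt_beta beta_lt1 p_ge1
  X_meas V_iid growthP lipP.
exists L, (window_const alpha beta epsilon lip); split => //.
- exact: (adam_field_le epsilon_gt0 alpha_ge0 alpha_lt1 alpha2_lt_beta beta_lt1 p_ge1
    X_meas V_iid growthP).
- move=> r t t' tr tr'; apply: rv_norm_le => [|j]; first by rewrite mulr_ge0.
  have -> : (F t - F t') 0 j = F t 0 j - F t' 0 j by rewrite !mxE.
  exact: F_lip.
move=> r h h0 h1; have [Us Us_iid thetaE] := adam_algorithm_path theta_adam.
have nuP := iid_path_law V_iid.
have := euler_windows_ae start epsilon_gt0 alpha_ge0 alpha_lt1 alpha2_lt_beta beta_lt1 p_ge1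
  X_meas gamma_gt0 gamma_decr gamma_cvg0 gamma_unbounded gamma_summable nuP
  (distribution_setT U) kappa0 lip0 (path_growth X_meas V_iid growthP)
  (path_lip X_meas V_iid lipP)
  (adam_field_err epsilon_gt0 alpha_ge0 alpha_lt1 alpha2_lt_beta beta_lt1 p_ge1
    X_meas V_iid growthP) F_lip h0 h1 r.
move=> /(ae_sample_path Us_iid nuP); apply: filterS => w.
by rewrite (_ : adam_pos _ _ _ _ _ _ _ = theta ^~ w)//; apply/funext => n.
Qed.

End AdamFollowsField.

(** * The semiflow and its Euler approximation *)

Section SemiflowBounds.
Context {R : realType} {d : nat}.
Context (F : 'rV[R]_d -> 'rV[R]_d) (Psi : R -> 'rV[R]_d -> 'rV[R]_d).
Hypothesis Psi_flow : semiflow F Psi.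
Implicit Types (x : 'rV[R]_d) (r s t : R) (j : 'I_d).

Lemma semiflow_derive x t j : 0 < t ->
  is_derive t 1 (fun s => Psi s x 0 j) (F (Psi t x) 0 j).
Proof.
move=> t0; have [_ _ /(_ t t0) dP] := Psi_flow x.
have /derivable_mxP dj := @ex_derive _ _ _ _ _ _ _ dP.
apply: DeriveDef; first exact: dj.
have := @derive_val _ _ _ _ _ _ _ dP; rewrite derive_mx; last exact: ex_derive.
by move=> <-; rewrite mxE.
Qed.

(** The one-sided derivative at [0] gives the continuity there that the mean
    value theorem requires. *)
Lemma semiflow_cvg0 x j : Psi t x 0 j @[t --> 0^'+] --> x 0 j.
Proof.
have [P0 dP _] := Psi_flow x; rewrite P0 in dP.
have hj : h^-1 * (Psi h x 0 j - x 0 j) @[h --> 0^'+] --> F x 0 j.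
  have := cvg_comp _ _ dP (@coord_continuous _ 1 d 0 j (F x)).
  by apply: cvg_trans; apply: near_eq_cvg; apply: nearW => h /=; rewrite !mxE.
have h0 : (h : R) @[h --> 0^'+] --> 0 by exact: cvg_at_right_filter cvg_id.
have : h * (h^-1 * (Psi h x 0 j - x 0 j)) + x 0 j @[h --> 0^'+] --> 0 * F x 0 j + x 0 j.
  by apply: cvgD; [exact: cvgM|exact: cvg_cst].
rewrite mul0r add0r; apply: cvg_trans; apply: near_eq_cvg; near=> h => /=.
rewrite mulrA mulfV ?mul1r ?subrK// gt_eqF//.
Unshelve. all: by end_near. Qed.

Lemma semiflow_mvt x j s t : 0 <= s -> s < t ->
  exists2 c, s < c < t & Psi t x 0 j - Psi s x 0 j = F (Psi c x) 0 j * (t - s).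
Proof.
move=> s0 st.
have cont u : 0 < u -> {for u, continuous (fun w => Psi w x 0 j)}.
  move=> u0; apply: differentiable_continuous; apply/derivable1_diffP.
  exact: (@ex_derive _ _ _ _ _ _ _ (semiflow_derive x j u0)).
have [c|/=|c] := @MVT R (fun u => Psi u x 0 j) (fun u => F (Psi u x) 0 j) s t st.
- by rewrite in_itv /= => /andP[sc _]; apply: semiflow_derive; exact: le_lt_trans sc.
- apply/(continuous_within_itvP _ st); split.
  + by move=> u; rewrite in_itv /= => /andP[su _]; apply: cont; exact: le_lt_trans su.
  + move: s0; rewrite le_eqVlt => /predU1P[<-|s0].
      by have [-> _ _] := Psi_flow x; exact: semiflow_cvg0.
    exact/cvg_at_right_filter/cont.
  + apply/cvg_at_left_filter/cont; exact: le_lt_trans st.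
- by rewrite in_itv /= => sct ->; exists c.
Qed.

Context (v : R) (L : R -> R).
Hypothesis F_le : forall x, `|F x| <= v.
Hypothesis L_ge0 : forall r, 0 <= L r.
Hypothesis F_lip : forall r (x x' : 'rV[R]_d), `|x| <= r -> `|x'| <= r ->
  `|F x - F x'| <= L r * `|x - x'|.

Let v0 : 0 <= v. Proof. exact: le_trans (F_le 0). Qed.

Lemma semiflow_dist_le x s t : 0 <= s -> s <= t -> `|Psi t x - Psi s x| <= v * (t - s).
Proof.
move=> s0; rewrite le_eqVlt => /predU1P[->|st]; first by rewrite !subrr normr0 mulr0.
have st0 : 0 <= t - s by rewrite subr_ge0 ltW.
apply: rv_norm_le => [|j]; first exact: mulr_ge0.
rewrite !mxE; have [c _ ->] := semiflow_mvt x j s0 st.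
rewrite normrM (ger0_norm st0) ler_wpM2r//.
exact: le_trans (rv_coord_le _ _) (F_le _).
Qed.

Lemma semiflow_norm_le x t : 0 <= t -> `|Psi t x| <= `|x| + v * t.
Proof.
move=> t0; have := semiflow_dist_le x (lexx 0) t0; have [-> _ _] := Psi_flow x.
rewrite subr0 => h; rewrite -[X in `|X|](subrK x) addrC.
by rewrite (le_trans (ler_normD _ _))// lerD2l.
Qed.

Lemma semiflow_euler r x s t : 0 <= s -> s <= t -> `|x| + v * t <= r ->
  `|Psi t x - Psi s x - (t - s) *: F (Psi s x)| <= L r * v * (t - s) ^+ 2.
Proof.
move=> s0; rewrite le_eqVlt => /predU1P[->|st] xr.
  by rewrite !subrr scale0r subrr normr0 expr0n mulr0.
have st0 : 0 <= t - s by rewrite subr_ge0 ltW.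
have K0 : 0 <= L r * v by exact: mulr_ge0.
apply: rv_norm_le => [|j]; first by rewrite mulr_ge0// sqr_ge0.
rewrite !mxE; have [c /andP[sc ct] ->] := semiflow_mvt x j s0 st.
have c0 : 0 <= c by rewrite (le_trans s0)// ltW.
have Pr u : 0 <= u -> u <= t -> `|Psi u x| <= r.
  move=> u0 ut; apply: (le_trans (semiflow_norm_le x u0)); apply: le_trans xr.
  by rewrite lerD2l ler_wpM2l.
rewrite [(t - s) * _]mulrC -mulrBl normrM (ger0_norm st0) expr2 [leRHS]mulrA.
rewrite ler_wpM2r//; have -> : F (Psi c x) 0 j - F (Psi s x) 0 j = (F (Psi c x) - F (Psi s x)) 0 j.
  by rewrite !mxE.
apply: (le_trans (rv_coord_le _ _)).
apply: (le_trans (F_lip (Pr c c0 (ltW ct)) (Pr s s0 (ltW st)))).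
rewrite -mulrA ler_wpM2l//; apply: (le_trans (semiflow_dist_le x s0 (ltW sc))).
by rewrite ler_wpM2l// lerD2r ltW.
Qed.

End SemiflowBounds.

(** * Shadowing the semiflow along the windows *)

Section Shadowing.
Context {R : realType} {d : nat}.
Context (F : 'rV[R]_d -> 'rV[R]_d) (Psi : R -> 'rV[R]_d -> 'rV[R]_d).
Hypothesis Psi_flow : semiflow F Psi.
Context (v : R) (L : R -> R).
Hypothesis F_le : forall x, `|F x| <= v.
Hypothesis L_ge0 : forall r, 0 <= L r.
Hypothesis F_lip : forall r (x x' : 'rV[R]_d), `|x| <= r -> `|x'| <= r ->
  `|F x - F x'| <= L r * `|x - x'|.

Let v0 : 0 <= v. Proof. exact: le_trans (F_le 0). Qed.

Lemma shadowing_step r x a (z z' : 'rV[R]_d) t tau h c :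
  0 <= t -> 0 <= h -> h <= tau -> tau <= 2 * h -> `|x| + v * (t + tau) <= r -> `|z| <= r ->
  0 <= c -> `|z' - z - tau *: F z| <= c * h ^+ 2 ->
  `|z - Psi t x| <= a ->
  `|z' - Psi (t + tau) x| <= (1 + L r * tau) * a + (c + 4 * (L r * v)) * h * tau.
Proof.
move=> t0 h0 ht t2 xr zr c0 zz' za.
have tau0 : 0 <= tau by exact: le_trans ht.
have le1 : t <= t + tau by rewrite lerDl.
have e1 := semiflow_euler Psi_flow F_le L_ge0 F_lip t0 le1 xr.
have Pr : `|Psi t x| <= r.
  apply: (le_trans (semiflow_norm_le Psi_flow F_le x t0)); apply: le_trans xr.
  by rewrite lerD2l ler_wpM2l.
have e2 := F_lip zr Pr.
have tE : t + tau - t = tau by rewrite addrAC subrr add0r.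
rewrite tE in e1.
have -> : z' - Psi (t + tau) x = (z' - z - tau *: F z) -
    (Psi (t + tau) x - Psi t x - tau *: F (Psi t x)) +
    (z - Psi t x + tau *: (F z - F (Psi t x))).
  rewrite scalerBr; apply/rowP => j; rewrite !mxE; ring.
apply: (le_trans (ler_normD _ _)).
apply: (le_trans (lerD (ler_normB _ _) (ler_normD _ _))).
rewrite normrZ (ger0_norm tau0).
have e3 : tau * `|F z - F (Psi t x)| <= tau * (L r * a).
  rewrite ler_wpM2l//; apply: (le_trans e2); exact: ler_wpM2l.
have e4 : c * h ^+ 2 <= c * (h * tau) by rewrite ler_wpM2l// expr2 ler_wpM2l.
have e5 : L r * v * tau ^+ 2 <= L r * v * (2 * h * tau).
  by apply: ler_wpM2l; [exact: mulr_ge0|rewrite expr2 ler_wpM2r].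
have e6 : 0 <= L r * v * (h * tau) by rewrite !mulr_ge0.
move: za zz' e1 e3 e4 e5 e6; set A := `|_|; set B := `|_|; set D := `|_|.
by move=> za zz' e1 e3 e4 e5 e6; nra.
Qed.

(** A discrete Gronwall inequality: the error [a] at the beginning and the errors
    of the Euler steps, of total order [h * T], are amplified by at most
    [expR (L r * T)]. The radius [r] has room for the distance that the points
    cover at speed [v] on windows of duration at most twice their lower
    bound. *)
Lemma shadowing r c h (z : nat -> 'rV[R]_d) (tau : nat -> R) x a T n :
  0 <= h -> 0 <= c -> (forall k, h <= tau k <= 2 * h) ->
  (forall k, `|z k.+1 - z k| <= v * (2 * h)) ->
  (forall k, `|z k| <= r -> `|z k.+1 - z k - tau k *: F (z k)| <= c * h ^+ 2) ->
  0 <= a -> `|z 0%N - x| <= a -> `|x| + a + 2 * v * T <= r ->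
  \sum_(k < n) tau k <= T ->
  `|z n - Psi (\sum_(k < n) tau k) x| <=
    expR (L r * T) * (a + (c + 4 * (L r * v)) * h * T).
Proof.
move=> h0 c0 htau hz hE a0 xa xr; set A := (c + 4 * (L r * v)) * h.
have A0 : 0 <= A.
  by apply: mulr_ge0 => //; apply: addr_ge0 => //; apply: mulr_ge0 => //; exact: mulr_ge0.
have tau0 k : 0 <= tau k by have /andP[+ _] := htau k; exact: le_trans.
pose t n := \sum_(k < n) tau k; rewrite -/(t n) => tT.
have t0 m : 0 <= t m by apply: sumr_ge0.
have tS m : t m.+1 = t m + tau m by rewrite /t big_ord_recr.
have zr m : `|z m - z 0%N| <= v * (2 * t m).
  elim: m => [|m IH]; first by rewrite subrr normr0 !mulr_ge0.
  rewrite -(subrKA (z m)) (le_trans (ler_normD _ _))// tS.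
  have /andP[h1 _] := htau m.
  have h2 : v * (2 * h) <= v * (2 * tau m) by rewrite ler_wpM2l// ler_wpM2l.
  by have := le_trans (hz m) h2; lra.
suff H m : t m <= T -> `|z m - Psi (t m) x| <= expR (L r * t m) * (a + A * t m).
  have Lt : L r * t n <= L r * T by rewrite ler_wpM2l.
  apply: (le_trans (H n tT)); apply: ler_pM; rewrite ?expR_ge0 ?ler_expR//.
    by apply: addr_ge0 => //; exact: mulr_ge0.
  by rewrite lerD2l ler_wpM2l.
elim: m => [_|m IH].
  rewrite /t big_ord0 !mulr0 expR0 mul1r addr0.
  by have [-> _ _] := Psi_flow x.
move=> mT; have mT' : t m <= T by apply: le_trans mT; rewrite tS lerDl.
have /andP[h1 h2] := htau m.
have zmr : `|z m| <= r.
  have -> : z m = (z m - z 0%N) + (z 0%N - x) + x by rewrite subrKA subrK.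
  apply: (le_trans (ler_normD _ _)); apply: le_trans xr.
  have : v * (2 * t m) <= v * (2 * T) by rewrite ler_wpM2l// ler_wpM2l.
  by have := ler_normD (z m - z 0%N) (z 0%N - x); have := zr m; have := xa; lra.
have xr' : `|x| + v * (t m + tau m) <= r.
  rewrite -tS; apply: le_trans xr.
  have : v * t m.+1 <= v * T by rewrite ler_wpM2l.
  have : 0 <= v * t m.+1 by rewrite mulr_ge0.
  by lra.
rewrite tS; apply: (le_trans (shadowing_step (t0 m) h0 h1 h2 xr' zmr c0 (hE m zmr) (IH mT'))).
have -> : expR (L r * (t m + tau m)) = expR (L r * t m) * expR (L r * tau m).
  by rewrite -expRD -mulrDr.
rewrite -/A; set E := expR (L r * t m).
have E1 : 1 <= E by rewrite -expR0 ler_expR mulr_ge0.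
have Et : 1 + L r * tau m <= expR (L r * tau m) by exact: expR_ge1Dx.
have ge0 : 0 <= E * (a + A * t m).
  by apply: mulr_ge0; [exact: expR_ge0|apply: addr_ge0 => //; exact: mulr_ge0].
have Lt0 : 0 <= L r * tau m by exact: mulr_ge0.
have k1 := ler_wpM2r ge0 Et.
have EE : 1 <= E * expR (L r * tau m).
  by rewrite -[leLHS]mul1r; apply: ler_pM => //; lra.
have k2 : A * tau m <= E * expR (L r * tau m) * (A * tau m).
  by rewrite ler_peMl// mulr_ge0.
by move: k1 k2; lra.
Qed.

End Shadowing.

(** * Convergence to the attractor *)

Lemma exists_window (G : nat -> nat) K n : (forall k, (G k < G k.+1)%N) ->
  (G K <= n)%N -> exists2 i, (K <= i)%N & (G i <= n < G i.+1)%N.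
Proof.
move=> GS; elim: n => [|n IH].
  by move=> GK; exists K => //; rewrite GK /= (leq_ltn_trans _ (GS K)).
rewrite leq_eqVlt => /predU1P[<-|]; first by exists K; rewrite ?leqnn ?GS.
rewrite ltnS => /IH[i Ki /andP[i1 i2]].
move: i2; rewrite leq_eqVlt => /predU1P[iE|i2].
  by exists i.+1; [exact: leqW|rewrite iE leqnn GS].
by exists i => //; rewrite i2 andbT leqW.
Qed.

Section Attraction.
Context {R : realType} {d : nat}.
Context (F : 'rV[R]_d -> 'rV[R]_d) (Psi : R -> 'rV[R]_d -> 'rV[R]_d).
Hypothesis Psi_flow : semiflow F Psi.
Context (v : R) (L C : R -> R).
Hypothesis F_le : forall x, `|F x| <= v.
Hypothesis L_ge0 : forall r, 0 <= L r.
Hypothesis F_lip : forall r (x x' : 'rV[R]_d), `|x| <= r -> `|x'| <= r ->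
  `|F x - F x'| <= L r * `|x - x'|.
Context (D : set 'rV[R]_d) (star : 'rV[R]_d).
Hypothesis D_compact : compact D.
Hypothesis star_int : D° star.
Hypothesis Psi_cvg :
  {uniform D, Psi t @[t --> +oo] --> (fun _ : 'rV[R]_d => star)}.
Variable y : nat -> 'rV[R]_d.
Hypothesis y_windows : forall r q : nat,
  euler_windows F v r%:R (C r%:R) q.+1%:R^-1 y.
Hypothesis y_returns : forall N, exists2 n, (N <= n)%N & D (y n).

Let v0 : 0 <= v. Proof. exact: le_trans (F_le 0). Qed.

Lemma uniform_attraction e : 0 < e ->
  exists2 T, 0 < T & forall t x, T <= t -> D x -> `|Psi t x - star| <= e.
Proof.
move=> e0.
pose E : set ('rV[R]_d * 'rV[R]_d) := [set z | ball z.1 e z.2].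
have entE : entourage E by rewrite -entourage_ballE; exists e.
have := Psi_cvg.
move=> /(_ [set h : {uniform` D -> 'rV[R]_d} | forall x, D x -> E (star, h x)]) [].
  by apply/(@uniform_nbhs 'rV[R]_d D 'rV[R]_d (fun=> star)); exists E; split=> [|h].
move=> M [_ hM]; exists (Num.max 1 (M + 1)); first by rewrite lt_max ltr01.
move=> t x; rewrite ge_max => /andP[_ Mt] Dx.
have /hM/(_ x Dx) : M < t by rewrite (lt_le_trans _ Mt)// ltrDl.
by rewrite /E /= mx_norm_ball /ball_ /= distrC => /ltW.
Qed.

Lemma compact_norm_le : exists r0, forall x, D x -> `|x| <= r0.
Proof.
have [M [_ hM]] := compact_bounded D_compact.
by exists (M + 1) => x; apply: hM; rewrite ltrDl.
Qed.

(** The flow needs time [T], hence at most [I] windows, to bring the compact set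
    into a ball around the attractor. The [I]-th to [2 * I]-th grid points after
    a point near the compact set lie in a larger ball that is still inside the
    compact set; so each of them can serve as a new starting point, and by
    induction all grid points from the [I]-th on lie in that ball. The window
    length [h] is chosen last, small enough for the shadowing error over the
    time [T'] that [2 * I] windows may last. *)
Lemma attracted e : 0 < e -> (forall x, `|x - star| <= e -> D x) ->
  exists N, forall n, (N <= n)%N -> `|y n - star| <= 2 * e.
Proof.
move=> e0 eD; have e20 : 0 < e / 2 by rewrite divr_gt0.
have [T T0 hT] := uniform_attraction e20; have [r0 hr0] := compact_norm_le.
pose T' := 4 * (T + 1); have T'0 : 0 <= T' by rewrite mulr_ge0// addr_ge0// ltW.
pose r := (Num.truncn (r0 + 1 + 2 * v * T')).+1.
have rP : r0 + 1 + 2 * v * T' <= r%:R.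
  by rewrite ltW// truncnS_gt.
pose c := Num.max 0 (C r%:R); have c0 : 0 <= c by rewrite le_max lexx.
pose A := c + 4 * (L r%:R * v).
have A0 : 0 <= A by apply: addr_ge0 => //; apply: mulr_ge0 => //; exact: mulr_ge0.
pose B := expR (L r%:R * T') * (2 * v + A * T').
have B0 : 0 <= B.
  by apply: mulr_ge0; [exact: expR_ge0|apply: addr_ge0; exact: mulr_ge0].
have m0 : 0 < Num.min 1 (e / 2) / (B + 2 * v + 1).
  by rewrite divr_gt0 ?lt_min ?ltr01// ltr_wpDl// addr_ge0// mulr_ge0.
have [q] := ltr_add_invr m0; rewrite add0r; set h := q.+1%:R^-1 => hm.
have h0 : 0 < h by rewrite invr_gt0.
have h1 : h <= 1 by rewrite invf_le1// ler1n.
have [hB [hv hve]] : h * B <= e / 2 /\ v * (2 * h) <= 1 /\ v * (2 * h) <= e.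
  rewrite ltr_pdivlMr in hm; last by rewrite ltr_wpDl// addr_ge0// mulr_ge0.
  have := hm; rewrite lt_min => /andP[k1 k2].
  have p1 : 0 <= h * B by rewrite mulr_ge0// ltW.
  have p2 : 0 <= h * v by rewrite mulr_ge0// ltW.
  by split; [|split]; nra.
have [G [tau [K [G0 GS hG]]]] := y_windows r q; rewrite -/h in hG.
pose I := (Num.truncn (T / h)).+1.
have /andP[I1 I2] : T <= h * I%:R <= T + h.
  have /andP[t1 t2] := truncn_itv (ltW (divr_gt0 T0 h0)).
  rewrite /I; apply/andP; split.
    by rewrite mulrC -ler_pdivrMr// ltW.
  by rewrite -natr1 mulrDr mulr1 lerD2r mulrC -ler_pdivlMr.
pose z k := y (G k).
have htau k : (K <= k)%N -> h <= tau k <= 2 * h by move=> /hG[].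
(* A grid point near the compact set shadows the semiflow from there. *)
have claim i x0 k : (K <= i)%N -> D x0 -> `|z i - x0| <= v * (2 * h) ->
    (I <= k <= 2 * I)%N -> `|z (i + k)%N - star| <= e.
  move=> Ki Dx zx /andP[Ik kI].
  have Kik l : (K <= i + l)%N by rewrite (leq_trans Ki)// leq_addr.
  pose t := \sum_(l < k) tau (i + l)%N.
  have tT : t <= T'.
    apply: (@le_trans _ _ (\sum_(l < k) 2 * h)).
      by apply: ler_sum => l _; have /andP[] := htau _ (Kik l).
    rewrite sumr_const card_ord -mulr_natl.
    have : k%:R * (2 * h) <= (2 * I)%:R * (2 * h).
      by rewrite ler_wpM2r ?mulr_ge0 ?(ltW h0)// ler_nat.
    by rewrite natrM /T'; lra.
  have Tt : T <= t.
    apply: (le_trans I1); apply: (@le_trans _ _ (\sum_(l < k) h)).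
      by rewrite sumr_const card_ord -[leRHS]mulr_natl [leLHS]mulrC ler_wpM2r ?(ltW h0)// ler_nat.
    by apply: ler_sum => l _; have /andP[] := htau _ (Kik l).
  have vh0 : 0 <= v * (2 * h) by rewrite !mulr_ge0// ltW.
  have := @shadowing _ _ _ _ Psi_flow _ _ F_le L_ge0 F_lip r%:R c h
    (fun l => z (i + l)%N) (fun l => tau (i + l)%N) x0 (v * (2 * h)) T' k (ltW h0) c0.
  rewrite addn0 -/t -/A => /(_ _ _ _ vh0 zx _ tT) sh.
  have {}sh : `|z (i + k)%N - Psi t x0| <= expR (L r%:R * T') * (v * (2 * h) + A * h * T').
    apply: sh => [l|l|l zr|].
    - exact: htau.
    - rewrite addnS; have [_ + _] := hG _ (Kik l); apply.
      by rewrite leqnn andbT ltnW.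
    - rewrite addnS; have [_ _ /(_ zr)] := hG _ (Kik l) => /le_trans; apply.
      by rewrite ler_wpM2r ?sqr_ge0// le_max lexx orbT.
    - by apply: le_trans rP; rewrite lerD2r lerD// hr0.
  rewrite -(subrKA (Psi t x0)) (le_trans (ler_normD _ _))//.
  have E : expR (L r%:R * T') * (v * (2 * h) + A * h * T') = h * B by rewrite /B; ring.
  rewrite E in sh; have := hT t x0 Tt Dx; move: sh; have := hB; lra.
have [n0 n0K Dn0] := y_returns (G K).
have [i Ki /andP[i1 i2]] := exists_window GS n0K.
have zi : `|z i - y n0| <= v * (2 * h).
  by rewrite distrC; have [_ + _] := hG i Ki; apply; rewrite i1 ltnW.
have late k : (I <= k)%N -> `|z (i + k)%N - star| <= e.
  elim/ltn_ind: k => k IH Ik; case: (leqP k (2 * I)) => kI.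
    by apply: (claim i (y n0)) => //; rewrite Ik.
  have Ik' : (I <= k - I)%N by rewrite leq_subRL// addnn -mul2n ltnW.
  have kI' : (k - I < k)%N by rewrite ltn_subrL /= (leq_trans _ Ik).
  have -> : (i + k = i + (k - I) + I)%N by rewrite -addnA subnK.
  apply: (claim _ (z (i + (k - I))%N)).
  - by rewrite (leq_trans Ki)// leq_addr.
  - by apply: eD; exact: IH.
  - by rewrite subrr normr0 !mulr_ge0// ltW.
  - by rewrite leqnn mul2n -addnn leq_addr.
exists (G (i + I)%N) => n nG.
have [j] := exists_window GS nG.
move=> ij /andP[j1 j2].
have ij' : (i <= j)%N by rewrite (leq_trans _ ij)// leq_addr.
have zj : `|z j - star| <= e.
  by have := late (j - i)%N; rewrite subnKC// leq_subRL//; apply.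
have yj : `|y n - z j| <= v * (2 * h).
  by have [_ + _] := hG j (leq_trans Ki ij'); apply; rewrite j1 ltnW.
by have := ler_distD (z j) (y n) star; move: yj zj; have := hve; lra.
Qed.

Theorem windows_cvg : y n @[n --> \oo] --> star.
Proof.
have /nbhs_ballP[e0 /= e00 eD] := star_int.
apply/cvgrPdist_le => e e_gt0.
pose e' := Num.min (e / 2) (e0 / 2).
have e'0 : 0 < e' by rewrite lt_min !divr_gt0.
have eD' x : `|x - star| <= e' -> D x.
  rewrite le_min => /andP[_ h]; apply: eD; rewrite mx_norm_ball /ball_ /= distrC.
  by apply: (le_lt_trans h); lra.
have [N hN] := attracted e'0 eD'; exists N => // n /= /hN.
rewrite distrC => /le_trans; apply.
have : e' <= e / 2 by rewrite ge_min lexx.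
by lra.
Qed.

End Attraction.

(** * Step sizes *)

Section StepSizes.
Context {R : realType} (gamma : nat -> R).
Hypothesis gamma_gt0 : forall n, (1 <= n)%N -> 0 < gamma n.

Lemma partial_sum_shift (u : nat -> R) m :
  (\sum_(1 <= n < m.+1) (u n)%:E)%E = (\sum_(0 <= k < m) u k.+1)%:E.
Proof. by rewrite big_add1 /= sumEFin. Qed.

Lemma nonsummable_unbounded : (\sum_(1 <= n <oo) (gamma n)%:E = +oo)%E ->
  forall B, exists m, B <= \sum_(0 <= k < m) gamma k.+1.
Proof.
move=> sumoo B; apply: contrapT => /forallNP H.
suff : (\sum_(1 <= n <oo) (gamma n)%:E <= B%:E)%E by rewrite sumoo leye_eq.
apply: lime_le; first by apply: is_cvg_nneseries => n n1 _; rewrite lee_fin ltW// gamma_gt0.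
apply: nearW => -[|m]; last first.
  by rewrite partial_sum_shift lee_fin; apply/ltW; rewrite ltNge; apply/negP/H.
rewrite big_geq// lee_fin; have := H 0%N; rewrite big_geq// => /negP; rewrite -ltNge.
exact: ltW.
Qed.

Lemma summable_bounded a : (\sum_(1 <= n <oo) (gamma n `^ a)%:E < +oo)%E ->
  exists B, forall m, \sum_(0 <= k < m) gamma k.+1 `^ a <= B.
Proof.
move=> fin; have ge0 n : (1 <= n)%N -> true -> (0 <= (gamma n `^ a)%:E)%E.
  by rewrite lee_fin powR_ge0.
exists (fine (\sum_(1 <= n <oo) (gamma n `^ a)%:E)%E) => m.
rewrite -lee_fin fineK; last first.
  by rewrite ge0_fin_numE// nneseries_ge0.
rewrite -(partial_sum_shift (fun n => gamma n `^ a)).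
exact: nneseries_lim_ge.
Qed.

End StepSizes.

(** * Almost sure convergence of Adam *)
Theorem corollary1p11 (R : realType) (epsilon alpha beta p : R)
    (epsilon_gt0 : 0 < epsilon)
    (alpha_ge0 : 0 <= alpha) (alpha_lt1 : alpha < 1)
    (alpha2_lt_beta : alpha ^+ 2 < beta) (beta_lt1 : beta < 1)
    (p_ge2 : 2 <= p)
    (* step sizes gamma 1, gamma 2, and so on; gamma 0 plays no role *)
    (gamma : nat -> R)
    (gamma_gt0 : forall n, (1 <= n)%N -> 0 < gamma n)
    (gamma_decr : forall m n, (1 <= m)%N -> (m <= n)%N -> gamma n <= gamma m)
    (gamma_cvg0 : gamma n @[n --> \oo] --> 0)
    (gamma_nonsummable : (\sum_(1 <= n <oo) (gamma n)%:E = +oo)%E)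
    (gamma_liminf :
      (0 < ereal_sup [set limn_einf (fun n : nat =>
             ((gamma n)^-1 *
              gamma (n + `|Num.ceil ((gamma n)^-1 * e)|)%N)%:E)
           | e in [set e : R | (0 < e)%R]])%E)
    (gamma_summable :
      (\sum_(1 <= n <oo) (gamma n `^ (1 + p / 3))%:E < +oo)%E)
    (d : nat) (d_gt0 : (0 < d)%N) (start : 'rV[R]_d)
    (* the innovation *)
    (dU : measure_display) (cU : measurableType dU)
    (dO : measure_display) (O : measurableType dO) (P : probability O R)
    (U : {RV P >-> cU}) (X : cU -> 'rV[R]_d -> 'rV[R]_d)
    (X_meas : product_measurable X) (X_reg : locally_regular X p U)
    (* the Adam algorithm *)
    (dA : measure_display) (OA : measurableType dA) (PA : probability OA R)
    (theta : nat -> OA -> 'rV[R]_d)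
    (theta_adam : adam_algorithm X U gamma alpha beta epsilon start PA theta)
    (* the Adam vector field, written with i.i.d. copies V of U *)
    (dV : measure_display) (OV : measurableType dV) (PV : probability OV R)
    (V : nat -> {RV PV >-> cU}) (V_iid : iid_copies U V)
    (Psi : R -> 'rV[R]_d -> 'rV[R]_d)
    (Psi_flow : semiflow (adam_field X alpha beta epsilon V) Psi)
    (D : set 'rV[R]_d) (D_compact : compact D)
    (theta_star : 'rV[R]_d) (theta_star_int : D° theta_star)
    (Psi_cvg :
      {uniform D, Psi t @[t --> +oo] --> (fun _ : 'rV[R]_d => theta_star)}) :
  {ae PA, forall w,
     (forall N : nat, exists2 n : nat, (N <= n)%N & D (theta n w)) ->
     theta n w @[n --> \oo] --> theta_star}.
Proof.
have p_ge1 : 1 <= p by rewrite (le_trans _ p_ge2)// ler1n.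
have [L [C [F_le L_ge0 F_lip windows]]] := adam_follows_field epsilon_gt0 alpha_ge0
  alpha_lt1 alpha2_lt_beta beta_lt1 p_ge1 X_meas X_reg gamma_gt0 gamma_decr gamma_cvg0
  (nonsummable_unbounded gamma_gt0 gamma_nonsummable) (summable_bounded gamma_summable)
  V_iid theta_adam.
have allwin : {ae PA, forall w, forall r q : nat, euler_windows
    (adam_field X alpha beta epsilon V) (adam_speed alpha beta) r%:R (C r%:R) q.+1%:R^-1
    (theta ^~ w)}.
  apply: ae_foralln => r; apply: ae_foralln => q; apply: windows.
    by rewrite invr_gt0.
  by rewrite invf_le1// ler1n.
apply: filterS allwin => w win visits.
exact: (windows_cvg Psi_flow F_le L_ge0 F_lip D_compact theta_star_int Psi_cvg win visits).
Qed.
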